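(* Let $n\ge1$ and $\beta>0$. The operator $\mathcal{A}^{-\beta}$ can be extended from $L^p(\mathbb{R}^n,\gamma_{-1})\cap L^2(\mathbb{R}^n,\gamma_{-1})$ to $L^p(\mathbb{R}^n,\gamma_{-1})$ as a bounded operator from $L^p(\mathbb{R}^n,\gamma_{-1})$ into itself, when $1<p<\infty$, and from $L^1(\mathbb{R}^n,\gamma_{-1})$ into $L^{1,\infty}(\mathbb{R}^n,\gamma_{-1})$, when $p=1$.
   Context: $\mathbb{N}=\{0,1,2,\dots\}$. $\gamma_{-1}$ is the inverse Gaussian measure on $\mathbb{R}^n$, with density $\pi^{n/2}e^{|x|^2}$ with respect to Lebesgue measure; $L^{1,\infty}$ is the weak $L^1$ space. $\mathcal{A}$ is the closure in $L^2(\mathbb{R}^n,\gamma_{-1})$ of $\mathcal{A}_0f=-\frac12\Delta f-x\cdot\nabla f$, $f\in C_c^\infty(\mathbb{R}^n)$. Hermite polynomials: $H_m(z)=(-1)^me^{z^2}\frac{d^m}{dz^m}e^{-z^2}$; $H_k(x)=\prod_{i=1}^nH_{k_i}(x_i)$ for $k\in\mathbb{N}^n$, $\widetilde H_k(x)=e^{-|x|^2}H_k(x)$, $|k|=k_1+\dots+k_n$; $\mathcal{A}\widetilde H_k=(|k|+n)\widetilde H_k$. For $f\in L^2(\mathbb{R}^n,\gamma_{-1})$, $$c_k(f)=\frac{\pi^{n/2}}{\|\widetilde H_k\|^2_{L^2(\mathbb{R}^n,\gamma_{-1})}}\int_{\mathbb{R}^n}f(y)\widetilde H_k(y)e^{|y|^2}dy,\qquad\mathcal{A}^{-\beta}(f)=\sum_{k\in\mathbb{N}^n}\frac{c_k(f)}{(|k|+n)^\beta}\widetilde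 H_k,$$ the latter series converging in $L^2(\mathbb{R}^n,\gamma_{-1})$ and defining a bounded operator on $L^2(\mathbb{R}^n,\gamma_{-1})$. *)

(* Defs.v *)
From HB Require Import structures.
From mathcomp Require Import all_boot all_order all_algebra finmap.
From mathcomp Require Import all_classical all_reals all_analysis.
From mathcomp Require Import measurable_realfun summability.

Set Implicit Arguments.
Unset Strict Implicit.
Unset Printing Implicit Defensive.
Import Order.TTheory GRing.Theory Num.Def Num.Theory.
Import numFieldNormedType.Exports.

Local Open Scope classical_set_scope.
Local Open Scope ring_scope.

(* R^n, with the product sigma-algebra (the Borel sets) *)
Notation euclidean R n := (n.-tuple (measurableTypeR R)).

Lemma sigma_finite_product_measure1 d1 d2 (T1 : measurableType d1)
    (T2 : measurableType d2) (R : realType)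
    (m1 : {sigma_finite_measure set T1 -> \bar R})
    (m2 : {sigma_finite_measure set T2 -> \bar R}) :
  sigma_finite setT (m1 \x m2)%E.
Proof.
have /sigma_finiteP[F [TF ndF Foo]] := sigma_finiteT m1.
have /sigma_finiteP[G [TG ndG Goo]] := sigma_finiteT m2.
exists (fun n => F n `*` G n).
  rewrite -setXTT TF TG predeqE => -[x y]; split.
    move=> [/= [n _ Fnx] [k _ Gky]]; exists (maxn n k) => //; split.
    - by move: x Fnx; exact/subsetPset/ndF/leq_maxl.
    - by move: y Gky; exact/subsetPset/ndG/leq_maxr.
  by move=> [n _ []/= ? ?]; split; exists n.
move=> k; have [? ?] := Foo k; have [? ?] := Goo k.
split; first exact: measurableX.
by rewrite product_measure1E// lte_mul_pinfty// ge0_fin_numE.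
Qed.

Section lebesgue_measure_tuple.
Context {R : realType}.

Definition tuple_cons n (x : measurableTypeR R * euclidean R n) :
  euclidean R n.+1 := [tuple of x.1 :: x.2].

Definition tuple_uncons n (x : euclidean R n.+1) :
  measurableTypeR R * euclidean R n := (thead x, [tuple of behead x]).

Lemma tuple_consK n : cancel (@tuple_cons n) (@tuple_uncons n).
Proof. by case=> x t; congr pair; rewrite ?theadE//; apply/val_inj. Qed.

Lemma measurable_tuple_cons n : measurable_fun setT (@tuple_cons n).
Proof. exact: measurable_cons. Qed.

Lemma measurable_tuple_uncons n : measurable_fun setT (@tuple_uncons n).
Proof.
by apply: measurable_fun_pair; [exact: measurable_tnth|exact: measurable_behead].
Qed.

Section cons_measure.
Variables (n : nat) (m : {sigma_finite_measure set (euclidean R n) -> \bar R}).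

Definition cons_measure : set (euclidean R n.+1) -> \bar R :=
  pushforward (@lebesgue_measure R \x m)%E (@tuple_cons n).

Let cons_measure0 : cons_measure set0 = 0%E.
Proof. by rewrite /cons_measure /pushforward preimage_set0 measure0. Qed.

Let cons_measure_ge0 A : (0 <= cons_measure A)%E.
Proof. by rewrite /cons_measure /pushforward measure_ge0. Qed.

Let cons_measure_sigma_additive : semi_sigma_additive cons_measure.
Proof.
have mP A : measurable A -> measurable (@tuple_cons n @^-1` A).
  by move=> mA; rewrite -[X in measurable X]setTI; exact: measurable_tuple_cons.
move=> F mF tF mUF; rewrite /cons_measure /pushforward preimage_bigcup.
apply: measure_semi_sigma_additive.
- by move=> k; exact: mP.
- apply/trivIsetP => /= i j _ _ ij; rewrite -preimage_setI.
  by move/trivIsetP : tF => /(_ _ _ _ _ ij) ->//; rewrite preimage_set0.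
- by rewrite -preimage_bigcup; exact: mP.
Qed.

HB.instance Definition _ := isMeasure.Build _ _ _ cons_measure
  cons_measure0 cons_measure_ge0 cons_measure_sigma_additive.

Let cons_measure_sigma_finite : sigma_finite setT cons_measure.
Proof.
have [F FT mF] := sigma_finite_product_measure1 (@lebesgue_measure R) m.
exists (fun k => @tuple_uncons n @^-1` F k).
  by rewrite -preimage_bigcup -FT preimage_setT.
move=> k; have [mFk Fk] := mF k; split.
  by rewrite -[X in measurable X]setTI; exact: measurable_tuple_uncons.
rewrite /cons_measure /pushforward.
rewrite (_ : _ @^-1` _ = F k)//; apply/seteqP.
by split => x; rewrite /preimage/= tuple_consK.
Qed.

HB.instance Definition _ := Measure_isSigmaFinite.Build _ _ _ cons_measure
  cons_measure_sigma_finite.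

End cons_measure.

Fixpoint lebesgue_measure_tuple n :
    {sigma_finite_measure set (euclidean R n) -> \bar R} :=
  match n with
  | 0 => \d_([tuple] : euclidean R 0)
  | n'.+1 => cons_measure (lebesgue_measure_tuple n')
  end.

End lebesgue_measure_tuple.

Section inverse_gaussian.
Context {R : realType} {n : nat}.
Implicit Type x : euclidean R n.

Definition sqnorm x : R := \sum_(i < n) tnth x i ^+ 2.

Definition inverse_gaussian_density x : R :=
  pi `^ (n%:R / 2) * expR (sqnorm x).

Definition inverse_gaussian : set (euclidean R n) -> \bar R := fun A =>
  (\int[lebesgue_measure_tuple n]_(x in A) (inverse_gaussian_density x)%:E)%E.

Lemma inverse_gaussian_density_ge0 x : 0 <= inverse_gaussian_density x.
Proof. by rewrite mulr_ge0// ?powR_ge0 ?expR_ge0. Qed.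

Lemma measurable_inverse_gaussian_density :
  measurable_fun setT inverse_gaussian_density.
Proof.
apply: measurable_funM => //; apply: measurableT_comp => //.
apply: measurable_sum => i; apply: measurable_funX.
exact: measurable_tnth.
Qed.

Let inverse_gaussian0 : inverse_gaussian set0 = 0%E.
Proof. exact: integral_set0. Qed.

Let inverse_gaussian_ge0 A : (0 <= inverse_gaussian A)%E.
Proof.
by apply: integral_ge0 => x _; rewrite lee_fin inverse_gaussian_density_ge0.
Qed.

Let inverse_gaussian_sigma_additive : semi_sigma_additive inverse_gaussian.
Proof.
move=> F mF tF mUF; rewrite /inverse_gaussian/= ge0_integral_bigcup//=.
- apply: is_cvg_ereal_nneg_natsum => k _; apply: integral_ge0 => x _.
  by rewrite lee_fin inverse_gaussian_density_ge0.
- apply/measurable_EFinP; apply: measurable_funTS.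
  exact: measurable_inverse_gaussian_density.
- by move=> x _; rewrite lee_fin inverse_gaussian_density_ge0.
Qed.

HB.instance Definition _ := isMeasure.Build _ _ _ inverse_gaussian
  inverse_gaussian0 inverse_gaussian_ge0 inverse_gaussian_sigma_additive.

End inverse_gaussian.
Arguments inverse_gaussian R n : clear implicits.

Definition hermite {R : realType} (m : nat) (z : R) : R :=
  (-1) ^+ m * expR (z ^+ 2) * derive1n m (fun t : R => expR (- t ^+ 2)) z.

Section negative_powers.
Context {R : realType} {n : nat}.
Implicit Types (k : n.-tuple nat) (f g : euclidean R n -> R) (beta : R).

Local Notation gamma := (inverse_gaussian R n).

Definition multi_hermite k (x : euclidean R n) : R :=
  \prod_(i < n) hermite (tnth k i) (tnth x i : R).

Definition hermite_tilde k (x : euclidean R n) : R :=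
  expR (- sqnorm x) * multi_hermite k x.

Definition multi_index_size k : nat := (\sum_(i < n) tnth k i)%N.

Definition hermite_coef k f : R :=
  pi `^ (n%:R / 2) / fine 'N[gamma]_2%:E[EFin \o hermite_tilde k]%E ^+ 2 *
  \int[lebesgue_measure_tuple n]_y
    (f y * hermite_tilde k y * expR (sqnorm y)).

Definition negative_power_term beta f k (x : euclidean R n) : R :=
  hermite_coef k f / (multi_index_size k + n)%:R `^ beta * hermite_tilde k x.

Definition negative_power_sum beta f (K : {fset n.-tuple nat})
    (x : euclidean R n) : R :=
  \sum_(k <- K) negative_power_term beta f k x.

(* For f in L^2, g is a representative of the class A^{-beta} f: the series
   over N^n converges to g in L^2, along the finite subsets of N^n. *)
Definition is_negative_power beta f g : Prop :=
  g \in Lfun gamma 2%:E /\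
  (fun K => 'N[gamma]_2%:E[EFin \o (negative_power_sum beta f K \- g)%R])%E
    @ totally --> 0%E.

End negative_powers.

Section operators.
Context d (T : measurableType d) (R : realType).
Variable mu : {measure set T -> \bar R}.
Implicit Types f g : T -> R.

Definition weak_L1_norm f : \bar R :=
  ereal_sup [set t%:E * mu [set x | t < `|f x|]%R | t in [set t | 0 < t]%R]%E.

Definition weak_L1 : set (T -> R) :=
  [set f | measurable_fun setT f /\ (weak_L1_norm f < +oo)%E].

(* S acts on representatives and is linear up to null sets. For the norms used
   here, the bound at f - g then gives S f = S g a.e. whenever f = g a.e. *)
Definition bounded_linear_operator
    (E : set (T -> R)) (normE : (T -> R) -> \bar R)
    (F : set (T -> R)) (normF : (T -> R) -> \bar R)
    (S : (T -> R) -> (T -> R)) : Prop :=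
  [/\ forall f, E f -> F (S f),
      forall (a : R) f g, E f -> E g ->
        S (fun x => a * f x + g x) = (fun x => a * S f x + S g x) %[ae mu] &
      exists C : R, forall f, E f -> (normF (S f) <= C%:E * normE f)%E].

End operators.

(* Main.v *)
(** Write r = e^{-t}. The semigroup e^{-tA} has the Mehler kernel [mehler r],
    and A^{-b} f is the average Gamma(b)^{-1} \int_0^oo t^{b-1} e^{-tA} f dt.
    The kernel has mass one in y and is symmetric with respect to gamma_{-1},
    so every e^{-tA} contracts L^p(gamma_{-1}) and the part t <= t0 of the
    average is bounded on all L^p, t^{b-1} being integrable at 0. For t > t0
    the kernel has no singularity left. If p > 1 and t0 is large enough, it is
    at most r^n times a product of a Gaussian in x and one in y to which
    Hoelder's inequality applies. If p = 1, it is at most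
    r^n e^{|y|^2 - |x|^2} e^{-|y - r x|^2} up to a constant; after completing
    the integral in t to the whole line, the majorant of the operator is
    e^{-|x|^2} times a homogeneous function of x, whose level sets can be
    measured ray by ray, which gives the weak type (1,1).
    Finally e^{-tA} multiplies the Hermite function of index k by r^{|k|+n}, so
    on L^2 the operator has the right eigenvalues; the error of a partial sum
    of the Hermite series is controlled by the Hilbert-Schmidt norm
    (r^2 / (1 - r^2))^n - \sum_k r^{2(|k|+n)} of the remainder of e^{-tA},
    which decreases to 0 as the set of indices k grows. *)
From HB Require Import structures.
Require Import Defs.
From mathcomp Require Import all_boot all_order all_algebra finmap.
From mathcomp Require Import all_classical all_reals all_analysis.
From mathcomp Require Import measurable_realfun summability.
From mathcomp Require Import ring lra.
Import Order.TTheory GRing.Theory Num.Def Num.Theory.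
Import numFieldNormedType.Exports.
Set Implicit Arguments.
Unset Strict Implicit.
Unset Printing Implicit Defensive.
Local Open Scope classical_set_scope.
Local Open Scope ring_scope.


(** The cut at t0 is forced. As t tends to 0 the Mehler kernel concentrates on the diagonal and only
    its mass can be used, while t^{b-1} is not integrable at infinity, so late times live on the
    decay r^n; this is where n >= 1 enters. For p > 1, r0 = e^{-t0} must lie below both p - 1 and
    1/(p - 1): the former makes the p-th power of the Gaussian in x integrable for gamma_{-1}, the
    latter makes the Gaussian split off by Hoelder's inequality in y integrable. At p = 1 no such r0
    exists. There t^{b-1} is traded for e^{t/2}, and the remaining e^{-(n - 1/2) t} is a pure
    exponential, so that dilating x amounts to translating t. On L^2 the weight t^{b-1} has infinite
    mass, so Cauchy-Schwarz in t uses t^{b-1} e^{-t/2}, and the remainder of the semigroup has to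
    pay for e^{t/2}. Its Hilbert-Schmidt norm decays fast enough for large t but explodes as t tends
    to 0, where the contraction bound replaces it; hence the minimum in [tail_density]. A single
    operator, given by an integral that converges absolutely almost everywhere, serves all p. *)

Lemma measurable_invr (R : realType) : measurable_fun setT (fun x : R => x^-1).
Proof.
(* Inversion is discontinuous at 0, so measurability is taken from real powers; the extra factor [x]
   restores the sign and makes both sides 0 at 0. *)
rewrite (_ : (fun x => _) = (fun x : R => x * (x ^+ 2) `^ (-1))); last first.
  apply/funext => x; rewrite powR_inv1 ?sqr_ge0//.
  by have [->|x0] := eqVneq x 0; [rewrite invr0 mul0r|field].
apply: measurable_funM => //.
by apply: (measurableT_comp (measurable_powR _)).
Qed.

Lemma measurable_sqrtr (R : realType) : measurable_fun setT (@Num.sqrt R).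
Proof. by apply: continuous_measurable_fun; exact: sqrt_continuous. Qed.

Import HBNNSimple.

(** Both sides commute with increasing limits, so simple functions suffice, and for these the
    hypothesis on [nu] applies to each level set. *)
Lemma ge0_integral_density d (T : measurableType d) (R : realType)
    (mu nu : {measure set T -> \bar R}) (g : T -> R) :
  measurable_fun setT g -> (forall x, 0 <= g x) ->
  (forall A, measurable A -> nu A = \int[mu]_(x in A) (g x)%:E)%E ->
  forall f : T -> \bar R, measurable_fun setT f -> (forall x, 0 <= f x)%E ->
  (\int[nu]_x f x = \int[mu]_x (f x * (g x)%:E))%E.
Proof.
move=> mg g0 nuE f mf f0.
pose f_ := nnsfun_approx measurableT mf.
have fE x : f x = limn (fun n => (f_ n x)%:E).
  by apply/esym/cvg_lim => //; exact: cvg_nnsfun_approx.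
transitivity (limn (fun n => \int[nu]_x (f_ n x)%:E)%E).
  under eq_integral do rewrite fE.
  rewrite monotone_convergence//.
  - by move=> n; exact/measurable_EFinP.
  - by move=> n x _; rewrite lee_fin.
  - by move=> x _ m n mn; rewrite lee_fin; exact/lefP/nd_nnsfun_approx.
transitivity (limn (fun n => \int[mu]_x ((f_ n x)%:E * (g x)%:E))%E); last first.
  rewrite -monotone_convergence//.
  - apply: eq_integral => x _; apply/cvg_lim => //.
    apply: cvgeZr => //.
    by apply: cvg_nnsfun_approx.
  - by move=> n; apply: emeasurable_funM => //; exact/measurable_EFinP.
  - by move=> n x _; rewrite mule_ge0// lee_fin.
  - move=> x _ m n mn; rewrite lee_wpmul2r// lee_fin//.
    exact/lefP/nd_nnsfun_approx.
congr (limn _); apply/funext => n.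
transitivity (\sum_(k \in range (f_ n)) k%:E * nu (f_ n @^-1` [set k]))%E.
  by rewrite integralT_nnsfun sintegralE.
transitivity (\sum_(k \in range (f_ n))
    \int[mu]_x (k * \1_(f_ n @^-1` [set k]) x * g x)%:E)%E; last first.
  rewrite -ge0_integral_fsum//=.
  - apply: eq_integral => x _.
    rewrite fsumEFin//= -EFinM [in RHS]fimfunE; congr EFin.
    by rewrite !fsbig_finite//= big_distrl.
  - move=> r; apply/measurable_EFinP; apply: measurable_funM => //.
    by apply: measurable_funM.
  - move=> r x _; have := nnfun_muleindic_ge0 (f_ n) r x.
    by rewrite -EFinM !lee_fin => h; rewrite mulr_ge0.
apply: eq_fsbigr => r; rewrite inE => -[x _ rE].
rewrite nuE//; under [RHS]eq_integral do rewrite -mulrA EFinM.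
have r0 : 0 <= r by rewrite -rE.
rewrite ge0_integralZl//=.
- congr (_ * _)%E; rewrite integral_mkcond; apply: eq_integral => y _.
  by rewrite restrict_EFin /= patchE indicE; case: ifPn; rewrite ?mul1r ?mul0r.
- by apply/measurable_EFinP; apply: measurable_funM.
- by move=> y _; rewrite lee_fin mulr_ge0.
Qed.

(** * Tonelli's theorem for functions of two variables *)

Section curried_fubini.
Local Open Scope ereal_scope.
Context d1 d2 (T1 : measurableType d1) (T2 : measurableType d2) (R : realType).
Variables (m1 : {sigma_finite_measure set T1 -> \bar R}).
Variables (m2 : {sigma_finite_measure set T2 -> \bar R}).
Variable g : T1 -> T2 -> \bar R.
Hypothesis mg : measurable_fun setT (fun z : T1 * T2 => g z.1 z.2).

Lemma measurable_ge0_integral_param : (forall x y, 0 <= g x y) ->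
  measurable_fun setT (fun x => \int[m2]_y g x y).
Proof.
move=> g0.
by apply: (measurable_fun_fubini_tonelli_F (fun z => g z.1 z.2)).
Qed.

Lemma ge0_integral_swap : (forall x y, 0 <= g x y) ->
  \int[m1]_x \int[m2]_y g x y = \int[m2]_y \int[m1]_x g x y.
Proof.
by move=> g0; apply: (fubini_tonelli (fun z => g z.1 z.2)).
Qed.

Lemma ge0_integral_prod : (forall x y, 0 <= g x y) ->
  \int[m1 \x m2]_z g z.1 z.2 = \int[m1]_x \int[m2]_y g x y.
Proof. by move=> g0; rewrite fubini_tonelli1. Qed.

Lemma ge0_integral_prod2 : (forall x y, 0 <= g x y) ->
  \int[m1 \x m2]_z g z.1 z.2 = \int[m2]_y \int[m1]_x g x y.
Proof. by move=> g0; rewrite fubini_tonelli2. Qed.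

End curried_fubini.

(** The integral is the difference of the integrals of the positive and negative parts, each
    measurable by Tonelli; operators are thus measurable even where their integral diverges. *)
Lemma measurable_integral_param d1 d2 (T1 : measurableType d1)
    (T2 : measurableType d2) (R : realType)
    (m2 : {sigma_finite_measure set T2 -> \bar R}) (g : T1 -> T2 -> \bar R) :
  measurable_fun setT (fun z : T1 * T2 => g z.1 z.2) ->
  measurable_fun setT (fun x => \int[m2]_y g x y)%E.
Proof.
move=> mg; under eq_fun do rewrite integralE.
apply: emeasurable_funB.
  apply: (@measurable_ge0_integral_param _ _ _ _ _ _ (fun x => (g x)^\+%E)) => //.
    rewrite (_ : (fun _ => _) = (fun z => g z.1 z.2)^\+%E).
      exact: measurable_funepos.
    by apply/funext => z; rewrite !funeposE.
apply: (@measurable_ge0_integral_param _ _ _ _ _ _ (fun x => (g x)^\-%E)) => //.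
  rewrite (_ : (fun _ => _) = (fun z => g z.1 z.2)^\-%E).
    exact: measurable_funeneg.
  by apply/funext => z; rewrite !funenegE.
Qed.

(** * Affine change of variable on the line *)

Section affine_substitution.
Context {R : realType}.
Variables (c b : R).
Hypothesis c0 : 0 < c.
Local Notation mu := (@lebesgue_measure R).

Let phi : measurableTypeR R -> measurableTypeR R := fun x => c * x + b.

Let mphi : measurable_fun setT phi.
Proof. by apply: measurable_funD => //; exact: measurable_funM. Qed.

Let cn : {nonneg R} := NngNum (ltW c0).

(** The image measure under [phi], rescaled by [c]. It gives intervals their length, so it is
    Lebesgue measure, and integrating against it is the substitution. *)
Let nu : {measure set (measurableTypeR R) -> \bar R} :=
  mscale cn
    (measure_function_pushforward__canonical__measure_function_Measure mu mphi).

Let nuE (A : set R) : measurable A -> mu A = nu A.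
Proof.
move=> mA; apply: lebesgue_measure_unique => //= _ [[u v]] _ <-.
rewrite /nu /= /mscale /= /pushforward.
rewrite (_ : phi @^-1` _ = `](u - b) / c, (v - b) / c]%classic); last first.
  apply/seteqP; split => x /=; rewrite !in_itv/= ltr_pdivrMr// ler_pdivlMr//
    ltrBlDr lerBrDr /phi mulrC//.
have cE : (v - b) / c - (u - b) / c = (v - u) / c by field; rewrite gt_eqF.
rewrite !lebesgue_measure_itv/= !lte_fin ltr_pM2r ?invr_gt0// ltrD2r.
case: ifPn => _; last by rewrite mule0.
by rewrite -!EFinD -EFinM cE mulrC divfK// gt_eqF.
Qed.

Lemma ge0_integral_affine (f : measurableTypeR R -> \bar R) : measurable_fun setT f ->
  (forall x, 0 <= f x)%E ->
  (\int[mu]_x f (c * x + b)%R * c%:E = \int[mu]_x f x)%E.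
Proof.
move=> mf f0.
rewrite [RHS](eq_measure_integral nu); last by move=> A mA _; exact: nuE.
rewrite ge0_integral_mscale//= ge0_integral_pushforward//=.
by rewrite muleC preimage_setT.
Qed.

End affine_substitution.

(** * Integration over tuples, and dilations *)

Section tuple_integral.
Context {R : realType}.
Local Notation mu := (@lebesgue_measure R).
Local Notation L n := (@lebesgue_measure_tuple R n).

Lemma measurable_sqnorm n :
  measurable_fun setT (@sqnorm R n).
Proof.
apply: measurable_sum => i; apply: measurable_funX.
exact: measurable_tnth.
Qed.

Lemma integral_tuple0 (f : euclidean R 0 -> \bar R) :
  (\int[L 0]_x f x = f [tuple])%E.
Proof.
rewrite /= integral_dirac//; first by rewrite diracT mul1e.
move=> _ B _; rewrite setTI.
have [h|h] := pselect (B (f [tuple])).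
  rewrite (_ : f @^-1` B = setT)//; apply/seteqP; split => // x _ /=.
  by rewrite (tuple0 x).
rewrite (_ : f @^-1` B = set0)//; apply/seteqP; split => // x /=.
by rewrite (tuple0 x).
Qed.

Lemma ge0_integral_tupleS n (f : euclidean R n.+1 -> \bar R) :
  measurable_fun setT f -> (forall x, 0 <= f x)%E ->
  (\int[L n.+1]_x f x = \int[mu]_a \int[L n]_t f (tuple_cons (a, t)))%E.
Proof.
move=> mf f0.
rewrite /= [LHS](_ : _ = \int[pushforward (mu \x L n)%E (@tuple_cons R n)]_x f x)%E.
  rewrite ge0_integral_pushforward//=; last exact: measurable_tuple_cons.
  rewrite preimage_setT fubini_tonelli1//.
  exact: (measurableT_comp mf (@measurable_tuple_cons R n)).
by [].
Qed.

(** The passage to the product space is made for the positive and negative parts separately, and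
    Fubini's theorem recombines them. *)
Lemma integrable_tupleS n (f : euclidean R n.+1 -> \bar R) :
  measurable_fun setT f ->
  (mu \x L n)%E.-integrable setT (f \o @tuple_cons R n) ->
  (L n.+1).-integrable setT f /\
  (\int[L n.+1]_x f x = \int[mu]_a \int[L n]_t f (tuple_cons (a, t)))%E.
Proof.
move=> mf fi.
have mc := @measurable_tuple_cons R n.
have h : (L n.+1).-integrable setT f.
  apply/integrableP; split => //.
  have /integrableP[_] := fi; apply: le_lt_trans.
  rewrite ge0_integral_tupleS//; last exact: measurableT_comp.
  rewrite fubini_tonelli1//; last first.
    by apply: measurableT_comp => //; exact: measurableT_comp.
split => //.
rewrite [LHS]integralE !ge0_integral_tupleS//; last 2 first.
- exact: measurable_funeneg.
- exact: measurable_funepos.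
rewrite (integral12_prod_meas1 fi) [RHS]integralE.
rewrite !fubini_tonelli1//.
- by congr (_ - _)%E; apply: eq_integral => a _;
    apply: eq_integral => t _; rewrite !(funeposE, funenegE).
- by apply: measurable_funeneg; exact: measurableT_comp.
- by apply: measurable_funepos; exact: measurableT_comp.
Qed.

Lemma tuple_cons_tnth0 n (a : R) (t : euclidean R n) :
  tnth (tuple_cons (a, t)) ord0 = a.
Proof. by []. Qed.

Lemma tuple_cons_tnthS n (a : R) (t : euclidean R n) i :
  tnth (tuple_cons (a, t)) (lift ord0 i) = tnth t i.
Proof. by rewrite tnthS. Qed.

Definition dilate n (c : R) (x : euclidean R n) : euclidean R n :=
  [tuple of map (fun a => c * a) x].

Lemma tnth_dilate n c (x : euclidean R n) i : tnth (dilate c x) i = c * tnth x i.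
Proof. by rewrite tnth_map. Qed.

Lemma measurable_dilate d (T : measurableType d) n (c : T -> R)
    (x : T -> euclidean R n) : measurable_fun setT c -> measurable_fun setT x ->
  measurable_fun setT (fun z => dilate (c z) (x z)).
Proof.
move=> mc mx; apply/measurable_fun_tnthP => i.
rewrite (_ : _ \o _ = (fun z => c z * tnth (x z) i)); last first.
  by apply/funext => z /=; rewrite tnth_dilate.
apply: measurable_funM => //.
exact: (measurableT_comp (measurable_tnth i)).
Qed.

Lemma sqnorm_dilate n c (x : euclidean R n) :
  sqnorm (dilate c x) = c ^+ 2 * sqnorm x.
Proof.
rewrite /sqnorm big_distrr; apply: eq_bigr => i _.
by rewrite tnth_dilate exprMn.
Qed.

Lemma dilate_cons n c a (t : euclidean R n) :
  dilate c (tuple_cons (a, t)) = tuple_cons (c * a, dilate c t).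
Proof. exact/val_inj. Qed.

(** Induction on [n]: the head coordinate is rescaled by the affine substitution, the tail by the
    induction hypothesis at a fixed head, and each contributes its power of [c]. *)
Lemma ge0_integral_dilate n (c : R) (f : euclidean R n -> \bar R) : 0 < c ->
  measurable_fun setT f -> (forall x, 0 <= f x)%E ->
  (\int[L n]_x (f (dilate c x) * (c ^+ n)%:E) = \int[L n]_x f x)%E.
Proof.
move=> c0; elim: n f => [|n ih] f mf f0.
  rewrite !integral_tuple0 expr0 mule1; congr f.
  exact/val_inj.
have cn0 k : (0 <= (c ^+ k)%:E)%E by rewrite lee_fin exprn_ge0// ltW.
have mfc : measurable_fun setT (f \o @tuple_cons R n).
  by apply: measurableT_comp => //; exact: measurable_tuple_cons.
rewrite !ge0_integral_tupleS//; last 2 first.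
- apply: emeasurable_funM => //; apply: measurableT_comp => //.
  exact: measurable_dilate.
- by move=> x; rewrite mule_ge0.
rewrite -[RHS](@ge0_integral_affine _ c 0)//; last 2 first.
- exact: measurable_ge0_integral_param.
- by move=> x; exact: integral_ge0.
rewrite -ge0_integralZr//; last 3 first.
- rewrite (_ : (fun _ => _) = (fun x => \int[L n]_t f (tuple_cons (x, t)))%E \o
    (fun a => c * a + 0))//.
  apply: measurableT_comp.
    exact: measurable_ge0_integral_param.
  by apply: measurable_funD => //; exact: measurable_funM.
- by move=> x _; exact: integral_ge0.
- by rewrite lee_fin ltW.
apply: eq_integral => a _; rewrite addr0.
rewrite -(ih (fun t => f (tuple_cons (c * a, t))))//; last first.
  by apply: (measurableT_comp mfc); exact: pair1_measurable.
rewrite -ge0_integralZr//; last 3 first.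
- apply: emeasurable_funM => //.
  rewrite (_ : (fun _ => _) = (f \o @tuple_cons R n) \o
      (fun t => (c * a, dilate c t)))//.
  apply: measurableT_comp => //; apply: measurable_fun_pair => //.
  exact: measurable_dilate.
- by move=> t _; rewrite mule_ge0.
- by rewrite lee_fin ltW.
by apply: eq_integral => t _; rewrite dilate_cons exprSr EFinM muleA.
Qed.

End tuple_integral.

(** Bundled so that the space of pairs (t, y) can itself be one factor in Tonelli's theorem. *)
Definition sigma_finite_product d1 d2 (T1 : measurableType d1)
    (T2 : measurableType d2) (R : realType)
    (m1 : {sigma_finite_measure set T1 -> \bar R})
    (m2 : {sigma_finite_measure set T2 -> \bar R}) :
    {sigma_finite_measure set (T1 * T2)%type -> \bar R} :=
  HB.pack (m1 \x m2)%E (Measure_isSigmaFinite.Build _ _ _ (m1 \x m2)%E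
    (sigma_finite_product_measure1 m1 m2)).

(** Hoelder's inequality for k^{1/q} and k^{1/p} h. It is Jensen's inequality for the measure with
    density [k], without normalising that measure. *)
Lemma ge0_powR_integral_le d (T : measurableType d) (R : realType)
    (m : {measure set T -> \bar R}) (k h : T -> R) (p : R) : 1 < p ->
  measurable_fun setT k -> measurable_fun setT h ->
  (forall x, 0 <= k x) -> (forall x, 0 <= h x) ->
  ((\int[m]_x (k x * h x)%:E) `^ p <=
   (\int[m]_x (k x)%:E) `^ (p - 1) * \int[m]_x (k x * h x `^ p)%:E)%E.
Proof.
move=> p1 mk mh k0 h0.
have p0 : 0 < p by rewrite (lt_trans _ p1).
pose q := p / (p - 1).
have q0 : 0 < q by rewrite divr_gt0// subr_gt0.
have qp : q^-1 + p^-1 = 1.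
  by rewrite /q invf_div; field; rewrite gt_eqF//= subr_eq0 gt_eqF.
pose f x := k x `^ q^-1; pose g x := k x `^ p^-1 * h x.
have mf : measurable_fun setT f by exact: (measurableT_comp (measurable_powR _)).
have mg : measurable_fun setT g.
  by apply: measurable_funM => //; exact: (measurableT_comp (measurable_powR _)).
have I0 (u : T -> R) : (forall x, 0 <= u x) -> (0 <= \int[m]_x (u x)%:E)%E.
  by move=> u0; apply: integral_ge0 => x _; rewrite lee_fin.
have kh0 : (0 <= \int[m]_x (k x * h x)%:E)%E by apply: I0 => x; rewrite mulr_ge0.
have := hoelder m mf mg q0 p0 qp.
have -> : 'N[m]_1[EFin \o (f \* g)%R]%E = (\int[m]_x (k x * h x)%:E)%E.
  rewrite Lnorm1; apply: eq_integral => x _ /=.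
  rewrite ger0_norm ?mulr_ge0 ?powR_ge0// /f /g mulrA -powRD ?qp ?powRr1//.
  by apply/implyP; rewrite oner_eq0.
have -> : 'N[m]_q%:E[EFin \o f]%E = ((\int[m]_x (k x)%:E) `^ q^-1)%E.
  rewrite unlock /=; congr poweR; apply: eq_integral => x _ /=.
  by rewrite ger0_norm ?powR_ge0// /f -powRrM mulVf ?gt_eqF// powRr1.
have -> : 'N[m]_p%:E[EFin \o g]%E = ((\int[m]_x (k x * h x `^ p)%:E) `^ p^-1)%E.
  rewrite unlock /=; congr poweR; apply: eq_integral => x _ /=.
  rewrite ger0_norm ?mulr_ge0 ?powR_ge0// /g powRM ?powR_ge0//.
  by rewrite -powRrM mulVf ?gt_eqF// powRr1.
move=> H.
have kp0 : (0 <= \int[m]_x (k x * h x `^ p)%:E)%E.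
  by apply: I0 => x; rewrite mulr_ge0 ?powR_ge0.
have := gt0_ler_poweR (ltW p0) _ _ H.
rewrite !in_itv/= !leey !andbT => /(_ kh0) /(_ (mule_ge0 (poweR_ge0 _ _) (poweR_ge0 _ _))).
rewrite poweRM ?poweR_ge0// -!poweRrM mulVf ?gt_eqF// poweRe1//.
by rewrite (_ : q^-1 * p = p - 1)// /q invf_div divfK// gt_eqF.
Qed.

(** * Tensor products and Gaussian integrals *)

Section tuple_product_integral.
Context {R : realType}.
Local Notation mu := (@lebesgue_measure R).
Local Notation L n := (@lebesgue_measure_tuple R n).

(** Integrability and value go through the induction together, since the tail must be integrable
    before its integral can be factored out. *)
Lemma integral_tuple_prod n (phi : 'I_n -> R -> R) (c : 'I_n -> R) :
  (forall i, mu.-integrable setT (EFin \o phi i)) ->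
  (forall i, (\int[mu]_x (phi i x)%:E = (c i)%:E)%E) ->
  (L n).-integrable setT (fun x => (\prod_(i < n) phi i (tnth x i))%:E) /\
  (\int[L n]_x (\prod_(i < n) phi i (tnth x i))%:E = (\prod_(i < n) c i)%:E)%E.
Proof.
elim: n phi c => [|n ih] phi c iphi cphi.
  split.
    apply/integrableP; split.
      apply/measurable_EFinP; apply: measurable_prod => i _.
      by case: i.
    by rewrite integral_tuple0 big_ord0 /= ltry.
  by rewrite integral_tuple0 !big_ord0.
have mphi i : measurable_fun (setT : set (measurableTypeR R)) (phi i).
  by apply/measurable_EFinP; exact: measurable_int (iphi i).
have [iG cG] := ih (fun i => phi (lift ord0 i)) (fun i => c (lift ord0 i))
  (fun i => iphi _) (fun i => cphi _).
pose G (t : euclidean R n) := \prod_(i < n) phi (lift ord0 i) (tnth t i).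
have mG : measurable_fun setT G by apply/measurable_EFinP; exact: measurable_int iG.
have FE a t : (\prod_(i < n.+1) phi i (tnth (tuple_cons (a, t)) i)) = phi ord0 a * G t.
  rewrite big_ord_recl tuple_cons_tnth0; congr (_ * _).
  by apply: eq_bigr => i _; rewrite tuple_cons_tnthS.
have mF : measurable_fun setT
    (fun x : euclidean R n.+1 => (\prod_(i < n.+1) phi i (tnth x i))%:E).
  apply/measurable_EFinP; apply: measurable_prod => i _.
  by apply: (measurableT_comp (mphi i)) => //; exact: measurable_tnth.
have iFc : (mu \x L n)%E.-integrable setT
    ((fun x => (\prod_(i < n.+1) phi i (tnth x i))%:E) \o @tuple_cons R n).
  apply/integrable12ltyP => /=.
    apply/measurable_EFinP.
    rewrite (_ : (fun _ => _) = (fun z => phi ord0 z.1 * G z.2)).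
      apply: measurable_funM.
        exact: (measurableT_comp (mphi ord0) measurable_fst).
      exact: (measurableT_comp mG measurable_snd).
    by apply/funext => -[a t]; exact: FE.
  under eq_integral.
    move=> a _; under eq_integral do rewrite FE normrM EFinM.
    rewrite ge0_integralZl//; last 1 first.
    - by apply/measurable_EFinP; exact: measurableT_comp.
    over.
  have /integrableP[_ /= hG] := iG.
  have /integrableP[_ /= h0] := iphi ord0.
  rewrite ge0_integralZr//=; last 2 first.
  - by apply/measurable_EFinP; exact: measurableT_comp.
  - by apply: integral_ge0 => x _; rewrite lee_fin.
  by rewrite lte_mul_pinfty// ?ge0_fin_numE ?integral_ge0// => x _; rewrite lee_fin.
have [iF ->] := integrable_tupleS mF iFc.
split; first exact: iF.
under eq_integral.
  move=> a _; under eq_integral do rewrite FE EFinM.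
  rewrite integralZl// cG; over.
rewrite integralZr//; last exact: iphi.
by rewrite cphi big_ord_recl EFinM.
Qed.

Lemma gauss1_integral (a b : R) : 0 < a ->
  mu.-integrable setT (fun x => (expR (- a * (x - b) ^+ 2))%:E) /\
  (\int[mu]_x (expR (- a * (x - b) ^+ 2))%:E = (Num.sqrt (pi / a))%:E)%E.
Proof.
move=> a0.
(* The standard deviation for which the normal density is proportional to exp(-a (x - b)^2). *)
pose s := Num.sqrt (2 * a)^-1.
have s2 : s ^+ 2 = (2 * a)^-1 by rewrite sqr_sqrtr// invr_ge0 mulr_ge0 ?ltW.
have s0 : s != 0 by rewrite gt_eqF// sqrtr_gt0 invr_gt0 mulr_gt0.
have pk0 : 0 < Num.sqrt (pi / a) by rewrite sqrtr_gt0 divr_gt0 ?pi_gt0.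
have E x : normal_pdf b s x = (Num.sqrt (pi / a))^-1 * expR (- a * (x - b) ^+ 2).
  rewrite normal_pdfE// /normal_peak /normal_fun s2; congr ((Num.sqrt _)^-1 * expR _).
    by field; rewrite gt_eqF.
  by field; rewrite gt_eqF.
have I := integral_normal_pdf b s; have J := integrable_normal_pdf b s.
have E2 x : expR (- a * (x - b) ^+ 2) = Num.sqrt (pi / a) * normal_pdf b s x.
  by rewrite E mulVKf// gt_eqF.
split.
  rewrite (_ : (fun _ => _) =
      (fun x => (Num.sqrt (pi / a))%:E * (normal_pdf b s x)%:E)%E).
    exact: integrableZl.
  by apply/funext => x; rewrite -EFinM -E2.
under eq_integral do rewrite E2 EFinM.
by rewrite integralZl// I mule1.
Qed.

Lemma gauss_tuple_integral n (a : R) (b : euclidean R n) : 0 < a ->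
  (\int[L n]_x (\prod_(i < n) expR (- a * (tnth x i - tnth b i) ^+ 2))%:E =
   (Num.sqrt (pi / a) ^+ n)%:E)%E.
Proof.
move=> a0.
have [_ ->] := @integral_tuple_prod n
  (fun i x => expR (- a * (x - tnth b i) ^+ 2)) (fun=> Num.sqrt (pi / a))
  (fun i => (gauss1_integral (tnth b i) a0).1)
  (fun i => (gauss1_integral (tnth b i) a0).2).
by rewrite prodr_const card_ord.
Qed.

Lemma ge0_integral_inverse_gaussian n (F : euclidean R n -> \bar R) :
  measurable_fun setT F -> (forall x, 0 <= F x)%E ->
  (\int[inverse_gaussian R n]_x F x =
   \int[L n]_x (F x * (inverse_gaussian_density x)%:E))%E.
Proof.
move=> mF F0; apply: ge0_integral_density => //.
- exact: measurable_inverse_gaussian_density.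
- exact: inverse_gaussian_density_ge0.
Qed.

End tuple_product_integral.

(** * The Mehler kernel and its two majorants *)

Section mehler.
Context {R : realType}.
Local Notation mu := (@lebesgue_measure R).
Local Notation L n := (@lebesgue_measure_tuple R n).
Local Notation D := inverse_gaussian_density.
Implicit Types r a b : R.

(** The Ornstein-Uhlenbeck kernel for r = e^{-t}, multiplied by [r], by e^{-a^2} on the left and by
    e^{b^2} on the right; it acts against Lebesgue measure in [b]. *)
Definition mehler1 r a b : R :=
  r / Num.sqrt (pi * (1 - r ^+ 2)) * expR (- (a - r * b) ^+ 2 / (1 - r ^+ 2)).

Definition mehler n r (x y : euclidean R n) : R :=
  \prod_(i < n) mehler1 r (tnth x i) (tnth y i).

Lemma mehler1_ge0 r a b : 0 <= r -> 0 <= mehler1 r a b.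
Proof. by move=> r0; rewrite mulr_ge0 ?expR_ge0// divr_ge0 ?sqrtr_ge0. Qed.

Lemma mehler_ge0 n r (x y : euclidean R n) : 0 <= r -> 0 <= mehler r x y.
Proof. by move=> r0; apply: prodr_ge0 => i _; exact: mehler1_ge0. Qed.

Lemma measurable_mehler1 d (T : measurableType d) (r a b : T -> R) :
  measurable_fun setT r -> measurable_fun setT a -> measurable_fun setT b ->
  measurable_fun setT (fun z => mehler1 (r z) (a z) (b z)).
Proof.
move=> mr ma mb.
have m1 : measurable_fun setT (fun z => 1 - r z ^+ 2).
  by apply: measurable_funB => //; exact: measurable_funX.
apply: measurable_funM.
  apply: measurable_funM => //.
  apply: (measurableT_comp (@measurable_invr R)).
  apply: (measurableT_comp (@measurable_sqrtr R)).
  exact: measurable_funM.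
apply: measurableT_comp => //.
apply: measurable_funM; last exact: (measurableT_comp (@measurable_invr R)).
apply: measurableT_comp => //; apply: measurable_funX.
by apply: measurable_funB => //; exact: measurable_funM.
Qed.

Lemma measurable_mehler d (T : measurableType d) n (r : T -> R)
    (x y : T -> euclidean R n) :
  measurable_fun setT r -> measurable_fun setT x -> measurable_fun setT y ->
  measurable_fun setT (fun z => mehler (r z) (x z) (y z)).
Proof.
move=> mr mx my; apply: measurable_prod => i _.
apply: measurable_mehler1 => //.
  exact: (measurableT_comp (measurable_tnth i)).
exact: (measurableT_comp (measurable_tnth i)).
Qed.

Lemma onemX2_gt0 r : 0 < r < 1 -> 0 < 1 - r ^+ 2.
Proof. by move=> /andP[r0 r1]; rewrite subr_gt0 exprn_ilt1// ltW. Qed.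

Lemma mehler1_integral r a : 0 < r < 1 ->
  mu.-integrable setT (EFin \o mehler1 r a) /\
  (\int[mu]_b (mehler1 r a b)%:E = 1)%E.
Proof.
move=> r01; have s0 := onemX2_gt0 r01; have /andP[r0 r1] := r01.
(* In [b] the kernel is a Gaussian centred at a / r with rate [c]. *)
pose c := r ^+ 2 / (1 - r ^+ 2).
have c0 : 0 < c by rewrite divr_gt0// exprn_gt0.
have [iG cG] := gauss1_integral (a / r) c0.
have cE : Num.sqrt (pi / c) = Num.sqrt (pi * (1 - r ^+ 2)) / r.
  rewrite /c invf_div mulrA sqrtrM; last by rewrite mulr_ge0 ?pi_ge0// ltW.
  by rewrite sqrtrV ?sqr_ge0// sqrtr_sqr gtr0_norm.
have E b : (mehler1 r a b)%:E = ((r / Num.sqrt (pi * (1 - r ^+ 2)))%:E *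
    (expR (- c * (b - a / r) ^+ 2))%:E)%E.
  rewrite -EFinM /mehler1; congr (_ * expR _)%:E.
  by rewrite /c; field; rewrite gt_eqF//= gt_eqF.
split.
  rewrite (_ : _ \o _ = fun b => ((r / Num.sqrt (pi * (1 - r ^+ 2)))%:E *
    (expR (- c * (b - a / r) ^+ 2))%:E)%E); first exact: integrableZl.
  by apply/funext => b; exact: E.
under eq_integral do rewrite E.
rewrite integralZl// cG -EFinM cE mulrA divfK ?divff// ?gt_eqF//.
by rewrite sqrtr_gt0 mulr_gt0 ?pi_gt0.
Qed.

Lemma mehler_integral n r (x : euclidean R n) : 0 < r < 1 ->
  (\int[L n]_y (mehler r x y)%:E = 1)%E.
Proof.
move=> r01; have [_ ->] := @integral_tuple_prod R n
  (fun i => mehler1 r (tnth x i)) (fun=> 1)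
  (fun i => (mehler1_integral _ r01).1) (fun i => (mehler1_integral _ r01).2).
by rewrite big1.
Qed.

(** Both exponents equal (2 r a b - r^2 (a^2 + b^2)) / (1 - r^2). *)
Lemma mehler1_sym r a b : 0 < r < 1 ->
  expR (a ^+ 2) * mehler1 r a b = mehler1 r b a * expR (b ^+ 2).
Proof.
move=> r01; have s0 := onemX2_gt0 r01.
rewrite /mehler1 mulrCA -!mulrA -!expRD; congr (_ * (_ * expR _)).
by field; rewrite gt_eqF.
Qed.

Lemma expR_sqnorm n (c : R) (x : euclidean R n) :
  expR (c * sqnorm x) = \prod_(i < n) expR (c * tnth x i ^+ 2).
Proof. by rewrite -expR_sum /sqnorm big_distrr. Qed.

Lemma measurable_expR_sqnorm n (c : R) :
  measurable_fun setT (fun x : euclidean R n => expR (c * sqnorm x)).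
Proof.
apply: measurableT_comp => //; apply: measurable_funM => //.
exact: measurable_sqnorm.
Qed.

Lemma gauss_sqnorm_integral n (c : R) : 0 < c ->
  (\int[L n]_x (expR (- c * sqnorm x))%:E = (Num.sqrt (pi / c) ^+ n)%:E)%E.
Proof.
move=> c0; rewrite -(gauss_tuple_integral [tuple of nseq n 0] c0).
apply: eq_integral => x _; rewrite expR_sqnorm; congr EFin.
by apply: eq_bigr => i _; rewrite tnth_nseq subr0.
Qed.

Lemma mehler_sym n r (x y : euclidean R n) : 0 < r < 1 ->
  mehler r x y * D x = mehler r y x * D y.
Proof.
move=> r01; rewrite /D mulrCA [RHS]mulrCA; congr (_ * _).
rewrite -(mul1r (sqnorm x)) -(mul1r (sqnorm y)) !expR_sqnorm -!big_split/=.
by apply: eq_bigr => i _; rewrite !mul1r mulrC mehler1_sym.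
Qed.

(** Symmetry moves the density to [y] and leaves a kernel of mass one: gamma_{-1} is invariant under
    the semigroup. *)
Lemma mehler_integral_density n r (y : euclidean R n) : 0 < r < 1 ->
  (\int[L n]_x (mehler r x y * D x)%:E = (D y)%:E)%E.
Proof.
move=> r01; have /andP[r0 _] := r01.
under eq_integral do rewrite mehler_sym// EFinM.
rewrite ge0_integralZr//.
- by rewrite mehler_integral// mul1e.
- by apply/measurable_EFinP; apply: measurable_mehler.
- by move=> x _; rewrite lee_fin mehler_ge0// ltW.
- by rewrite lee_fin inverse_gaussian_density_ge0.
Qed.

Lemma le_prod_cst n (c : R) (u v : 'I_n -> R) : 0 <= c ->
  (forall i, 0 <= u i <= c * v i) ->
  \prod_(i < n) u i <= c ^+ n * \prod_(i < n) v i.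
Proof.
move=> c0 uv; rewrite -[X in c ^+ X]card_ord -prodr_const -big_split/=.
exact: ler_prod.
Qed.

(** Only the singular denominator is frozen at [r0]; the numerator is kept because its n-th power is
    the decay e^{-nt}. *)
Lemma mehler1_peak_le r r0 : 0 < r -> r <= r0 -> r0 < 1 ->
  r / Num.sqrt (pi * (1 - r ^+ 2)) <= r / Num.sqrt (pi * (1 - r0 ^+ 2)).
Proof.
move=> rp rr0 r01; have rp0 := lt_le_trans rp rr0.
have s0 : 0 < 1 - r0 ^+ 2 by apply: onemX2_gt0; rewrite rp0.
have s1 : 1 - r0 ^+ 2 <= 1 - r ^+ 2 by rewrite lerB// ler_pXn2r// nnegrE ltW.
rewrite ler_pM2l// lef_pV2 ?posrE ?sqrtr_gt0 ?mulr_gt0 ?pi_gt0//.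
  by rewrite ler_wsqrtr// ler_pM2l ?pi_gt0.
exact: lt_le_trans s1.
Qed.

(** In each coordinate the exponent is b^2 - (a^2 + b^2)/(1 + r) minus a multiple of (a - b)^2;
    dropping the latter separates the variables. A small [r0] brings the rates close to -1 in [x]
    and to 0 in [y]. *)
Lemma mehler_le_gauss n r r0 (x y : euclidean R n) :
  0 < r -> r <= r0 -> r0 < 1 ->
  mehler r x y <= (r / Num.sqrt (pi * (1 - r0 ^+ 2))) ^+ n *
    (expR (- (1 + r0)^-1 * sqnorm x) * expR ((1 - (1 + r0)^-1) * sqnorm y)).
Proof.
move=> rp rr0 r01; rewrite !expR_sqnorm -big_split/=.
have r1 : 0 < r < 1 by rewrite rp (le_lt_trans rr0).
apply: le_prod_cst; first by rewrite divr_ge0 ?sqrtr_ge0// ltW.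
move=> i; rewrite mehler1_ge0 ?(ltW rp)//= /mehler1.
apply: ler_pM; rewrite ?expR_ge0 ?divr_ge0 ?sqrtr_ge0 ?(ltW rp)//.
  exact: mehler1_peak_le.
rewrite -expRD ler_expR.
move: (tnth x i : R) (tnth y i : R) => a b.
have s0 := onemX2_gt0 r1; have rp0 := lt_le_trans rp rr0.
have h : (1 + r0)^-1 <= (1 + r)^-1.
  by rewrite lef_pV2 ?posrE ?addr_gt0// lerD2l.
have -> : - (a - r * b) ^+ 2 / (1 - r ^+ 2) =
    b ^+ 2 - (a ^+ 2 + b ^+ 2) / (1 + r) - r * (a - b) ^+ 2 / (1 - r ^+ 2).
  by field; rewrite gt_eqF//= gt_eqF// addr_gt0.
have h1 : 0 <= r * (a - b) ^+ 2 / (1 - r ^+ 2).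
  by apply: divr_ge0; [apply: mulr_ge0|exact: ltW]; rewrite ?sqr_ge0// ltW.
have h2 : (a ^+ 2 + b ^+ 2) / (1 + r0) <= (a ^+ 2 + b ^+ 2) / (1 + r).
  by rewrite ler_wpM2l// addr_ge0 ?sqr_ge0.
rewrite (_ : _ + _ * b ^+ 2 = b ^+ 2 - (a ^+ 2 + b ^+ 2) / (1 + r0)); last by ring.
lra.
Qed.

(** The exponent is rewritten with (b - r a)^2, and 1/(1 - r^2) is split as 1 + r^2/(1 - r^2). The
    interaction of [x] and [y] survives with a rate free of [r], so that a dilation of [x] will only
    shift t. *)
Lemma mehler_le_translate n r r0 (x y : euclidean R n) :
  0 < r -> r <= r0 -> r0 < 1 ->
  mehler r x y <= (r / Num.sqrt (pi * (1 - r0 ^+ 2))) ^+ n *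
    (expR (- sqnorm x) * expR (sqnorm y) *
     \prod_(i < n) expR (- 1 * (tnth y i - r * tnth x i) ^+ 2)).
Proof.
move=> rp rr0 r01; rewrite -(mulN1r (sqnorm x)) -(mul1r (sqnorm y)).
rewrite !expR_sqnorm -!big_split/=.
have r1 : 0 < r < 1 by rewrite rp (le_lt_trans rr0).
apply: le_prod_cst; first by rewrite divr_ge0 ?sqrtr_ge0// ltW.
move=> i; rewrite mehler1_ge0 ?(ltW rp)//= /mehler1.
apply: ler_pM; rewrite ?expR_ge0 ?divr_ge0 ?sqrtr_ge0 ?(ltW rp)//.
  exact: mehler1_peak_le.
rewrite -!expRD ler_expR.
move: (tnth x i : R) (tnth y i : R) => a b.
have s0 := onemX2_gt0 r1.
have -> : - (a - r * b) ^+ 2 / (1 - r ^+ 2) =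
    - a ^+ 2 + b ^+ 2 - (b - r * a) ^+ 2 - r ^+ 2 * (b - r * a) ^+ 2 / (1 - r ^+ 2).
  by field; rewrite gt_eqF.
have h1 : 0 <= r ^+ 2 * (b - r * a) ^+ 2 / (1 - r ^+ 2).
  by apply: divr_ge0; [apply: mulr_ge0|exact: ltW]; rewrite ?sqr_ge0// ltW.
lra.
Qed.

End mehler.

(** * Averages of the semigroup against a weight in t *)

Section subordinated_operators.
Context {R : realType} {n : nat}.
Local Notation mu := (@lebesgue_measure R).
Local Notation L := (@lebesgue_measure_tuple R n).
Local Notation M := (sigma_finite_product mu L).
Local Notation D := inverse_gaussian_density.
Local Notation gamma := (inverse_gaussian R n).
Local Notation space := (measurableTypeR R * euclidean R n)%type.

(** The Mehler formula makes sense for t > 0 only, where 0 < e^{-t} < 1; a weight vanishing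
    elsewhere lets all integrals run over the whole line. *)
Definition kernel_weight (w : R -> R) :=
  [/\ measurable_fun (setT : set (measurableTypeR R)) w, forall t, 0 <= w t &
      forall t, t <= 0 -> w t = 0].

Definition subordinated_kernel (w : R -> R) (x : euclidean R n) (z : space) : R :=
  w z.1 * mehler (expR (- (z.1 : R))) x z.2.

(** Extended-real majorant of the signed operator. The bounds are proved for it, and its finiteness
    at a point makes the signed integral converge there. *)
Definition subordinated_abs (w : R -> R) (f : euclidean R n -> R)
    (x : euclidean R n) : \bar R :=
  (\int[M]_z (subordinated_kernel w x z * `|f z.2|)%:E)%E.

Variable w : R -> R.
Hypothesis hw : kernel_weight w.

Lemma expRN_itv (t : R) : 0 < t -> 0 < expR (- t) < 1.
Proof. by move=> t0; rewrite expR_gt0 -expR0 ltr_expR oppr_lt0. Qed.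

Lemma subordinated_kernel_ge0 x z : 0 <= subordinated_kernel w x z.
Proof. by have [_ w0 _] := hw; rewrite mulr_ge0// mehler_ge0// expR_ge0. Qed.

Lemma measurable_weight_fst d (T : measurableType d) (t : T -> measurableTypeR R) :
  measurable_fun setT t -> measurable_fun setT (fun z => w (t z)).
Proof. by have [mw _ _] := hw; exact: measurableT_comp. Qed.

Lemma measurable_expRN d (T : measurableType d) (t : T -> measurableTypeR R) :
  measurable_fun setT t -> measurable_fun setT (fun z => expR (- (t z : R))).
Proof. by move=> mt; apply: measurableT_comp => //; exact: measurableT_comp. Qed.

Lemma measurable_subordinated_kernel d (T : measurableType d)
    (x : T -> euclidean R n) (z : T -> space) :
  measurable_fun setT x -> measurable_fun setT z ->
  measurable_fun setT (fun u => subordinated_kernel w (x u) (z u)).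
Proof.
move=> mx mz; apply: measurable_funM.
  apply: measurable_weight_fst; exact: (measurableT_comp measurable_fst).
apply: measurable_mehler => //.
  by apply: measurable_expRN; exact: (measurableT_comp measurable_fst).
exact: (measurableT_comp measurable_snd).
Qed.

Lemma subordinated_kernel_integral x :
  (\int[M]_z (subordinated_kernel w x z)%:E = \int[mu]_t (w t)%:E)%E.
Proof.
have [mw w0 wN] := hw.
rewrite (@ge0_integral_prod _ _ _ _ _ mu L
  (fun t y => (w t * mehler (expR (- (t : R))) x y)%:E)); last 2 first.
- apply/measurable_EFinP.
  by apply: (@measurable_subordinated_kernel _ _ (fun=> x) id).
- by move=> t y; rewrite lee_fin (subordinated_kernel_ge0 x (t, y)).
apply: eq_integral => t _.
have [t0|t0] := leP t 0.
  by rewrite wN//; under eq_integral do rewrite mul0r; rewrite integral0.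
under eq_integral do rewrite EFinM.
rewrite ge0_integralZl//.
- by rewrite mehler_integral ?mule1// expRN_itv.
- apply/measurable_EFinP.
  by apply: measurable_mehler => //.
- by move=> y _; rewrite lee_fin mehler_ge0// expR_ge0.
- by rewrite lee_fin.
Qed.

Lemma subordinated_kernel_integral_density z :
  (\int[L]_x (subordinated_kernel w x z * D x)%:E = (w z.1 * D z.2)%:E)%E.
Proof.
have [mw w0 wN] := hw.
under eq_integral do rewrite -mulrA EFinM.
rewrite ge0_integralZl//; last 3 first.
- apply/measurable_EFinP; apply: measurable_funM.
    by apply: measurable_mehler.
  exact: measurable_inverse_gaussian_density.
- by move=> x _; rewrite lee_fin mulr_ge0 ?inverse_gaussian_density_ge0
    ?mehler_ge0 ?expR_ge0.
- by rewrite lee_fin.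
have [t0|t0] := leP (z.1 : R) 0; first by rewrite wN// mul0r mul0e.
by rewrite mehler_integral_density ?expRN_itv.
Qed.

Lemma measurable_subordinated_abs (f : euclidean R n -> R) :
  measurable_fun setT f -> measurable_fun setT (subordinated_abs w f).
Proof.
move=> mf; apply: (@measurable_integral_param _ _ _ _ _ M
  (fun x z => (subordinated_kernel w x z * `|f z.2|)%:E)).
apply/measurable_EFinP; apply: measurable_funM.
  exact: measurable_subordinated_kernel.
apply: measurableT_comp => //; apply: (measurableT_comp mf).
exact: (measurableT_comp measurable_snd).
Qed.

Lemma subordinated_abs_ge0 (f : euclidean R n -> R) x :
  (0 <= subordinated_abs w f x)%E.
Proof.
apply: integral_ge0 => z _.
by rewrite lee_fin mulr_ge0// subordinated_kernel_ge0.
Qed.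

(** Tonelli's theorem and the invariance of gamma_{-1} give an exact factorisation; for an
    integrable weight it is the bound on L^1. *)
Lemma integral_subordinated_abs (h : euclidean R n -> R) :
  measurable_fun setT h ->
  (\int[gamma]_x subordinated_abs w h x =
   (\int[mu]_t (w t)%:E) * \int[gamma]_y `|h y|%:E)%E.
Proof.
move=> mh; have [mw w0 wN] := hw.
have mh2 : measurable_fun setT (fun z : euclidean R n * space => `|h z.2.2|).
  apply: measurableT_comp => //; apply: (measurableT_comp mh).
  exact: (measurableT_comp measurable_snd).
have mD := @measurable_inverse_gaussian_density R n.
have D0 := @inverse_gaussian_density_ge0 R n.
rewrite !ge0_integral_inverse_gaussian//; last 3 first.
- by apply/measurable_EFinP; exact: measurableT_comp.
- exact: measurable_subordinated_abs.
- exact: subordinated_abs_ge0.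
transitivity (\int[L]_x \int[M]_z
    (subordinated_kernel w x z * `|h z.2| * D x)%:E)%E.
  apply: eq_integral => x _; rewrite -ge0_integralZr//.
  - apply/measurable_EFinP; apply: measurable_funM.
      exact: (@measurable_subordinated_kernel _ _ (fun=> x) id).
    apply: measurableT_comp => //; exact: (measurableT_comp mh measurable_snd).
  - by move=> z _; rewrite lee_fin mulr_ge0// subordinated_kernel_ge0.
  - by rewrite lee_fin.
rewrite (@ge0_integral_swap _ _ _ _ _ L M
  (fun x z => (subordinated_kernel w x z * `|h z.2| * D x)%:E)); last 2 first.
- apply/measurable_EFinP; apply: measurable_funM; last first.
    exact: (measurableT_comp mD).
  by apply: measurable_funM => //; exact: measurable_subordinated_kernel.
- by move=> x z; rewrite lee_fin mulr_ge0// mulr_ge0// subordinated_kernel_ge0.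
transitivity (\int[M]_z ((w z.1)%:E * (`|h z.2| * D z.2)%:E))%E.
  apply: eq_integral => z _.
  under eq_integral do rewrite mulrAC EFinM.
  rewrite ge0_integralZr//.
  - by rewrite subordinated_kernel_integral_density -!EFinM; congr EFin; ring.
  - apply/measurable_EFinP; apply: measurable_funM => //.
    exact: (@measurable_subordinated_kernel _ _ id (fun=> z)).
  - by move=> x _; rewrite lee_fin mulr_ge0// subordinated_kernel_ge0.
rewrite (@ge0_integral_prod _ _ _ _ _ mu L
  (fun t y => ((w t)%:E * (`|h y| * D y)%:E))%E); last 2 first.
- apply: emeasurable_funM; apply/measurable_EFinP.
    by apply: measurable_weight_fst.
  apply: measurable_funM; last exact: (measurableT_comp mD).
  apply: measurableT_comp => //; exact: (measurableT_comp mh).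
- by move=> t y; rewrite mule_ge0// lee_fin// mulr_ge0.
have mhD : measurable_fun setT (fun y => (`|h y| * D y)%:E).
  by apply/measurable_EFinP; apply: measurable_funM => //; exact: measurableT_comp.
have hD0 y : (0 <= (`|h y| * D y)%:E)%E by rewrite lee_fin mulr_ge0.
under eq_integral.
  move=> t _; rewrite ge0_integralZl//; last by rewrite lee_fin.
  over.
rewrite ge0_integralZr//.
- by apply/measurable_EFinP.
- by move=> t _; rewrite lee_fin.
- exact: integral_ge0.
Qed.

(** Jensen's inequality at each [x], the kernel having the integral of [w] as total mass, combined
    with the L^1 identity for |f|^p; the exponents p - 1 and 1 of the mass add up. *)
Lemma integral_subordinated_abs_powR (p : R) (f : euclidean R n -> R) :
  1 < p -> measurable_fun setT f ->
  (\int[gamma]_x (subordinated_abs w f x `^ p) <=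
   (\int[mu]_t (w t)%:E) `^ p * \int[gamma]_y (`|f y| `^ p)%:E)%E.
Proof.
move=> p1 mf; have [mw w0 wN] := hw.
have p0 : 0 < p by rewrite (lt_trans _ p1).
have mfp : measurable_fun setT (fun y => `|f y| `^ p).
  by apply: (measurableT_comp (measurable_powR _)); exact: measurableT_comp.
have W0 : (0 <= \int[mu]_t (w t)%:E)%E.
  by apply: integral_ge0 => t _; rewrite lee_fin.
have mU : measurable_fun setT (fun x => subordinated_abs w f x `^ p)%E.
  apply: (@measurableT_comp _ _ _ _ _ _ (fun x => x `^ p)%E) => //.
    exact: measurable_poweR.
  exact: measurable_subordinated_abs.
have step : (\int[gamma]_x (subordinated_abs w f x `^ p) <=
    \int[gamma]_x ((\int[mu]_t (w t)%:E) `^ (p - 1) *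
      subordinated_abs w (fun y => `|f y| `^ p)%R x))%E.
  apply: ge0_le_integral => //.
  - by move=> x _; exact: poweR_ge0.
  - apply: emeasurable_funM => //.
    exact: measurable_subordinated_abs.
  move=> x _.
  rewrite -(subordinated_kernel_integral x).
  apply: le_trans; first apply: (@ge0_powR_integral_le _ _ _ _ _ _ p) => //.
  - exact: (@measurable_subordinated_kernel _ _ (fun=> x) id).
  - apply: measurableT_comp => //; exact: (measurableT_comp mf measurable_snd).
  - by move=> z; exact: subordinated_kernel_ge0.
  rewrite lee_wpmul2l ?poweR_ge0// /subordinated_abs.
  under [leRHS]eq_integral do rewrite ger0_norm ?powR_ge0//.
  exact: lexx.
apply: (le_trans step).
rewrite ge0_integralZl//; last 3 first.
- exact: measurable_subordinated_abs.
- by move=> x _; exact: subordinated_abs_ge0.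
- exact: poweR_ge0.
rewrite integral_subordinated_abs// muleA.
under [X in (_ * X <= _)%E]eq_integral do rewrite ger0_norm ?powR_ge0//.
rewrite lee_wpmul2r//; first by apply: integral_ge0 => x _; rewrite lee_fin powR_ge0.
rewrite -[X in (_ * X <= _)%E](poweRe1 W0) -poweRD ?subrK//.
by rewrite add_neq0_poweRD_def// subrK gt_eqF.
Qed.

End subordinated_operators.

(** * Gamma integrals in one variable *)

Section one_variable_integrals.
Context {R : realType}.
Local Notation mu := (@lebesgue_measure R).

Lemma FTC_itv (F f : R -> R) (a b : R) : a < b ->
  (forall x, a <= x <= b -> is_derive x 1 F (f x)) ->
  (forall x, a <= x <= b -> {for x, continuous f}) ->
  (\int[mu]_(x in `[a, b]) (f x)%:E = (F b)%:E - (F a)%:E)%E.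
Proof.
move=> ab dF cf.
have cF x : a <= x <= b -> {for x, continuous F}.
  move=> xab; have [d _] := dF x xab.
  by apply: differentiable_continuous; exact/derivable1_diffP.
apply: continuous_FTC2 => //.
- apply: continuous_in_subspaceT => x; rewrite inE/= in_itv/=; exact: cf.
- split.
  + move=> x; rewrite in_itv/= => /andP[ax xb].
    by have [d _] := dF x (introT andP (conj (ltW ax) (ltW xb))).
  + by apply: cvg_at_right_filter; apply: cF; rewrite lexx ltW.
  + by apply: cvg_at_left_filter; apply: cF; rewrite lexx ltW.
- move=> x; rewrite in_itv/= => /andP[ax xb].
  have [d e] := dF x (introT andP (conj (ltW ax) (ltW xb))).
  by rewrite derive1E.
Qed.

Lemma ge0_FTC_y (F f : R -> R) (a l : R) :
  (forall x, a <= x -> 0 <= f x) ->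
  (forall x, a <= x -> is_derive x 1 F (f x)) ->
  (forall x, a <= x -> {for x, continuous f}) ->
  F x @[x --> +oo] --> l ->
  (\int[mu]_(x in `[a, +oo[) (f x)%:E = l%:E - (F a)%:E)%E.
Proof.
move=> f0 dF cf Fl.
apply: ge0_continuous_FTC2y => //.
- by apply: continuous_in_subspaceT => x; rewrite inE/= in_itv/= andbT; exact: cf.
- by move=> x ax; have [d _] := dF x (ltW ax).
- apply: cvg_at_right_filter; have [d _] := dF a (lexx _).
  by apply: differentiable_continuous; exact/derivable1_diffP.
- move=> x; rewrite in_itv/= andbT => ax.
  by have [d e] := dF x (ltW ax); rewrite derive1E.
Qed.

Lemma expRN_integral_y (a c : R) : 0 < a ->
  (\int[mu]_(x in `[c, +oo[) (expR (- (a * x)))%:E = (expR (- (a * c)) / a)%:E)%E.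
Proof.
move=> a0.
have dF (x : R) : is_derive x 1 (fun x => - (expR (- (a * x)) / a)) (expR (- (a * x))).
  have -> : (fun x => - (expR (- (a * x)) / a)) =
      (fun x => (- a^-1) * (expR \o (fun x => - (a * x))) x).
    by apply/funext => y /=; rewrite mulNr mulrC.
  apply: is_derive_eq.
  rewrite /= /GRing.scale/=.
  by field; rewrite gt_eqF.
rewrite (ge0_FTC_y (F := fun x => - (expR (- (a * x)) / a)) (l := 0)).
- by rewrite sub0e EFinN oppeK.
- by move=> x _; exact: expR_ge0.
- move=> x _; apply: continuous_comp; last exact: continuous_expR.
  apply: continuousN; apply: continuousM; [exact: cst_continuous|exact: id].
- rewrite -oppr0 -(mul0r a^-1); apply: cvgN; apply: cvgM; last exact: cvg_cst.
  apply: (@cvg_comp _ _ _ (fun x => a * x) (fun x => expR (- x))); last exact: cvgr_expR.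
  exact: gt0_cvgMry.
Qed.

Lemma powR_integral_01 (b : R) : 0 < b ->
  (\int[mu]_(x in `]0%R, 1%R]) (x `^ (b - 1))%:E <= (b^-1)%:E)%E.
Proof.
move=> b0.
(* The power may blow up at 0, so ]0, 1] is exhausted by intervals away from 0; [k.+2] keeps the
   left end strictly below 1. *)
pose A (k : nat) : set (measurableTypeR R) := `[(k.+2%:R)^-1, 1]%classic.
have -> : `]0%R, 1%R]%classic = \bigcup_k A k.
  apply/seteqP; split => x /=; rewrite /A /= in_itv/=; last first.
    move=> [k _ /=]; rewrite in_itv/= => /andP[kx ->]; rewrite andbT.
    by apply: lt_le_trans kx; rewrite invr_gt0.
  move=> /andP[x0 x1].
  exists (Num.truncn x^-1) => //=; rewrite in_itv/= x1 andbT.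
  rewrite invf_ple ?posrE ?ltr0n//.
  apply: ltW; apply: lt_trans (truncnS_gt _) _; first by rewrite ltr_nat.
have mA k : measurable (A k) by exact: measurable_itv.
have mf : measurable_fun (setT : set (measurableTypeR R)) (fun x : R => (x `^ (b - 1))%:E).
  by apply/measurable_EFinP; exact: measurable_powR.
have nd : nondecreasing_seq A.
  move=> i j ij; apply/subsetPset => x /=; rewrite /A /= !in_itv/= => /andP[ix ->].
  rewrite andbT (le_trans _ ix)// lef_pV2 ?posrE ?ltr0n// ler_nat.
  by rewrite !ltnS.
have h := @ge0_nondecreasing_set_cvg_integral _ _ _ A
  (fun x : R => (x `^ (b - 1))%:E) mu nd mA (fun=> measurable_funTS mf)
  (fun i x _ => powR_ge0 _ _).
rewrite -(cvg_lim _ h)//.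
apply: lime_le; first by apply/cvg_ex; eexists; exact: h.
apply: nearW => k.
have xA (x : R) : k.+2%:R^-1 <= x <= 1 -> 0 < x.
  by move=> /andP[kx _]; rewrite (lt_le_trans _ kx)// invr_gt0 ltr0n.
have dF (x : R) : k.+2%:R^-1 <= x <= 1 ->
    is_derive x 1 (fun x => b^-1 * x `^ b) (x `^ (b - 1)).
  move=> /xA x0.
  have d : is_derive x 1 (@powR R ^~ b) (b * x `^ (b - 1)) by exact: is_derive1_powR.
  rewrite (_ : x `^ (b - 1) = b^-1 *: (b * x `^ (b - 1))); last first.
    by rewrite /GRing.scale/= mulKf// gt_eqF.
  exact: is_deriveZ.
rewrite (FTC_itv _ dF).
- rewrite powR1 mulr1 -EFinB lee_fin gerBl mulr_ge0// ?powR_ge0// invr_ge0.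
  exact: ltW.
- by rewrite invf_lt1 ?ltr0n// ltr1n.
- move=> x /xA x0.
  apply: differentiable_continuous; apply/derivable1_diffP.
  by apply: derivable_powR; rewrite in_itv/= x0.
Qed.

(** With m > |b| and c = e/m, multiplying ln(c t) <= c t by [m] gives b ln t <= m ln t <= e t - m ln
    c for t >= 1. *)
Lemma powR_le_expR (b e : R) : 0 < e ->
  exists2 C : R, 0 < C & forall t, 1 <= t -> t `^ b <= C * expR (e * t).
Proof.
move=> e0; pose m := `|b| + 1.
have m0 : 0 < m by rewrite ltr_wpDl.
pose c := e / m; have c0 : 0 < c by rewrite divr_gt0.
exists (expR (- (m * ln c))); first exact: expR_gt0.
move=> t t1; have t0 : 0 < t by rewrite (lt_le_trans _ t1).
have lt0 : 0 <= ln t by exact: ln_ge0.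
rewrite /powR gt_eqF// -expRD ler_expR.
apply: (@le_trans _ _ (m * ln t)).
  by rewrite ler_wpM2r// (le_trans (ler_norm _))// lerDl.
have h : ln (c * t) <= c * t by apply/ltW/ln_sublinear; rewrite mulr_gt0.
rewrite lnM ?posrE// in h.
have -> : e * t = m * (c * t) by rewrite /c; field; rewrite gt_eqF.
rewrite addrC -lerBlDr opprK -mulrDr ler_pM2l//.
by rewrite addrC.
Qed.

Definition power_weight (b t : R) : R :=
  if 0 < t then t `^ (b - 1) else 0.

Lemma power_weight_ge0 b t : 0 <= power_weight b t.
Proof. by rewrite /power_weight; case: ifP => // _; exact: powR_ge0. Qed.

Lemma measurable_power_weight b :
  measurable_fun (setT : set (measurableTypeR R)) (power_weight b).
Proof.
apply: measurable_fun_if => //.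
- exact: measurable_fun_ltr.
- by apply: measurable_funTS; exact: measurable_powR.
Qed.

Lemma power_weight_expR_lty (b : R) : 0 < b ->
  (\int[mu]_t (power_weight b t * expR (- t))%:E < +oo)%E.
Proof.
move=> b0.
(* Half of the decay e^{-t} absorbs the power for t >= 1; on ]0, 1] the exponential is dropped. *)
have [C C0 hC] := @powR_le_expR (b - 1) 2^-1 ltac:(by []).
have m01 : measurable (`]0%R, 1%R]%classic : set (measurableTypeR R)) by [].
have m1y : measurable (`[1%R, +oo[%classic : set (measurableTypeR R)) by [].
have mpw := measurable_power_weight b.
have me : measurable_fun (setT : set (measurableTypeR R)) (fun t : R => expR (- t)).
  by apply: measurableT_comp => //; exact: measurableT_comp.
have me2 : measurable_fun (setT : set (measurableTypeR R))
    (fun t : R => (C * expR (- (2^-1 * t)))%:E).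
  apply/measurable_EFinP; apply: measurable_funM => //; apply: measurableT_comp => //.
  by apply: measurableT_comp => //; exact: measurable_funM.
have mp : measurable_fun (setT : set (measurableTypeR R)) (fun t : R => (t `^ (b - 1))%:E).
  by apply/measurable_EFinP; exact: measurable_powR.
pose f1 : R -> \bar R := (fun t : R => (t `^ (b - 1))%:E) \_ `]0, 1].
pose f2 : R -> \bar R := (fun t : R => (C * expR (- (2^-1 * t)))%:E) \_ `[1, +oo[.
apply: (@le_lt_trans _ _ (\int[mu]_t (f1 t + f2 t))%E).
  apply: ge0_le_integral => //.
  - by move=> t _; rewrite lee_fin mulr_ge0 ?power_weight_ge0 ?expR_ge0.
  - by apply/measurable_EFinP; exact: measurable_funM.
  - apply: emeasurable_funD.
      by apply/(measurable_restrictT _ m01); exact: measurable_funTS.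
    by apply/(measurable_restrictT _ m1y); exact: measurable_funTS.
  move=> t _; rewrite /f1 /f2 !patchE !mem_setE !in_itv/= andbT /power_weight.
  have [t0|t0] := ltP 0 t; last first.
    have t1 : t < 1 by rewrite (le_lt_trans t0).
    by rewrite mul0r (leNgt 1 t) t1/= adde0.
  have [t1|t1] := leP t 1.
    apply: (@le_trans _ _ (t `^ (b - 1))%:E).
      by rewrite lee_fin ler_piMr ?powR_ge0// -expR0 ler_expR oppr_le0 ltW.
    by rewrite leeDl//; case: ifP => // _; rewrite lee_fin mulr_ge0 ?expR_ge0 ?ltW.
  rewrite (ltW t1) add0e lee_fin.
  have -> : - (2^-1 * t) = 2^-1 * t + - t by field.
  by rewrite expRD mulrA ler_wpM2r ?expR_ge0// hC// ltW.
rewrite ge0_integralD//; last 4 first.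
- by move=> t _; rewrite /f1 patchE; case: ifP => // _; rewrite lee_fin powR_ge0.
- by apply/(measurable_restrictT _ m01); exact: measurable_funTS.
- move=> t _; rewrite /f2 patchE; case: ifP => // _.
  by rewrite lee_fin mulr_ge0 ?expR_ge0 ?ltW.
- by apply/(measurable_restrictT _ m1y); exact: measurable_funTS.
rewrite /f1 /f2 -!integral_mkcond; apply: lte_add_pinfty.
  by apply: le_lt_trans (powR_integral_01 b0) _; rewrite ltry.
under eq_integral do rewrite EFinM.
rewrite ge0_integralZl//; last 2 first.
- apply/measurable_EFinP; apply: measurable_funTS; apply: measurableT_comp => //.
  by apply: measurableT_comp => //; exact: measurable_funM.
- by rewrite lee_fin ltW.
by rewrite expRN_integral_y// -EFinM ltry.
Qed.

(** Euler's Gamma function at [b], the normalising constant of the average. *)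
Definition power_weight_mass (b : R) : R :=
  \int[mu]_t (power_weight b t * expR (- t)).

Lemma power_weight_massE b : 0 < b ->
  (\int[mu]_t (power_weight b t * expR (- t))%:E = (power_weight_mass b)%:E)%E.
Proof.
move=> b0; rewrite /power_weight_mass /Rintegral fineK// ge0_fin_numE.
  exact: power_weight_expR_lty.
by apply: integral_ge0 => t _; rewrite lee_fin mulr_ge0 ?power_weight_ge0 ?expR_ge0.
Qed.

Lemma power_weight_mass_gt0 b : 0 < b -> 0 < power_weight_mass b.
Proof.
move=> b0; rewrite -lte_fin -power_weight_massE//.
(* On [1, 2] one has 0 <= ln t <= 2, so [c] bounds the integrand from below. *)
pose c : R := expR (- (2 * `|b - 1|) - 2).
have mp : measurable_fun (setT : set (measurableTypeR R))
    (fun t : R => (power_weight b t * expR (- t))%:E).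
  apply/measurable_EFinP; apply: measurable_funM; first exact: measurable_power_weight.
  by apply: measurableT_comp => //; exact: measurableT_comp.
apply: (@lt_le_trans _ _ (\int[mu]_(t in `[1%R, 2%R]) (c%:E))%E).
  rewrite integral_cst//= lebesgue_measure_itv/= lte_fin ltr1n -EFinB -EFinM lte_fin.
  by rewrite mulr_gt0 ?expR_gt0// subr_gt0 ltr1n.
apply: (@le_trans _ _ (\int[mu]_(t in `[1%R, 2%R]) (power_weight b t * expR (- t))%:E)%E).
  apply: ge0_le_integral => //.
  - by move=> t _; rewrite lee_fin expR_ge0.
  - exact: measurable_funTS.
  move=> t /=; rewrite in_itv/= => /andP[t1 t2].
  have t0 : 0 < t by rewrite (lt_le_trans _ t1).
  rewrite lee_fin /power_weight t0 /powR gt_eqF// -expRD ler_expR lerD//; last by rewrite lerN2.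
  have l0 : 0 <= ln t by exact: ln_ge0.
  have l2 : ln t <= 2 by rewrite (le_trans (ltW (ln_sublinear t0))).
  have := ler_norm (- (b - 1)); rewrite normrN => h.
  rewrite lerNl -mulNr (le_trans (ler_wpM2r l0 h))// mulrC.
  by rewrite ler_wpM2r.
apply: ge0_subset_integral => //.
by move=> t _; rewrite lee_fin mulr_ge0 ?power_weight_ge0 ?expR_ge0.
Qed.

(** Substitution of l t for t. At an eigenvalue [l] it produces the factor l^{-b}; at l = 1/2 it
    gives the mass needed for Cauchy-Schwarz in t. *)
Lemma power_weight_laplace (b l : R) : 0 < b -> 0 < l ->
  (\int[mu]_t (power_weight b t * expR (- (l * t)))%:E =
   (power_weight_mass b / l `^ b)%:E)%E.
Proof.
move=> b0 l0.
have mp : measurable_fun (setT : set (measurableTypeR R))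
    (fun t : R => (power_weight b t * expR (- t))%:E).
  apply/measurable_EFinP; apply: measurable_funM; first exact: measurable_power_weight.
  by apply: measurableT_comp => //; exact: measurableT_comp.
have mpl : measurable_fun (setT : set (measurableTypeR R))
    (fun t : R => (power_weight b t * expR (- (l * t)))%:E).
  apply/measurable_EFinP; apply: measurable_funM; first exact: measurable_power_weight.
  apply: measurableT_comp => //.
  by apply: measurableT_comp => //; exact: measurable_funM.
have X0 t : (0 <= (power_weight b t * expR (- (l * t)))%:E)%E.
  by rewrite lee_fin mulr_ge0 ?power_weight_ge0 ?expR_ge0.
have f0 t : (0 <= (power_weight b t * expR (- t))%:E)%E.
  by rewrite lee_fin mulr_ge0 ?power_weight_ge0 ?expR_ge0.
have := ge0_integral_affine 0 l0 mp f0.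
rewrite power_weight_massE//.
have -> : (\int[mu]_t (power_weight b (l * t + 0) * expR (- (l * t + 0)))%:E =
    (l `^ (b - 1))%:E * \int[mu]_t (power_weight b t * expR (- (l * t)))%:E)%E.
  rewrite -ge0_integralZl//; last by rewrite lee_fin powR_ge0.
  apply: eq_integral => t _; rewrite addr0 -EFinM mulrA; congr (_ * _)%:E.
  rewrite /power_weight pmulr_rgt0//; case: ifPn => [t0|_]; last by rewrite mulr0.
  by rewrite powRM ?ltW.
rewrite muleAC -EFinM [_ * l]mulrC mulr_powRB1 ?ltW// => h.
rewrite [RHS]EFinM -h muleC muleA -EFinM mulVf ?mul1e//.
by rewrite gt_eqF// powR_gt0.
Qed.
End one_variable_integrals.

(** * Level sets along one ray *)

Section radial.
Context {R : realType}.
Local Notation mu := (@lebesgue_measure R).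

(* The level set is contained in a half-line [c, +oo[ with G c = v, where
   G t = expR (q * expR (- (2 * t)) - a * t) decreases to 0, and the
   integrand is at most -2 G'. *)
Lemma radial_level_integral (q a v : R) : 1 <= q -> 2^-1 <= a -> 0 <= v ->
  (\int[mu]_t ((if expR (q * expR (- (2 * t)) - a * t) < v then 1 else 0) *
     expR (q * expR (- (2 * t)) - (a + 2^-1) * t))%:E <= (2 * v)%:E)%E.
Proof.
move=> q1 a2; rewrite le_eqVlt => /predU1P[<-|v0].
  under eq_integral do rewrite ltNge expR_ge0 /= mul0r.
  by rewrite integral0 mulr0.
have a0 : 0 < a by rewrite (lt_le_trans _ a2).
have q0 : 0 < q by rewrite (lt_le_trans _ q1).
pose G (t : R) : R := expR (q * expR (- (2 * t)) - a * t).
pose g (t : R) : R := G t * (2 * q * expR (- (2 * t)) + a).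
have g0 (t : R) : 0 <= g t.
  by rewrite mulr_ge0 ?expR_ge0// addr_ge0 ?(ltW a0)// mulr_ge0 ?expR_ge0// mulr_ge0// ltW.
have dGN (t : R) : is_derive t 1 G (- g t).
  have -> : G = expR \o (fun y : R => q * (expR \o (fun z => - (2 * z))) y - a * y).
    by [].
  apply: is_derive_eq.
  rewrite /= /GRing.scale/= /g /G.
  by ring.
have dG (t : R) : is_derive t 1 (- G) (g t).
  by rewrite -[g t]opprK; exact: is_deriveN.
have cG : continuous G.
  move=> t; have [d _] := dGN t.
  by apply: differentiable_continuous; exact/derivable1_diffP.
have Gmono (s t : R) : s <= t -> G t <= G s.
  move=> st; rewrite ler_expR; apply: lerB; last by rewrite ler_pM2l.
  by rewrite ler_pM2l// ler_expR lerN2 ler_pM2l.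
have Gle (t : R) : 0 <= t -> G t <= expR (q - a * t).
  move=> t0; rewrite ler_expR lerB// -[leRHS]mulr1 ler_pM2l//.
  by rewrite -expR0 ler_expR oppr_le0 mulr_ge0.
have Gge (t : R) : expR (- (a * t)) <= G t.
  by rewrite ler_expR addrC lerDl mulr_ge0 ?expR_ge0// ltW.
(* [G] lies above e^{-a t} everywhere and below e^{q - a t} for t >= 0; solving these for the value
   [v] gives two times between which [G] takes it. *)
pose t0 := - ln v / a; pose t1 := Num.max 0 ((q - ln v) / a).
have Gt0 : v <= G t0.
  apply: le_trans (Gge t0); rewrite -[leLHS](lnK v0) ler_expR /t0.
  by rewrite mulrC divfK ?gt_eqF// opprK.
have Gt1 : G t1 <= v.
  have t10 : 0 <= t1 by rewrite le_max lexx.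
  apply: le_trans (Gle t1 t10) _; rewrite -[leRHS](lnK v0) ler_expR.
  rewrite lerBlDr addrC -lerBlDr.
  rewrite mulrC -ler_pdivrMr// /t1 le_max; apply/orP; right.
  by rewrite lexx.
have t01 : t0 <= t1.
  rewrite /t1 le_max; apply/orP; right; rewrite ler_pM2r ?invr_gt0//.
  by rewrite addrC lerDl ltW.
have [c _ Gc] : exists2 c, c \in `[t0, t1] & G c = v.
  apply: IVT => //; first exact: continuous_subspaceT.
  by rewrite ge_min le_max Gt0 Gt1 orbT.
have cg : forall t : R, c <= t -> {for t, continuous g}.
  move=> t _; apply: continuousM; first exact: cG.
  apply: continuousD; last exact: cst_continuous.
  apply: continuousM; first exact: cst_continuous.
  apply: continuous_comp; last exact: continuous_expR.
  by apply: continuousN; apply: continuousM; [exact: cst_continuous|exact: id].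
have limG : (- G) x @[x --> +oo] --> (0 : R).
  rewrite -oppr0; apply: cvgN.
  apply: (@squeeze_cvgr _ _ _ _ (cst 0) (fun x => expR q * expR (- (a * x)))).
  - near=> x; rewrite expR_ge0/= -expRD; apply: Gle.
    by near: x; apply: nbhs_pinfty_ge; rewrite num_real.
  - exact: cvg_cst.
  - rewrite -(mulr0 (expR q)); apply: cvgM; first exact: cvg_cst.
    apply: (@cvg_comp _ _ _ (fun x => a * x) (fun x => expR (- x))); last exact: cvgr_expR.
    exact: gt0_cvgMry.
have Ig := ge0_FTC_y (fun t _ => g0 t) (fun t (_ : c <= t) => dG t) cg limG.
have mg : measurable_fun (setT : set (measurableTypeR R)) g.
  apply: measurable_funM.
    apply: measurableT_comp => //; apply: measurable_funB.
      apply: measurable_funM => //; apply: measurableT_comp => //.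
      by apply: measurableT_comp => //; exact: measurable_funM.
    exact: measurable_funM.
  apply: measurable_funD => //; apply: measurable_funM => //.
  apply: measurableT_comp => //.
  by apply: measurableT_comp => //; exact: measurable_funM.
apply: (@le_trans _ _ (\int[mu]_(t in `[c, +oo[) (2 * g t)%:E)%E); last first.
  under eq_integral do rewrite EFinM.
  rewrite ge0_integralZl//.
  - rewrite Ig; have -> : (- G) c = - v by rewrite -Gc.
    by rewrite EFinN oppeK add0e EFinM.
  - by apply/measurable_EFinP; exact: measurable_funTS.
  - by move=> t _; rewrite lee_fin.
rewrite [leRHS]integral_mkcond; apply: ge0_le_integral => //.
- by move=> t _; rewrite lee_fin mulr_ge0 ?expR_ge0//; case: ifP.
- apply/measurable_EFinP; apply: measurable_funM.
    apply: measurable_fun_if => //; apply: measurable_fun_ltr => //.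
    apply: measurableT_comp => //; apply: measurable_funB.
      apply: measurable_funM => //; apply: measurableT_comp => //.
      by apply: measurableT_comp => //; exact: measurable_funM.
    exact: measurable_funM.
  apply: measurableT_comp => //; apply: measurable_funB.
    apply: measurable_funM => //; apply: measurableT_comp => //.
    by apply: measurableT_comp => //; exact: measurable_funM.
  exact: measurable_funM.
- have mc : measurable (`[c, +oo[%classic : set (measurableTypeR R)) by [].
  apply/(measurable_restrictT _ mc); apply/measurable_EFinP.
  by apply: measurable_funTS; exact: measurable_funM.
move=> t _; rewrite patchE mem_setE in_itv/= andbT.
case: ifPn => Gv; last first.
  by rewrite mul0r; case: ifP => // _; rewrite lee_fin mulr_ge0.
have -> : c <= t.
  rewrite leNgt; apply/negP => tc; have := Gmono _ _ (ltW tc).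
  by rewrite Gc leNgt Gv.
rewrite mul1r lee_fin.
have -> : q * expR (- (2 * t)) - (a + 2^-1) * t =
  (q * expR (- (2 * t)) - a * t) + - (2^-1 * t) by ring.
rewrite expRD /g mulrCA ler_wpM2l ?expR_ge0//.
(* With u = e^{-t/2} the claim is u <= 2 (2 q u^4 + a); as q >= 1 and a >= 1/2, it follows from u <=
   4 u^4 + 1. *)
pose u := expR (- (2^-1 * t)).
have u4 : expR (- (2 * t)) = u ^+ 4.
  by rewrite -expRM_natl; congr expR; field.
rewrite -/u u4.
have := sqr_ge0 (u - 1); have := sqr_ge0 (u ^+ 2 - 1); have : 0 <= u ^+ 4.
  by rewrite exprn_ge0// expR_ge0.
have h : u ^+ 4 <= q * u ^+ 4 by rewrite ler_peMl// exprn_ge0// expR_ge0.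
have : (u ^+ 2) ^+ 2 = u ^+ 4 by ring.
rewrite !sqrrB.
by lra.
Unshelve. all: by end_near. Qed.

End radial.

(** * Annulus and polar coordinates *)

Section annulus.
Context {R : realType} {n : nat}.
Local Notation mu := (@lebesgue_measure R).
Local Notation L := (@lebesgue_measure_tuple R n).

(** Every ray from the origin crosses this set in logarithmic length 1/2, the same for all rays, so
    averaging over dilations replaces a surface measure. *)
Definition annulus (z : euclidean R n) : R :=
  if (1 <= sqnorm z) && (sqnorm z < expR 1) then 1 else 0.

Lemma annulus_ge0 z : 0 <= annulus z.
Proof. by rewrite /annulus; case: ifP. Qed.

Lemma sqnorm_ge0 (z : euclidean R n) : 0 <= sqnorm z.
Proof. by apply: sumr_ge0 => i _; exact: sqr_ge0. Qed.

Lemma measurable_annulus d (T : measurableType d) (z : T -> euclidean R n) :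
  measurable_fun setT z -> measurable_fun setT (fun u => annulus (z u)).
Proof.
move=> mz.
have msz : measurable_fun setT (fun u => sqnorm (z u)).
  exact: (measurableT_comp (@measurable_sqnorm R n)).
apply: measurable_fun_if => //; apply: measurable_and.
- exact: measurable_fun_ler.
- exact: measurable_fun_ltr.
Qed.

Lemma annulus_haar_integral (x : euclidean R n) :
  (\int[mu]_t (annulus (dilate (expR t) x))%:E =
   (if sqnorm x == 0 then 0 else 2^-1)%:E)%E.
Proof.
have [x0|x0] := eqVneq (sqnorm x) 0.
  under eq_integral do rewrite /annulus sqnorm_dilate x0 mulr0 ler10 /=.
  by rewrite integral0.
have q0 : 0 < sqnorm x by rewrite lt_neqAle eq_sym x0 sqnorm_ge0.
(* Membership reads 0 <= 2 t + l < 1, an interval of length 1/2 in t. *)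
set l := ln (sqnorm x).
rewrite (_ : (fun t => _) = (fun t => (\1_`[- l / 2, (1 - l) / 2[%classic t)%:E)).
  rewrite integral_indic//= setIT lebesgue_measure_itv/= lte_fin.
  by rewrite ltr_pM2r// ltrDr ltr01 -EFinB; congr EFin; field.
apply/funext => t; rewrite indicE mem_setE in_itv/= /annulus sqnorm_dilate.
rewrite -[sqnorm x]lnK ?posrE// -/l -expRM_natl -expRD -[X in X <= _]expR0.
rewrite ler_expR ltr_expR.
have -> : (- l / 2 <= t) = (0 <= 2 * t + l).
  by rewrite ler_pdivrMr// -lerBlDr sub0r mulrC.
have -> : (t < (1 - l) / 2) = (2 * t + l < 1).
  by rewrite ltr_pdivlMr// ltrBrDr mulrC.
by case: ifP.
Qed.

(* Polar coordinates, with the annulus in the role of the unit sphere. *)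
Lemma ge0_integral_polar (Psi : euclidean R n -> \bar R) :
  measurable_fun setT Psi -> (forall x, 0 <= Psi x)%E ->
  (\int[L]_z \int[mu]_t ((annulus z)%:E * Psi (dilate (expR (- t)) z) *
      (expR (- (n%:R * t)))%:E) =
   \int[L]_x (Psi x * (if sqnorm x == 0 then 0 else 2^-1)%:E))%E.
Proof.
move=> mPsi Psi0.
have mexp d (T : measurableType d) (c : R) (t : T -> measurableTypeR R) :
    measurable_fun setT t -> measurable_fun setT (fun u => expR (c * (t u : R))).
  by move=> mt; apply: measurableT_comp => //; exact: measurable_funM.
have e1 (t : R) : - t = -1 * t by rewrite mulN1r.
have en (t : R) : - (n%:R * t) = (- n%:R) * t by rewrite mulNr.
have mg : measurable_fun setT (fun u : euclidean R n * measurableTypeR R =>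
    ((annulus u.1)%:E * Psi (dilate (expR (- (u.2 : R))) u.1) *
      (expR (- (n%:R * (u.2 : R))))%:E)%E).
  apply: emeasurable_funM; last first.
    by apply/measurable_EFinP; under eq_fun do rewrite en; apply: mexp.
  apply: emeasurable_funM.
    by apply/measurable_EFinP; apply: measurable_annulus.
  apply: measurableT_comp => //; apply: measurable_dilate => //.
  by under eq_fun do rewrite e1; apply: mexp.
have mh : measurable_fun setT (fun u : euclidean R n * measurableTypeR R =>
    ((annulus (dilate (expR (u.2 : R)) u.1))%:E * Psi u.1)%E).
  apply: emeasurable_funM; last exact: measurableT_comp.
  apply/measurable_EFinP; apply: measurable_annulus; apply: measurable_dilate => //.
  exact: measurableT_comp.
rewrite (@ge0_integral_swap _ _ _ _ _ L mu (fun z t =>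
    ((annulus z)%:E * Psi (dilate (expR (- t)) z) *
      (expR (- (n%:R * t)))%:E)%E)) //; last first.
  by move=> z t; rewrite !mule_ge0// lee_fin ?annulus_ge0 ?expR_ge0.
(* At fixed t the dilation by e^{-t} has Jacobian e^{-nt} and carries the parameter from [Psi] to
   the annulus. *)
transitivity (\int[mu]_t \int[L]_x ((annulus (dilate (expR t) x))%:E * Psi x))%E.
  apply: eq_integral => t _.
  rewrite -[RHS](@ge0_integral_dilate _ _ (expR (- t))) ?expR_gt0//.
  - apply: eq_integral => z _; congr (_ * _ * _)%E.
      congr (annulus _)%:E; apply: eq_from_tnth => i.
      by rewrite !tnth_dilate mulrA expRxMexpNx_1 mul1r.
    by rewrite -expRM_natl mulrN.
  - exact: (measurableT_comp mh (pair2_measurable t)).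
  - by move=> x; rewrite mule_ge0// lee_fin annulus_ge0.
rewrite -(@ge0_integral_swap _ _ _ _ _ L mu (fun x t =>
    ((annulus (dilate (expR t) x))%:E * Psi x)%E)) //; last first.
  by move=> z t; rewrite mule_ge0// lee_fin annulus_ge0.
apply: eq_integral => x _.
rewrite ge0_integralZr//.
- by rewrite annulus_haar_integral muleC.
- apply/measurable_EFinP; apply: measurable_annulus.
  exact: measurable_dilate.
- by move=> t _; rewrite lee_fin annulus_ge0.
Qed.

Lemma annulus_integral_lty : (\int[L]_z (annulus z)%:E < +oo)%E.
Proof.
have mG : measurable_fun setT (fun z : euclidean R n => (expR (- 1 * sqnorm z))%:E).
  by apply/measurable_EFinP; exact: measurable_expR_sqnorm.
(* On the annulus |z|^2 < e, so e^e e^{-|z|^2} is at least 1 there. *)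
apply: (@le_lt_trans _ _
    (\int[L]_z ((expR (expR 1))%:E * (expR (- 1 * sqnorm z))%:E))%E).
  apply: ge0_le_integral => //.
  - by move=> z _; rewrite lee_fin annulus_ge0.
  - by apply/measurable_EFinP; apply: measurable_annulus.
  - exact: emeasurable_funM.
  move=> z _; rewrite -EFinM lee_fin -expRD /annulus.
  case: ifP => [/andP[_ z1]|_]; last exact: expR_ge0.
  by rewrite -[leLHS]expR0 ler_expR mulN1r subr_ge0 ltW.
by rewrite ge0_integralZl// gauss_sqnorm_integral// -EFinM ltry.
Qed.

End annulus.

(** * The homogeneous majorant *)

Section weak_type.
Context {R : realType} {n : nat}.
Hypothesis n_ge1 : (1 <= n)%N.
Local Notation mu := (@lebesgue_measure R).
Local Notation L := (@lebesgue_measure_tuple R n).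
Local Notation M := (sigma_finite_product mu L).
Local Notation space := (measurableTypeR R * euclidean R n)%type.

Definition bump (t : R) (x y : euclidean R n) : R :=
  \prod_(i < n) expR (- 1 * (tnth y i - expR (- t) * tnth x i) ^+ 2).

Lemma bump_ge0 t x y : 0 <= bump t x y.
Proof. by apply: prodr_ge0 => i _; exact: expR_ge0. Qed.

Lemma bump_le1 t x y : bump t x y <= 1.
Proof.
apply: prodr_ile1 => i _; rewrite expR_ge0/= -[leRHS]expR0 ler_expR mulN1r.
by rewrite oppr_le0 sqr_ge0.
Qed.

Lemma measurable_bump d (T : measurableType d) (t : T -> measurableTypeR R)
    (x y : T -> euclidean R n) :
  measurable_fun setT t -> measurable_fun setT x -> measurable_fun setT y ->
  measurable_fun setT (fun u => bump (t u) (x u) (y u)).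
Proof.
move=> mt mx my; apply: measurable_prod => i _; apply: measurableT_comp => //.
apply: measurable_funM => //; apply: measurable_funX; apply: measurable_funB.
  exact: (measurableT_comp (measurable_tnth i)).
apply: measurable_funM; first exact: measurable_expRN.
exact: (measurableT_comp (measurable_tnth i)).
Qed.

Lemma bump_dilate (s t : R) x y :
  bump t (dilate (expR (- s)) x) y = bump (t + s) x y.
Proof.
apply: eq_bigr => i _; rewrite tnth_dilate mulrA -expRD.
by rewrite opprD.
Qed.

Lemma bump_integral y : (\int[L]_x (bump 0 x y)%:E = (Num.sqrt pi ^+ n)%:E)%E.
Proof.
rewrite -[pi in RHS]divr1 -(gauss_tuple_integral y ltr01).
apply: eq_integral => x _; congr EFin; apply: eq_bigr => i _.
by rewrite oppr0 expR0 mul1r; congr expR; ring.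
Qed.

Let a : R := n%:R - 2^-1.

Let a_ge : 2^-1 <= a.
Proof.
have h : (1 : R) <= n%:R by rewrite ler1n.
by rewrite /a; lra.
Qed.

Let a_gt0 : 0 < a.
Proof. exact: lt_le_trans a_ge. Qed.

(** The rate n - 1/2 is the decay r^n less the e^{t/2} spent on t^{b-1}. Letting t run over the
    whole line, negative times included, is what makes the integral homogeneous in [x]. *)
Definition homogeneous_kernel (x : euclidean R n) (z : space) : R :=
  expR (- ((n%:R - 2^-1) * (z.1 : R))) * bump z.1 x z.2.

Definition homogeneous_majorant (F : euclidean R n -> R) (x : euclidean R n) :
    \bar R :=
  (\int[M]_z (homogeneous_kernel x z * F z.2)%:E)%E.

Variable F : euclidean R n -> R.
Hypothesis mF : measurable_fun setT F.
Hypothesis F0 : forall y, 0 <= F y.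
Local Notation B := (homogeneous_majorant F).

Lemma homogeneous_kernel_ge0 x z : 0 <= homogeneous_kernel x z.
Proof. by rewrite mulr_ge0 ?expR_ge0// bump_ge0. Qed.

Lemma measurable_homogeneous_kernel d (T : measurableType d)
    (x : T -> euclidean R n) (z : T -> space) :
  measurable_fun setT x -> measurable_fun setT z ->
  measurable_fun setT (fun u => homogeneous_kernel (x u) (z u)).
Proof.
move=> mx mz.
have mz1 : measurable_fun setT (fun u => (z u).1) by exact: (measurableT_comp measurable_fst).
apply: measurable_funM.
  apply: measurableT_comp => //; apply: measurableT_comp => //.
  exact: measurable_funM.
apply: measurable_bump => //.
exact: (measurableT_comp measurable_snd).
Qed.

Lemma homogeneous_majorant_ge0 x : (0 <= B x)%E.
Proof.
by apply: integral_ge0 => z _; rewrite lee_fin mulr_ge0// homogeneous_kernel_ge0.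
Qed.

Lemma measurable_homogeneous_majorant : measurable_fun setT B.
Proof.
apply: (@measurable_integral_param _ _ _ _ _ M
  (fun x z => (homogeneous_kernel x z * F z.2)%:E)).
apply/measurable_EFinP; apply: measurable_funM.
  exact: measurable_homogeneous_kernel.
by apply: (measurableT_comp mF); exact: (measurableT_comp measurable_snd).
Qed.

Lemma homogeneous_majorantE x :
  (B x = \int[L]_y \int[mu]_t (homogeneous_kernel x (t, y) * F y)%:E)%E.
Proof.
rewrite -(@ge0_integral_prod2 _ _ _ _ _ mu L
  (fun t y => (homogeneous_kernel x (t, y) * F y)%:E)).
- by apply: eq_integral => -[].
- apply/measurable_EFinP; apply: measurable_funM.
    apply: (@measurable_homogeneous_kernel _ _ (fun=> x) (fun z => (z.1, z.2))) => //.
    exact: measurable_fun_pair.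
  exact: (measurableT_comp mF).
- by move=> t y; rewrite lee_fin mulr_ge0// homogeneous_kernel_ge0.
Qed.

(** Dilating [x] by e^{-s} shifts t by [s] inside [bump]; translation invariance on the whole line
    leaves the factor e^{a s}. *)
Lemma homogeneous_majorant_dilate (s : R) x :
  (B (dilate (expR (- s)) x) = (expR (a * s))%:E * B x)%E.
Proof.
have mk x' y' : measurable_fun (setT : set (measurableTypeR R))
    (fun t => (homogeneous_kernel x' (t, y') * F y')%:E).
  apply/measurable_EFinP; apply: measurable_funM => //.
  by apply: (@measurable_homogeneous_kernel _ _ (fun=> x') (fun t => (t, y'))).
have k0 x' z' y' : (0 <= (homogeneous_kernel x' z' * F y')%:E)%E.
  by rewrite lee_fin mulr_ge0// homogeneous_kernel_ge0.
rewrite !homogeneous_majorantE -ge0_integralZl//; last 2 first.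
- apply: (@measurable_ge0_integral_param _ _ _ _ _ mu
    (fun y t => (homogeneous_kernel x (t, y) * F y)%:E)) => //.
  apply/measurable_EFinP; apply: measurable_funM; last exact: (measurableT_comp mF).
  apply: (@measurable_homogeneous_kernel _ _ (fun=> x) (fun z => (z.2, z.1))) => //.
  exact: measurable_fun_pair.
- by move=> y _; apply: integral_ge0.
apply: eq_integral => y _.
rewrite -ge0_integralZl//.
have mg : measurable_fun (setT : set (measurableTypeR R))
    (fun t => (expR (a * s))%:E * (homogeneous_kernel x (t, y) * F y)%:E)%E.
  exact: emeasurable_funM.
rewrite -[RHS](ge0_integral_affine s ltr01 mg); last first.
  by move=> t; rewrite mule_ge0// lee_fin expR_ge0.
rewrite mule1; apply: eq_integral => t _; rewrite mul1r -EFinM mulrA; congr (_ * _)%:E.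
rewrite /homogeneous_kernel/= bump_dilate mulrA; congr (_ * _).
by rewrite -expRD; congr expR; rewrite /a; ring.
Qed.

End weak_type.

(** * Integrating the homogeneous kernel over the annulus *)

Section weak_type_bound.
Context {R : realType} {n : nat}.
Hypothesis n_ge1 : (1 <= n)%N.
Local Notation mu := (@lebesgue_measure R).
Local Notation L := (@lebesgue_measure_tuple R n).
Local Notation a := (n%:R - 2^-1 : R).

Let a_ge : 2^-1 <= a.
Proof.
have h : (1 : R) <= n%:R by rewrite ler1n.
by lra.
Qed.

Let a_gt0 : 0 < a.
Proof. exact: lt_le_trans a_ge. Qed.

(* For t >= 0 the kernel is at most exp (- a t); for t < 0 the integral over
   (z, t) is computed in polar coordinates. *)
Lemma annulus_kernel_integral :
  exists2 K : R, 0 <= K & forall y : euclidean R n,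
  (\int[L]_z \int[mu]_t (annulus z * homogeneous_kernel z (t, y))%:E <= K%:E)%E.
Proof.
have h1 := @annulus_integral_lty R n.
have An0 : (0 <= \int[L]_z (annulus z)%:E)%E.
  by apply: integral_ge0 => z _; rewrite lee_fin annulus_ge0.
pose A := fine (\int[L]_z (annulus z)%:E)%E.
have AE : (\int[L]_z (annulus z)%:E = A%:E)%E by rewrite fineK// ge0_fin_numE.
exists (A * a^-1 + Num.sqrt pi ^+ n) => [|y].
  by rewrite addr_ge0 ?exprn_ge0 ?sqrtr_ge0// mulr_ge0 ?fine_ge0// invr_ge0 ltW.
pose f1 (t : R) := if 0 <= t then expR (- (a * t)) else 0.
have f10 t : 0 <= f1 t by rewrite /f1; case: ifP => // _; exact: expR_ge0.
have mlin d (T : measurableType d) (c : R) (t : T -> measurableTypeR R) :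
    measurable_fun setT t -> measurable_fun setT (fun u => expR (- (c * (t u : R)))).
  by move=> mt; do 2 apply: measurableT_comp => //; exact: measurable_funM.
have mf1 d (T : measurableType d) (t : T -> measurableTypeR R) :
    measurable_fun setT t -> measurable_fun setT (fun u => f1 (t u)).
  move=> mt; apply: measurable_fun_if => //; first exact: measurable_fun_ler.
  by apply: measurable_funTS; exact: mlin.
have If1 : (\int[mu]_t (f1 t)%:E = (a^-1)%:E)%E.
  transitivity (\int[mu]_(t in `[0%R, +oo[) (expR (- (a * t)))%:E)%E.
    rewrite [RHS]integral_mkcond; apply: eq_integral => t _.
    by rewrite patchE mem_setE in_itv/= andbT /f1; case: ifP.
  by rewrite expRN_integral_y// mulr0 oppr0 expR0 mul1r.
have mA : measurable_fun setT (fun z : euclidean R n => (annulus z)%:E).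
  by apply/measurable_EFinP; exact: measurable_annulus.
pose g1 (z : euclidean R n) (t : R) : \bar R := ((annulus z)%:E * (f1 t)%:E)%E.
pose g2 (z : euclidean R n) (t : R) : \bar R :=
  ((annulus z)%:E * (bump 0 (dilate (expR (- t)) z) y)%:E *
      (expR (- (n%:R * t)))%:E)%E.
have g10 z t : (0 <= g1 z t)%E by rewrite mule_ge0// lee_fin ?annulus_ge0.
have g20 z t : (0 <= g2 z t)%E.
  by rewrite !mule_ge0// lee_fin ?annulus_ge0 ?expR_ge0 ?bump_ge0.
have mg1 : measurable_fun setT (fun u : euclidean R n * measurableTypeR R => g1 u.1 u.2).
  apply: emeasurable_funM; last by apply/measurable_EFinP; exact: mf1.
  exact: (measurableT_comp mA).
have mg2 : measurable_fun setT (fun u : euclidean R n * measurableTypeR R => g2 u.1 u.2).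
  apply: emeasurable_funM; last by apply/measurable_EFinP; exact: mlin.
  apply: emeasurable_funM; first exact: (measurableT_comp mA).
  apply/measurable_EFinP; apply: (@measurable_bump _ _ _ _ (fun=> 0)) => //.
  by apply: measurable_dilate => //; exact: measurable_expRN.
have m12 z : measurable_fun (setT : set (measurableTypeR R)) (g1 z) /\
    measurable_fun (setT : set (measurableTypeR R)) (g2 z).
  split; first exact: (measurableT_comp mg1 (pair1_measurable z)).
  exact: (measurableT_comp mg2 (pair1_measurable z)).
apply: (@le_trans _ _ (\int[L]_z \int[mu]_t (g1 z t + g2 z t))%E).
  apply: ge0_le_integral => //.
  - move=> z _; apply: integral_ge0 => t _.
    by rewrite lee_fin mulr_ge0 ?annulus_ge0 ?homogeneous_kernel_ge0.
  - apply: (@measurable_ge0_integral_param _ _ _ _ _ mu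
      (fun z t => (annulus z * homogeneous_kernel z (t, y))%:E)).
      apply/measurable_EFinP; apply: measurable_funM; first exact: measurable_annulus.
      apply: (@measurable_homogeneous_kernel _ _ _ _ fst (fun u => (u.2, y))) => //.
      exact: measurable_fun_pair.
    by move=> z t; rewrite lee_fin mulr_ge0 ?annulus_ge0 ?homogeneous_kernel_ge0.
  - apply: (@measurable_ge0_integral_param _ _ _ _ _ mu
      (fun z t => (g1 z t + g2 z t)%E)); first exact: emeasurable_funD.
    by move=> z t; rewrite adde_ge0.
  move=> z _; have [m1 m2] := m12 z.
  apply: ge0_le_integral => //.
  - by move=> t _; rewrite lee_fin mulr_ge0 ?annulus_ge0 ?homogeneous_kernel_ge0.
  - apply/measurable_EFinP; apply: measurable_funM => //.
    by apply: (@measurable_homogeneous_kernel _ _ _ _ (fun=> z) (fun u => (u, y))).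
  - exact: emeasurable_funD.
  move=> t _; rewrite /g1 /g2 -!EFinM -EFinD lee_fin -mulrA -mulrDr.
  rewrite ler_wpM2l ?annulus_ge0// bump_dilate add0r /homogeneous_kernel/= /f1.
  have [t0|t0] := leP 0 t.
    apply: (@le_trans _ _ (expR (- (a * t)))).
      by rewrite ler_piMr ?expR_ge0// bump_le1.
    by rewrite lerDl mulr_ge0 ?bump_ge0 ?expR_ge0.
  (* For t < 0 the factor e^{-(n - 1/2) t} is at most e^{-nt}, the Jacobian that polar coordinates
     require. *)
  rewrite add0r mulrC ler_wpM2l ?bump_ge0// ler_expR lerN2 mulrBl.
  by rewrite lerDl -mulrN mulr_ge0// oppr_ge0 ltW.
under eq_integral.
  move=> z _; have [m1 m2] := m12 z.
  rewrite ge0_integralD//.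
  over.
rewrite ge0_integralD//; last 4 first.
- by move=> z _; apply: integral_ge0.
- exact: (@measurable_ge0_integral_param _ _ _ _ _ mu g1).
- by move=> z _; apply: integral_ge0.
- exact: (@measurable_ge0_integral_param _ _ _ _ _ mu g2).
rewrite EFinD leeD//.
  under eq_integral.
    move=> z _; rewrite /g1 ge0_integralZl//; last 3 first.
    - by apply/measurable_EFinP; exact: mf1.
    - by move=> t _; rewrite lee_fin.
    - by rewrite lee_fin annulus_ge0.
    rewrite If1; over.
  rewrite ge0_integralZr//.
  - by rewrite AE -EFinM.
  - by move=> z _; rewrite lee_fin annulus_ge0.
  - by rewrite lee_fin invr_ge0 ltW.
have mb : measurable_fun setT (fun x : euclidean R n => (bump 0 x y)%:E).
  apply/measurable_EFinP.
  by apply: (@measurable_bump _ _ _ _ (fun=> 0) id (fun=> y)).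
rewrite /g2 (ge0_integral_polar mb); last by move=> x; rewrite lee_fin bump_ge0.
rewrite -(bump_integral y); apply: ge0_le_integral => //.
- by move=> x _; rewrite mule_ge0 ?lee_fin ?bump_ge0//; case: ifP.
- apply: emeasurable_funM => //; apply/measurable_EFinP.
  apply: measurable_fun_if => //.
  apply: measurable_fun_eqr => //; exact: measurable_sqnorm.
- move=> x _; rewrite -EFinM lee_fin ler_piMr ?bump_ge0//; case: ifP => // _.
  by rewrite invf_le1// ler1n.
Qed.

End weak_type_bound.

(** * Weak-type estimate for the homogeneous majorant *)

Section weak_type_level.
Context {R : realType} {n : nat}.
Hypothesis n_ge1 : (1 <= n)%N.
Local Notation mu := (@lebesgue_measure R).
Local Notation L := (@lebesgue_measure_tuple R n).
Local Notation D := inverse_gaussian_density.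
Local Notation gamma := (inverse_gaussian R n).
Local Notation a := (n%:R - 2^-1 : R).

Let a_ge : 2^-1 <= a.
Proof.
have h : (1 : R) <= n%:R by rewrite ler1n.
by lra.
Qed.

Let a_gt0 : 0 < a.
Proof. exact: lt_le_trans a_ge. Qed.

Lemma measurable_sqnorm_eq0 : measurable [set x : euclidean R n | sqnorm x = 0].
Proof.
have := @measurable_sqnorm R n measurableT [set 0] (measurable_set1 _).
by rewrite setTI.
Qed.

(* The set is invariant under dilations, which multiply its measure by 2 ^ n;
   its measure is finite because the Gaussian is 1 on it. *)
Lemma sqnorm_eq0_null : L [set x : euclidean R n | sqnorm x = 0] = 0%E.
Proof.
set Z := [set x | _].
have mZ : measurable Z by exact: measurable_sqnorm_eq0.
have mIZ : measurable_fun setT (fun x => (\1_Z x)%:E : \bar R).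
  exact/measurable_EFinP/measurable_indic.
have LZ : (\int[L]_x (\1_Z x)%:E = L Z)%E by rewrite integral_indic// setIT.
have Zfin : (L Z < +oo)%E.
  rewrite -LZ; apply: (@le_lt_trans _ _ (\int[L]_z (expR (- 1 * sqnorm z))%:E)%E).
    apply: ge0_le_integral => //.
      by apply/measurable_EFinP; exact: measurable_expR_sqnorm.
    move=> x _; rewrite lee_fin indicE; case: (boolP (x \in Z)) => [/set_mem ->|_].
      by rewrite mulr0 expR0.
    exact: expR_ge0.
  by rewrite gauss_sqnorm_integral// ltry.
have two0 : (0 : R) < 2 by [].
have I0 x : (0 <= (\1_Z x)%:E :> \bar R)%E by rewrite lee_fin.
have := ge0_integral_dilate two0 mIZ I0.
have dZ x : \1_Z (dilate 2 x) = \1_Z x :> R.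
  rewrite !indicE; congr (nat_of_bool _)%:R; apply/idP/idP.
    rewrite !inE /Z /= sqnorm_dilate => /eqP.
    by rewrite mulf_eq0 expf_eq0 pnatr_eq0/= => /eqP.
  by rewrite !inE /Z /= sqnorm_dilate => ->; rewrite mulr0.
under eq_integral do rewrite dZ.
rewrite ge0_integralZr ?lee_fin ?exprn_ge0// LZ => h.
have Zf : L Z \is a fin_num by rewrite ge0_fin_numE.
move: h; rewrite -(fineK Zf) -EFinM => -[] /eqP; rewrite -subr_eq0 -[X in _ - X]mulr1 -mulrBr mulf_eq0.
move=> /orP[/eqP -> //|].
rewrite subr_eq0 -natrX -[1]/(1%:R) eqr_nat => /eqP e2.
by have := ltn_expl n (isT : (1 < 2)%N); rewrite e2 ltnNge n_ge1.
Qed.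

(** The factor in [ge0_integral_polar] equals 1/2 off a null set, so it can be moved out as the
    constant 2. *)
Lemma ge0_integral_polarT (Psi : euclidean R n -> \bar R) :
  measurable_fun setT Psi -> (forall x, 0 <= Psi x)%E ->
  (\int[L]_x Psi x = 2%:E * \int[L]_z \int[mu]_t ((annulus z)%:E *
      Psi (dilate (expR (- t)) z) * (expR (- (n%:R * t)))%:E))%E.
Proof.
move=> mPsi Psi0; rewrite ge0_integral_polar//.
have mif : measurable_fun setT
    (fun x : euclidean R n => (if sqnorm x == 0 then 0 else 2^-1 : R)%:E).
  apply/measurable_EFinP; apply: measurable_fun_if => //.
  by apply: measurable_fun_eqr => //; exact: measurable_sqnorm.
have if0 (x : euclidean R n) : (0 <= (if sqnorm x == 0 then 0 else 2^-1 : R)%:E)%E.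
  by rewrite lee_fin; case: ifP.
rewrite -ge0_integralZl//; last 2 first.
- exact: emeasurable_funM.
- by move=> x _; rewrite mule_ge0.
apply: ge0_ae_eq_integral => //.
- by apply: emeasurable_funM => //; exact: emeasurable_funM.
- by move=> x _; rewrite mule_ge0// mule_ge0.
exists [set x : euclidean R n | sqnorm x = 0]; split.
- exact: measurable_sqnorm_eq0.
- exact: sqnorm_eq0_null.
move=> x /= h; apply/eqP/negPn/negP => x0; apply: h => _.
by rewrite (negbTE x0) muleC -muleA -EFinM mulVf// mule1.
Qed.

(** On the ray e^{-t} z, with z in the annulus and q = |z|^2, homogeneity turns the level condition
    into exp(q e^{-2t} - a t) < c B(z)/s, and gamma_{-1} has radial density a constant times exp(q
    e^{-2t} - n t). As n = a + 1/2, [radial_level_integral] measures each ray by a multiple of B(z);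
    integrated over the annulus, B is controlled by the integral of [F]. *)
Lemma weak_type_level : exists2 K : R, 0 <= K &
  forall (F : euclidean R n -> R) (c s : R),
    measurable_fun setT F -> (forall y, 0 <= F y) -> 0 < c -> 0 < s ->
  (gamma [set x | s%:E < (c * expR (- sqnorm x))%:E * homogeneous_majorant F x] <=
   (K * c / s)%:E * \int[L]_y (F y)%:E)%E.
Proof.
have [K K0 hK] := @annulus_kernel_integral R n n_ge1.
pose P : R := pi `^ (n%:R / 2).
have P0 : 0 < P by rewrite powR_gt0// pi_gt0.
(* One factor 2 comes from polar coordinates, the other from the bound on a ray, [P] from the
   density and [K] from the annulus. *)
exists (4 * P * K) => [|F c s mF F0 c0 s0].
  by apply: mulr_ge0 => //; apply: mulr_ge0 => //; exact: ltW.
have mB := measurable_homogeneous_majorant mF.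
have B0 := homogeneous_majorant_ge0 F0.
set B := homogeneous_majorant F in mB B0 *.
set E := [set x | _].
have mE : measurable E.
  rewrite /E -[X in measurable X]setTI.
  apply: emeasurable_fun_o_infty => //.
  apply: emeasurable_funM => //; apply/measurable_EFinP; apply: measurable_funM => //.
  by do 2 apply: measurableT_comp => //; exact: measurable_sqnorm.
pose Psi x : \bar R := (\1_E x * D x)%:E.
have mPsi : measurable_fun setT Psi.
  apply/measurable_EFinP; apply: measurable_funM.
    exact: measurable_indic.
  exact: measurable_inverse_gaussian_density.
have Psi0 x : (0 <= Psi x)%E.
  by rewrite lee_fin mulr_ge0// inverse_gaussian_density_ge0.
have gE : gamma E = (\int[L]_x Psi x)%E.
  rewrite -[E in LHS]setIT -integral_indic// ge0_integral_inverse_gaussian//.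
  by apply/measurable_EFinP; exact: measurable_indic.
have key z : (\int[mu]_t ((annulus z)%:E * Psi (dilate (expR (- t)) z) *
      (expR (- (n%:R * t)))%:E) <= (2 * P * c / s)%:E * ((annulus z)%:E * B z))%E.
  rewrite /annulus; case: ifPn => [/andP[q1 _]|_]; last first.
    under eq_integral do rewrite !mul0e.
    by rewrite integral0 mul0e mule0.
  (* An infinite majorant makes the right-hand side infinite; otherwise it is a real number and the
     ray bound applies. *)
  have [Bz|Bz] := eqVneq (B z) +oo%E.
    rewrite Bz mul1e gt0_muley ?leey// lte_fin !mulr_gt0// ?invr_gt0//.
  have Bf : B z \is a fin_num by rewrite ge0_fin_numE// ltey.
  have b0 : 0 <= fine (B z) by rewrite fine_ge0.
  rewrite mul1e -(fineK Bf) -EFinM.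
  have v0 : 0 <= c * fine (B z) / s.
    by apply: divr_ge0; [apply: mulr_ge0 => //|]; exact: ltW.
  have h := radial_level_integral q1 a_ge v0.
  have an : a + 2^-1 = n%:R by rewrite subrK.
  apply: (@le_trans _ _ (P%:E * (2 * (c * fine (B z) / s))%:E)%E); last first.
    by rewrite -EFinM lee_fin le_eqVlt; apply/orP; left; apply/eqP; field; rewrite gt_eqF.
  apply: le_trans (lee_wpmul2l _ h); last by rewrite lee_fin ltW.
  rewrite -ge0_integralZl//; last 3 first.
  - apply/measurable_EFinP.
    have ml (k : R) : measurable_fun (setT : set (measurableTypeR R))
       (fun t : R => sqnorm z * expR (- (2 * t)) - k * t).
      apply: measurable_funB; last exact: measurable_funM.
      apply: measurable_funM => //; apply: measurableT_comp => //.
      by apply: measurableT_comp => //; exact: measurable_funM.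
    apply: measurable_funM; last exact: measurableT_comp.
    apply: measurable_fun_if => //; apply: measurable_fun_ltr => //.
    exact: measurableT_comp.
  - by move=> t _; rewrite lee_fin mulr_ge0 ?expR_ge0//; case: ifP.
  - by rewrite lee_fin ltW.
  rewrite le_eqVlt; apply/orP; left; apply/eqP; apply: eq_integral => t _.
  rewrite mul1e -!EFinM; congr EFin.
  rewrite /D sqnorm_dilate -expRM_natl mulrN -/P.
  have -> : \1_E (dilate (expR (- t)) z) =
     (if expR (sqnorm z * expR (- (2 * t)) - a * t) < c * fine (B z) / s then 1 else 0) :> R.
    rewrite indicE; have -> : (dilate (expR (- t)) z \in E) =
        (expR (sqnorm z * expR (- (2 * t)) - a * t) < c * fine (B z) / s).
      have -> : (dilate (expR (- t)) z \in E) =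
          (s%:E < (c * expR (- sqnorm (dilate (expR (- t)) z)))%:E *
             B (dilate (expR (- t)) z))%E.
        by apply/idP/idP; rewrite inE.
      rewrite /B homogeneous_majorant_dilate// -/B -(fineK Bf) -!EFinM lte_fin.
      rewrite sqnorm_dilate -expRM_natl mulrN (mulrC _ (sqnorm z)).
      set X := sqnorm z * _.
      have -> : c * expR (- X) * (expR (a * t) * fine (B z)) =
          c * fine (B z) / expR (X - a * t).
        by rewrite -expRN opprB addrC expRD; ring.
      by rewrite ltr_pdivlMr ?expR_gt0// ltr_pdivlMr// mulrC.
    by case: ifP.
  rewrite an mulrCA -!mulrA; congr (_ * (_ * _)).
  by rewrite -expRD mulrC.
rewrite gE ge0_integral_polarT//.
have mlin d (T : measurableType d) (k : R) (t : T -> measurableTypeR R) :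
    measurable_fun setT t -> measurable_fun setT (fun u => expR (- (k * (t u : R)))).
  by move=> mt; do 2 apply: measurableT_comp => //; exact: measurable_funM.
have mA : measurable_fun setT (fun z : euclidean R n => (annulus z)%:E).
  by apply/measurable_EFinP; exact: measurable_annulus.
have A0 (z : euclidean R n) : (0 <= (annulus z)%:E)%E by rewrite lee_fin annulus_ge0.
have C0 : 0 <= 2 * P * c / s.
  by rewrite ltW// divr_gt0// mulr_gt0// mulr_gt0.
apply: (@le_trans _ _ (2%:E * \int[L]_z ((2 * P * c / s)%:E * ((annulus z)%:E * B z)))%E).
  rewrite lee_wpmul2l// ge0_le_integral//.
  - move=> z _; apply: integral_ge0 => t _.
    by rewrite !mule_ge0// lee_fin expR_ge0.
  - apply: (@measurable_ge0_integral_param _ _ _ _ _ mu (fun z t => ((annulus z)%:E *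
      Psi (dilate (expR (- t)) z) * (expR (- (n%:R * t)))%:E)%E)); last first.
      by move=> z t; rewrite !mule_ge0// lee_fin expR_ge0.
    apply: emeasurable_funM; last by apply/measurable_EFinP; exact: mlin.
    apply: emeasurable_funM; first exact: (measurableT_comp mA).
    apply: (measurableT_comp mPsi).
    by apply: measurable_dilate => //; exact: measurable_expRN.
  - by apply: emeasurable_funM => //; exact: emeasurable_funM.
rewrite ge0_integralZl//; last 2 first.
- exact: emeasurable_funM.
- by move=> z _; rewrite mule_ge0.
have k0 (z y : euclidean R n) t : (0 <= (annulus z * homogeneous_kernel z (t, y))%:E)%E.
  by rewrite lee_fin mulr_ge0 ?annulus_ge0 ?homogeneous_kernel_ge0.
pose h (z y : euclidean R n) : \bar R :=
  (\int[mu]_t (annulus z * homogeneous_kernel z (t, y))%:E)%E.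
have h0 z y : (0 <= h z y)%E by exact: integral_ge0.
have mk : measurable_fun setT
    (fun u : (euclidean R n * euclidean R n) * measurableTypeR R =>
      (annulus u.1.1 * homogeneous_kernel u.1.1 (u.2, u.1.2))%:E).
  have m11 : measurable_fun setT
    (fun u : (euclidean R n * euclidean R n) * measurableTypeR R => u.1.1).
    exact: (measurableT_comp measurable_fst).
  apply/measurable_EFinP; apply: measurable_funM; first exact: measurable_annulus.
  apply: (@measurable_homogeneous_kernel _ _ _ _ (fun u => u.1.1)
    (fun u => (u.2, u.1.2))) => //.
  apply: measurable_fun_pair => //; exact: (measurableT_comp measurable_snd).
have mh : measurable_fun setT (fun u : euclidean R n * euclidean R n => h u.1 u.2).
  apply: (@measurable_ge0_integral_param _ _ _ _ _ mu
    (fun (u : euclidean R n * euclidean R n) t =>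
      (annulus u.1 * homogeneous_kernel u.1 (t, u.2))%:E)) => //.
have mFE : measurable_fun setT (fun y => (F y)%:E) by exact/measurable_EFinP.
have step : (\int[L]_z ((annulus z)%:E * B z) <= K%:E * \int[L]_y (F y)%:E)%E.
  have -> : (\int[L]_z ((annulus z)%:E * B z) = \int[L]_z \int[L]_y (h z y * (F y)%:E))%E.
    apply: eq_integral => z _; rewrite /B homogeneous_majorantE//.
    have mkz : measurable_fun setT (fun u : euclidean R n * measurableTypeR R =>
        (homogeneous_kernel z (u.2, u.1) * F u.1)%:E).
      apply/measurable_EFinP; apply: measurable_funM; last exact: (measurableT_comp mF).
      apply: (@measurable_homogeneous_kernel _ _ _ _ (fun=> z) (fun u => (u.2, u.1))) => //.
      exact: measurable_fun_pair.
    rewrite -ge0_integralZl//; last 2 first.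
    - apply: (@measurable_ge0_integral_param _ _ _ _ _ mu
        (fun y t => (homogeneous_kernel z (t, y) * F y)%:E)) => //.
      by move=> y t; rewrite lee_fin mulr_ge0// homogeneous_kernel_ge0.
    - move=> y _; apply: integral_ge0 => t _.
      by rewrite lee_fin mulr_ge0// homogeneous_kernel_ge0.
    apply: eq_integral => y _; rewrite /h -ge0_integralZl//; last 2 first.
    - exact: (measurableT_comp mkz (pair1_measurable y)).
    - by move=> t _; rewrite lee_fin mulr_ge0// homogeneous_kernel_ge0.
    rewrite -ge0_integralZr//.
    - by apply: eq_integral => t _; rewrite -!EFinM mulrA.
    - exact: (measurableT_comp mk (pair1_measurable (z, y))).
    - by rewrite lee_fin.
  rewrite (@ge0_integral_swap _ _ _ _ _ L L (fun z y => (h z y * (F y)%:E)%E)); last 2 first.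
  - by apply: emeasurable_funM => //; exact: (measurableT_comp mFE).
  - by move=> z y; rewrite mule_ge0// lee_fin.
  rewrite -ge0_integralZl//; last by move=> y _; rewrite lee_fin.
  apply: ge0_le_integral => //.
  - by move=> y _; apply: integral_ge0 => z _; rewrite mule_ge0// lee_fin.
  - apply: (@measurable_ge0_integral_param _ _ _ _ _ L (fun y z => (h z y * (F y)%:E)%E)).
      apply: emeasurable_funM; last exact: (measurableT_comp mFE).
      exact: (measurableT_comp mh (measurable_fun_pair measurable_snd measurable_fst)).
    by move=> y z; rewrite mule_ge0// lee_fin.
  - exact: emeasurable_funM.
  move=> y _; rewrite ge0_integralZr//.
  - by rewrite lee_wpmul2r ?lee_fin// hK.
  - exact: (measurableT_comp mh (pair2_measurable y)).
  - by rewrite lee_fin.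
apply: le_trans (lee_wpmul2l _ (lee_wpmul2l _ step)) _; rewrite ?lee_fin//.
rewrite !muleA -!EFinM le_eqVlt; apply/orP; left; apply/eqP; congr (_%:E * _)%E.
by field; rewrite gt_eqF.
Qed.

End weak_type_level.

(** * Cutting the weight at t0 *)

Section weight_splitting.
Context {R : realType} {n : nat}.
Hypothesis n_ge1 : (1 <= n)%N.
Local Notation mu := (@lebesgue_measure R).
Local Notation L := (@lebesgue_measure_tuple R n).
Local Notation M := (sigma_finite_product mu L).

Definition early_weight (t0 : R) (w : R -> R) (t : R) := if t <= t0 then w t else 0.

Definition late_weight (t0 : R) (w : R -> R) (t : R) := if t0 < t then w t else 0.

Lemma kernel_weight_power (b : R) : kernel_weight (power_weight b).
Proof.
split; first exact: measurable_power_weight.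
- exact: power_weight_ge0.
- by move=> t t0; rewrite /power_weight ltNge t0.
Qed.

Lemma kernel_weight_early t0 w : kernel_weight w -> kernel_weight (early_weight t0 w).
Proof.
move=> [mw w0 wN]; split.
- by apply: measurable_fun_if => //; [exact: measurable_fun_ler|exact: measurable_funTS].
- by move=> t; rewrite /early_weight; case: ifP.
- by move=> t tN; rewrite /early_weight wN//; case: ifP.
Qed.

Lemma kernel_weight_late t0 w : kernel_weight w -> kernel_weight (late_weight t0 w).
Proof.
move=> [mw w0 wN]; split.
- by apply: measurable_fun_if => //; [exact: measurable_fun_ltr|exact: measurable_funTS].
- by move=> t; rewrite /late_weight; case: ifP.
- by move=> t tN; rewrite /late_weight wN//; case: ifP.
Qed.

Lemma subordinated_abs_split t0 w (f : euclidean R n -> R) x : kernel_weight w ->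
  measurable_fun setT f ->
  (subordinated_abs w f x = subordinated_abs (early_weight t0 w) f x +
                            subordinated_abs (late_weight t0 w) f x)%E.
Proof.
move=> hw mf.
have mk v : kernel_weight v -> measurable_fun setT
    (fun z : measurableTypeR R * euclidean R n => (subordinated_kernel v x z * `|f z.2|)%:E).
  move=> hv; apply/measurable_EFinP; apply: measurable_funM.
    exact: (measurable_subordinated_kernel hv (x := fun=> x) (z := id)).
  apply: measurableT_comp => //; exact: (measurableT_comp mf measurable_snd).
have k0 v z : kernel_weight v -> (0 <= (subordinated_kernel v x z * `|f z.2|)%:E)%E.
  by move=> hv; rewrite lee_fin mulr_ge0// subordinated_kernel_ge0.
have he := kernel_weight_early t0 hw; have hl := kernel_weight_late t0 hw.
rewrite /subordinated_abs -ge0_integralD//.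
- apply: eq_integral => z _; rewrite -EFinD -mulrDl -mulrDl.
  congr (_ * _ * _)%:E; rewrite /early_weight /late_weight.
  by case: leP => _; rewrite ?addr0 ?add0r.
- by move=> z _; exact: k0.
- exact: mk.
- by move=> z _; exact: k0.
- exact: mk.
Qed.

Lemma integral_early_weight_lty (b t0 : R) : 0 < b ->
  (\int[mu]_t (early_weight t0 (power_weight b) t)%:E < +oo)%E.
Proof.
move=> b0; have hw := kernel_weight_power b.
have [me e0 _] := kernel_weight_early t0 hw.
have mw : measurable_fun (setT : set (measurableTypeR R))
    (fun t : R => (power_weight b t * expR (- t))%:E).
  apply/measurable_EFinP; apply: measurable_funM; first exact: measurable_power_weight.
  by apply: measurableT_comp => //; exact: measurableT_comp.
(* For t <= t0 one has 1 <= e^{t0} e^{-t}, which reduces the claim to the Gamma integral. *)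
apply: (@le_lt_trans _ _ (\int[mu]_t ((expR t0)%:E * (power_weight b t * expR (- t))%:E))%E).
  apply: ge0_le_integral => //.
  - by move=> t _; rewrite lee_fin.
  - exact/measurable_EFinP.
  - exact: emeasurable_funM.
  move=> t _; rewrite -EFinM lee_fin mulrCA -expRD /early_weight.
  case: ifPn => [tt|_]; last by rewrite mulr_ge0 ?power_weight_ge0 ?expR_ge0.
  by rewrite ler_peMr ?power_weight_ge0// -expR0 ler_expR subr_ge0.
rewrite ge0_integralZl//.
- by rewrite power_weight_massE// -EFinM ltry.
- by move=> t _; rewrite lee_fin mulr_ge0 ?power_weight_ge0 ?expR_ge0.
Qed.

(** On t > 0, and for n >= 1, the decay e^{-nt} is at least as strong as the e^{-t} of the Gamma
    integral. *)
Lemma integral_late_weight_le (b t0 : R) : 0 < b ->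
  (\int[mu]_t (late_weight t0 (power_weight b) t * expR (- (n%:R * t)))%:E <=
   (power_weight_mass b)%:E)%E.
Proof.
move=> b0; have hw := kernel_weight_power b.
have [ml l0 _] := kernel_weight_late t0 hw.
rewrite -power_weight_massE//; apply: ge0_le_integral => //.
- by move=> t _; rewrite lee_fin mulr_ge0 ?expR_ge0.
- apply/measurable_EFinP; apply: measurable_funM => //.
  by do 2 apply: measurableT_comp => //; exact: measurable_funM.
- apply/measurable_EFinP; apply: measurable_funM; first exact: measurable_power_weight.
  by do 2 apply: measurableT_comp => //.
move=> t _; rewrite lee_fin /late_weight; case: ifPn => _; last first.
  by rewrite mul0r mulr_ge0 ?power_weight_ge0 ?expR_ge0.
have [t0'|t0'] := leP t 0; first by rewrite /power_weight ltNge t0' !mul0r.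
rewrite ler_wpM2l ?power_weight_ge0// ler_expR lerN2 -[leLHS]mul1r.
by rewrite ler_wpM2r ?ler1n// ltW.
Qed.

(** Once [mehler_le_gauss] has separated the variables, the integral in t is that of the weight
    against r^n and factors out. *)
Lemma subordinated_abs_late_le (b t0 r0 th : R) (f : euclidean R n -> R) x :
  0 < b -> 0 < t0 -> measurable_fun setT f ->
  r0 = expR (- t0) -> th = (1 + r0)^-1 ->
  (subordinated_abs (late_weight t0 (power_weight b)) f x <=
   (power_weight_mass b / Num.sqrt (pi * (1 - r0 ^+ 2)) ^+ n *
     expR (- th * sqnorm x))%:E *
    \int[L]_y (expR ((1 - th) * sqnorm y) * `|f y|)%:E)%E.
Proof.
move=> b0 t0p mf r0E thE.
have hl := kernel_weight_late t0 (kernel_weight_power b).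
have [ml l0 lN] := hl.
set w := late_weight t0 (power_weight b) in hl ml l0 lN *.
pose q := Num.sqrt (pi * (1 - r0 ^+ 2)) ^+ n.
have q0 : 0 <= q by rewrite exprn_ge0// sqrtr_ge0.
have qi0 : 0 <= q^-1 by rewrite invr_ge0.
pose g (t : R) (y : euclidean R n) : \bar R := ((w t * expR (- (n%:R * t)))%:E *
  ((q^-1 * expR (- th * sqnorm x))%:E * (expR ((1 - th) * sqnorm y) * `|f y|)%:E))%E.
have mw : measurable_fun (setT : set (measurableTypeR R))
    (fun t => (w t * expR (- (n%:R * t)))%:E).
  apply/measurable_EFinP; apply: measurable_funM => //.
  by do 2 apply: measurableT_comp => //; exact: measurable_funM.
have my : measurable_fun setT (fun y => (expR ((1 - th) * sqnorm y) * `|f y|)%:E).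
  apply/measurable_EFinP; apply: measurable_funM; first exact: measurable_expR_sqnorm.
  exact: measurableT_comp.
have w0 t : (0 <= (w t * expR (- (n%:R * t)))%:E)%E.
  by rewrite lee_fin mulr_ge0 ?expR_ge0.
have c0 : (0 <= (q^-1 * expR (- th * sqnorm x))%:E)%E.
  by rewrite lee_fin mulr_ge0 ?expR_ge0.
have g0 t y : (0 <= g t y)%E by rewrite mule_ge0// mule_ge0.
have mg : measurable_fun setT (fun z : measurableTypeR R * euclidean R n => g z.1 z.2).
  apply: emeasurable_funM; first exact: (measurableT_comp mw measurable_fst).
  apply: emeasurable_funM => //; exact: (measurableT_comp my measurable_snd).
apply: (@le_trans _ _ (\int[M]_z g z.1 z.2)%E).
  apply: ge0_le_integral => //.
  - by move=> z _; rewrite lee_fin mulr_ge0// subordinated_kernel_ge0.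
  - apply/measurable_EFinP; apply: measurable_funM.
      exact: (measurable_subordinated_kernel hl (x := fun=> x) (z := id)).
    apply: measurableT_comp => //; exact: (measurableT_comp mf measurable_snd).
  move=> [t y] _ /=; rewrite /g -!EFinM lee_fin /subordinated_kernel/=.
  have [tt0|tt0] := leP t t0.
    by rewrite /w /late_weight ltNge tt0/= !mul0r.
  rewrite -!mulrA ler_wpM2l//.
  have rr0 : expR (- t) <= r0 by rewrite r0E ler_expR lerN2 ltW.
  have r01 : r0 < 1 by rewrite r0E; have /andP[] := expRN_itv t0p.
  have h : mehler (expR (- t)) x y <= _ := @mehler_le_gauss R n (expR (- t)) r0 x y
    (expR_gt0 _) rr0 r01.
  apply: le_trans (ler_wpM2r (normr_ge0 _) h) _.
  rewrite le_eqVlt; apply/orP; left; apply/eqP.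
  rewrite exprMn exprVn -expRM_natl mulrN -/q -thE; ring.
rewrite (ge0_integral_prod mu L mg g0).
have I0 : (0 <= \int[L]_y (expR ((1 - th) * sqnorm y) * `|f y|)%:E)%E by exact: integral_ge0.
under eq_integral.
  move=> t _; rewrite ge0_integralZl//; last 2 first.
  - exact: emeasurable_funM.
  - by move=> y _; rewrite mule_ge0.
  rewrite ge0_integralZl//.
  over.
rewrite ge0_integralZr//; last by rewrite mule_ge0.
apply: le_trans (lee_wpmul2r _ (integral_late_weight_le t0 b0)) _; first by rewrite mule_ge0.
by rewrite muleA -EFinM mulrA.
Qed.

End weight_splitting.

(** * Late times for p > 1 *)

Section subordinated_bounds.
Context {R : realType} {n : nat}.
Hypothesis n_ge1 : (1 <= n)%N.
Local Notation mu := (@lebesgue_measure R).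
Local Notation L := (@lebesgue_measure_tuple R n).
Local Notation D := inverse_gaussian_density.
Local Notation gamma := (inverse_gaussian R n).
Variable b : R.
Hypothesis b0 : 0 < b.
Local Notation w := (power_weight b).
Local Notation P := (pi `^ (n%:R / 2) : R).

Let P0 : 0 < P.
Proof. by rewrite powR_gt0// pi_gt0. Qed.

Lemma integral_sqnorm_density (h : euclidean R n -> R) : measurable_fun setT h ->
  (forall y, 0 <= h y) ->
  (\int[L]_y (expR (sqnorm y) * h y)%:E =
   (P^-1)%:E * \int[gamma]_y (h y)%:E)%E.
Proof.
move=> mh h0; rewrite ge0_integral_inverse_gaussian//; last exact/measurable_EFinP.
rewrite -ge0_integralZl//.
- apply: eq_integral => y _; rewrite -!EFinM; congr EFin.
  by rewrite /D; field; rewrite gt_eqF.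
- apply: emeasurable_funM; apply/measurable_EFinP => //.
  exact: measurable_inverse_gaussian_density.
- by move=> y _; rewrite mule_ge0// lee_fin ?inverse_gaussian_density_ge0.
- by rewrite lee_fin invr_ge0 ltW.
Qed.

(** Hoelder's inequality in [y] with two Gaussian factors: e^{d |y|^2} must be integrable, and its
    product with the p-th power of e^{c |y|^2} must be exactly the density e^{|y|^2}. *)
Lemma subordinated_late_powR (p : R) : 1 < p ->
  exists t0 : R, exists2 C : R, 0 <= C &
  forall f : euclidean R n -> R, measurable_fun setT f ->
  (\int[gamma]_x (subordinated_abs (late_weight t0 w) f x `^ p) <=
   C%:E * \int[gamma]_y (`|f y| `^ p)%:E)%E.
Proof.
move=> p1; have p0 : 0 < p by rewrite (lt_trans _ p1).
have pm0 : 0 < p - 1 by rewrite subr_gt0.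
(* r0 < p - 1 gives p th > 1, so the Gaussian in [x] beats the density of gamma_{-1}; r0 < 1/(p - 1)
   gives d < 0. *)
pose m := Num.min (p - 1) (p - 1)^-1.
have m0 : 0 < m by rewrite lt_min pm0 invr_gt0.
(* The entry 1 - ln m yields r0 <= m/e < m; the entry 1 keeps t0 positive. *)
pose t0 := Num.max 1 (1 - ln m).
have t0p : 0 < t0 by rewrite lt_max ltr01.
pose r0 := expR (- t0); pose th := (1 + r0)^-1.
have r0p : 0 < r0 by exact: expR_gt0.
have r0m : r0 < m.
  apply: (@le_lt_trans _ _ (expR (ln m - 1))).
    by rewrite ler_expR lerNl opprB le_max lexx orbT.
  by rewrite -[ltRHS](lnK m0) ltr_expR gtrBl.
have thp : 1 < p * th.
  rewrite /th ltr_pdivlMr ?addr_gt0// mul1r addrC -ltrBrDr.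
  by rewrite (lt_le_trans r0m)// ge_min lexx.
(* The solution of d + c = 1 - th and d + c p = 1. *)
pose c := th / (p - 1); pose d := 1 - th - c.
have dneg : 0 < - d.
  have -> : - d = (th * p - (p - 1)) / (p - 1) by rewrite /d /c; field; rewrite gt_eqF.
  rewrite divr_gt0// subr_gt0 /th mulrC ltr_pdivlMr ?addr_gt0//.
  have h : r0 * (p - 1) < 1.
    by rewrite -ltr_pdivlMr// mul1r (lt_le_trans r0m)// ge_min lexx orbT.
  lra.
pose A : R := power_weight_mass b / Num.sqrt (pi * (1 - r0 ^+ 2)) ^+ n.
have A0 : 0 <= A.
  by rewrite divr_ge0 ?exprn_ge0 ?sqrtr_ge0// ltW// power_weight_mass_gt0.
pose J : R := Num.sqrt (pi / - d) ^+ n.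
pose Q : R := J `^ (p - 1) * P^-1.
have Q0 : 0 <= Q by rewrite mulr_ge0 ?powR_ge0// invr_ge0 ltW.
pose X : R := Num.sqrt (pi / (p * th - 1)) ^+ n.
have X0 : 0 <= X by rewrite exprn_ge0// sqrtr_ge0.
exists t0; exists (A `^ p * P * X * Q).
  by do 3 apply: mulr_ge0 => //; rewrite ?powR_ge0.
move=> f mf.
set If := (\int[gamma]_y (`|f y| `^ p)%:E)%E.
have If0 : (0 <= If)%E by apply: integral_ge0 => y _; rewrite lee_fin powR_ge0.
have mfp : measurable_fun setT (fun y => `|f y| `^ p).
  by apply: (measurableT_comp (measurable_powR _)); exact: measurableT_comp.
have hold : ((\int[L]_y (expR ((1 - th) * sqnorm y) * `|f y|)%:E) `^ p <= Q%:E * If)%E.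
  have -> : (\int[L]_y (expR ((1 - th) * sqnorm y) * `|f y|)%:E =
      \int[L]_y (expR (d * sqnorm y) * (expR (c * sqnorm y) * `|f y|))%:E)%E.
    apply: eq_integral => y _; rewrite mulrA -expRD -mulrDl.
    by rewrite /d subrK.
  apply: le_trans; first apply: ge0_powR_integral_le => //.
  - exact: measurable_expR_sqnorm.
  - apply: measurable_funM; first exact: measurable_expR_sqnorm.
    exact: measurableT_comp.
  have -> : (\int[L]_y (expR (d * sqnorm y))%:E = J%:E)%E.
    by rewrite /J -(gauss_sqnorm_integral n dneg); apply: eq_integral => y _; rewrite opprK.
  rewrite poweR_EFin /Q EFinM -muleA lee_wpmul2l ?lee_fin ?powR_ge0//.
  rewrite /If -integral_sqnorm_density; last 2 first.
  - exact: mfp.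
  - by move=> y; exact: powR_ge0.
  rewrite le_eqVlt; apply/orP; left; apply/eqP; apply: eq_integral => y _.
  rewrite powRM ?expR_ge0// -expRM mulrA -expRD.
  have -> // : d * sqnorm y + c * sqnorm y * p = sqnorm y.
  by rewrite /d /c; field; rewrite gt_eqF.
have hl := kernel_weight_late t0 (kernel_weight_power b).
have mL := measurable_subordinated_abs hl mf.
have mpow (u : euclidean R n -> \bar R) : measurable_fun setT u ->
    measurable_fun setT (fun x => u x `^ p)%E.
  move=> mu_; apply: (@measurableT_comp _ _ _ _ _ _ (fun x => x `^ p)%E) => //.
  exact: measurable_poweR.
have mE : measurable_fun setT (fun x : euclidean R n => ((A * expR (- th * sqnorm x)) `^ p)%:E).
  apply/measurable_EFinP; apply: (measurableT_comp (measurable_powR _)).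
  by apply: measurable_funM => //; exact: measurable_expR_sqnorm.
have E0 (x : euclidean R n) : (0 <= ((A * expR (- th * sqnorm x)) `^ p)%:E)%E.
  by rewrite lee_fin powR_ge0.
have QI0 : (0 <= Q%:E * If)%E by rewrite mule_ge0// lee_fin.
apply: (@le_trans _ _ (\int[gamma]_x (((A * expR (- th * sqnorm x)) `^ p)%:E * (Q%:E * If)))%E).
  apply: ge0_le_integral => //.
  - by move=> x _; exact: poweR_ge0.
  - exact: mpow.
  - exact: emeasurable_funM.
  move=> x _; have := subordinated_abs_late_le n_ge1 x b0 t0p mf erefl erefl.
  rewrite -/r0 -/th -/A => h.
  have U0 := subordinated_abs_ge0 hl f x.
  have AE0 : (0 <= (A * expR (- th * sqnorm x))%:E)%E.
    by rewrite lee_fin mulr_ge0 ?expR_ge0.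
  have I0 : (0 <= \int[L]_y (expR ((1 - th) * sqnorm y) * `|f y|)%:E)%E.
    by apply: integral_ge0 => y _; rewrite lee_fin mulr_ge0 ?expR_ge0.
  apply: (@le_trans _ _ (((A * expR (- th * sqnorm x))%:E *
     \int[L]_y (expR ((1 - th) * sqnorm y) * `|f y|)%:E) `^ p)%E).
    apply: gt0_ler_poweR => //; rewrite ?ltW// in_itv/= leey andbT//.
    by rewrite mule_ge0.
  rewrite poweRM// poweR_EFin.
  exact: lee_wpmul2l.
rewrite ge0_integralZr//.
have -> : ((A `^ p * P * X * Q)%:E * If = (A `^ p * P * X)%:E * (Q%:E * If))%E.
  by rewrite muleA -EFinM.
rewrite lee_wpmul2r//.
rewrite ge0_integral_inverse_gaussian//.
have XE : (\int[L]_x (expR (- (p * th - 1) * sqnorm x))%:E = X%:E)%E.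
  by rewrite gauss_sqnorm_integral// subr_gt0.
have mX : measurable_fun setT (fun x : euclidean R n => (expR (- (p * th - 1) * sqnorm x))%:E).
  by apply/measurable_EFinP; exact: measurable_expR_sqnorm.
rewrite EFinM -XE -ge0_integralZl//; last first.
  by rewrite lee_fin mulr_ge0 ?powR_ge0.
rewrite le_eqVlt; apply/orP; left; apply/eqP; apply: eq_integral => x _.
rewrite -!EFinM; congr EFin.
rewrite powRM ?expR_ge0// -expRM /D.
have -> : - (p * th - 1) * sqnorm x = - th * sqnorm x * p + sqnorm x by ring.
by rewrite expRD; ring.
Qed.

End subordinated_bounds.

(** * Strong and weak bounds for the whole average *)

Section subordinated_total.
Context {R : realType} {n : nat}.
Hypothesis n_ge1 : (1 <= n)%N.
Local Notation mu := (@lebesgue_measure R).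
Local Notation L := (@lebesgue_measure_tuple R n).
Local Notation gamma := (inverse_gaussian R n).
Variable b : R.
Hypothesis b0 : 0 < b.
Local Notation w := (power_weight b).

Lemma powereD_le (p : R) (x y : \bar R) : 1 < p -> (0 <= x)%E -> (0 <= y)%E ->
  ((x + y) `^ p <= (2 `^ p)%:E * (x `^ p + y `^ p))%E.
Proof.
move=> p1; have p0 : 0 < p by rewrite (lt_trans _ p1).
wlog xy : x y / (x <= y)%E.
  move=> H x0 y0; have [xy|/ltW yx] := leP x y; first exact: H.
  by rewrite addeC [in leRHS]addeC; exact: H.
move=> x0 y0.
have xy2 : (x + y <= 2%:E * y)%E.
  have -> : (2%:E * y = y + y)%E by rewrite -[2]/(1 + 1) EFinD ge0_muleDl// mul1e.
  exact: leeD2r.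
apply: (@le_trans _ _ ((2%:E * y) `^ p)%E).
  apply: gt0_ler_poweR => //; rewrite ?ltW// in_itv/= leey andbT ?adde_ge0//.
  by rewrite mule_ge0.
by rewrite poweRM// poweR_EFin lee_wpmul2l ?lee_fin ?powR_ge0// leeDr// poweR_ge0.
Qed.

Lemma subordinated_powR_bound (p : R) : 1 < p ->
  exists2 C : R, 0 <= C &
  forall f : euclidean R n -> R, measurable_fun setT f ->
  (\int[gamma]_x (subordinated_abs w f x `^ p) <=
   C%:E * \int[gamma]_y (`|f y| `^ p)%:E)%E.
Proof.
move=> p1; have p0 : 0 < p by rewrite (lt_trans _ p1).
have [t0 [C C0 hC]] := subordinated_late_powR n_ge1 b0 p1.
have hw := kernel_weight_power b.
have he := kernel_weight_early t0 hw; have hl := kernel_weight_late t0 hw.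
have We0 : (0 <= \int[mu]_t (early_weight t0 w t)%:E)%E.
  by apply: integral_ge0 => t _; rewrite lee_fin; have [_ + _] := he.
have WeE : (\int[mu]_t (early_weight t0 w t)%:E)%E \is a fin_num.
  by rewrite ge0_fin_numE// integral_early_weight_lty.
pose W := fine (\int[mu]_t (early_weight t0 w t)%:E)%E.
exists (2 `^ p * (W `^ p + C)).
  by rewrite mulr_ge0 ?powR_ge0// addr_ge0 ?powR_ge0.
move=> f mf.
have me := measurable_subordinated_abs he mf.
have ml := measurable_subordinated_abs hl mf.
have mw := measurable_subordinated_abs hw mf.
have mpow (u : euclidean R n -> \bar R) : measurable_fun setT u ->
    measurable_fun setT (fun x => u x `^ p)%E.
  move=> mu_; apply: (@measurableT_comp _ _ _ _ _ _ (fun x => x `^ p)%E) => //.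
  exact: measurable_poweR.
have E0 x := subordinated_abs_ge0 he f x.
have L0 x := subordinated_abs_ge0 hl f x.
apply: (@le_trans _ _ (\int[gamma]_x ((2 `^ p)%:E *
    (subordinated_abs (early_weight t0 w) f x `^ p +
     subordinated_abs (late_weight t0 w) f x `^ p)))%E).
  apply: ge0_le_integral => //.
  - by move=> x _; exact: poweR_ge0.
  - exact: mpow.
  - by apply: emeasurable_funM => //; apply: emeasurable_funD; exact: mpow.
  move=> x _; rewrite (subordinated_abs_split t0)//.
  exact: powereD_le.
rewrite ge0_integralZl//; last 2 first.
- by apply: emeasurable_funD; exact: mpow.
- by move=> x _; rewrite adde_ge0 ?poweR_ge0.
rewrite EFinM -muleA lee_wpmul2l ?lee_fin ?powR_ge0//.
rewrite ge0_integralD//; last 4 first.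
- by move=> x _; exact: poweR_ge0.
- exact: mpow.
- by move=> x _; exact: poweR_ge0.
- exact: mpow.
rewrite EFinD ge0_muleDl ?lee_fin ?powR_ge0//.
apply: leeD; last exact: hC.
by have := integral_subordinated_abs_powR he p1 mf; rewrite -(fineK WeE) poweR_EFin.
Qed.

Lemma markov_level (h : euclidean R n -> \bar R) (s : R) : 0 < s ->
  measurable_fun setT h -> (forall x, 0 <= h x)%E ->
  (gamma [set x | s%:E < h x] <= (s^-1)%:E * \int[gamma]_x h x)%E.
Proof.
move=> s0 mh h0.
have := le_integral_abse gamma measurableT mh s0.
under [X in (_ <= X)%E -> _]eq_integral do rewrite gee0_abs//.
rewrite setTI => H; rewrite lee_pdivlMl//.
apply: le_trans H; apply: lee_wpmul2l; first by rewrite lee_fin ltW.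
apply: le_measure; rewrite ?inE.
- by rewrite -[X in measurable X]setTI; exact: emeasurable_fun_o_infty.
- rewrite -[X in measurable X]setTI; apply: emeasurable_fun_c_infty => //.
  exact: measurableT_comp.
- by move=> x /= /ltW; rewrite gee0_abs.
Qed.

(** For t > 1 one has t^{b-1} <= C e^{t/2}, and [mehler_le_translate] applies with r0 = 1/e;
    extending the integral to all t only enlarges it. *)
Lemma late_weight_le_homogeneous : exists2 c : R, 0 < c &
  forall (f : euclidean R n -> R) x, measurable_fun setT f ->
  (subordinated_abs (late_weight 1 w) f x <=
   (c * expR (- sqnorm x))%:E *
   homogeneous_majorant (fun y => expR (sqnorm y) * `|f y|)%R x)%E.
Proof.
have [C Cp hC] := @powR_le_expR R (b - 1) 2^-1 ltac:(by []).
pose r0 : R := expR (- 1).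
have r01 : r0 < 1 by have /andP[] := expRN_itv (@ltr01 R).
have r0p : 0 < r0 by exact: expR_gt0.
pose q := Num.sqrt (pi * (1 - r0 ^+ 2)) ^+ n.
have q0 : 0 < q.
  by rewrite exprn_gt0// sqrtr_gt0 mulr_gt0 ?pi_gt0// onemX2_gt0 // r0p.
exists (C / q) => [|f x mf]; first exact: divr_gt0.
have hl := kernel_weight_late 1 (kernel_weight_power b).
have mF : measurable_fun setT (fun y : euclidean R n => expR (sqnorm y) * `|f y|).
  apply: measurable_funM; last exact: measurableT_comp.
  by apply: measurableT_comp => //; exact: measurable_sqnorm.
have mk : measurable_fun setT (fun z : measurableTypeR R * euclidean R n =>
    (homogeneous_kernel x z * (expR (sqnorm z.2) * `|f z.2|))%:E).
  apply/measurable_EFinP; apply: measurable_funM.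
    exact: (@measurable_homogeneous_kernel _ _ _ _ (fun=> x) id).
  exact: (measurableT_comp mF measurable_snd).
have c0 : (0 <= (C / q * expR (- sqnorm x))%:E)%E.
  by rewrite lee_fin mulr_ge0 ?expR_ge0// divr_ge0// ltW.
have k0 z : (0 <= (homogeneous_kernel x z * (expR (sqnorm z.2) * `|f z.2|))%:E)%E.
  rewrite lee_fin; apply: mulr_ge0; first exact: homogeneous_kernel_ge0.
  by apply: mulr_ge0 => //; exact: expR_ge0.
rewrite /homogeneous_majorant -ge0_integralZl//.
apply: ge0_le_integral => //.
- by move=> z _; rewrite lee_fin mulr_ge0// subordinated_kernel_ge0.
- apply/measurable_EFinP; apply: measurable_funM.
    exact: (measurable_subordinated_kernel hl (x := fun=> x) (z := id)).
  apply: measurableT_comp => //; exact: (measurableT_comp mf measurable_snd).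
- exact: emeasurable_funM.
move=> [t y] _ /=; rewrite -EFinM lee_fin /subordinated_kernel/= /late_weight.
case: ifPn => [t1|_]; last first.
  rewrite !mul0r; apply: mulr_ge0; first by move: c0; rewrite lee_fin.
  by have := k0 (t, y); rewrite lee_fin.
have t0 : 0 < t by rewrite (lt_trans _ t1).
have rr0 : expR (- t) <= r0 by rewrite /r0 ler_expR lerN2 ltW.
have h1 := mehler_le_translate x y (expR_gt0 (- t)) rr0 r01.
have h2 : w t <= C * expR (2^-1 * t) by rewrite /power_weight t0; apply/hC/ltW.
have w0 : 0 <= w t by exact: power_weight_ge0.
have m0 : 0 <= mehler (expR (- t)) x y by rewrite mehler_ge0// expR_ge0.
apply: le_trans (ler_wpM2r (normr_ge0 _) (ler_pM w0 m0 h2 h1)) _.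
rewrite le_eqVlt; apply/orP; left; apply/eqP.
rewrite -/(bump t x y) /homogeneous_kernel/= exprMn exprVn -/q -expRM_natl.
have -> : - ((n%:R - 2^-1) * t) = 2^-1 * t + n%:R * - t by ring.
by rewrite expRD; ring.
Qed.

Lemma subordinated_weak_bound : exists2 K : R, 0 <= K &
  forall (f : euclidean R n -> R) (s : R), measurable_fun setT f -> 0 < s ->
  (gamma [set x | s%:E < subordinated_abs w f x] <=
   (K / s)%:E * \int[gamma]_y `|f y|%:E)%E.
Proof.
have [c c0 hc] := late_weight_le_homogeneous.
have [K K0 hK] := @weak_type_level R n n_ge1.
have hw := kernel_weight_power b.
have he := kernel_weight_early 1 hw; have hl := kernel_weight_late 1 hw.
have We0 : (0 <= \int[mu]_t (early_weight 1 w t)%:E)%E.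
  by apply: integral_ge0 => t _; rewrite lee_fin; have [_ + _] := he.
have WeE : (\int[mu]_t (early_weight 1 w t)%:E)%E \is a fin_num.
  by rewrite ge0_fin_numE// integral_early_weight_lty.
pose W := fine (\int[mu]_t (early_weight 1 w t)%:E)%E.
have W0 : 0 <= W by exact: fine_ge0.
pose P : R := pi `^ (n%:R / 2).
have P0 : 0 < P by rewrite powR_gt0// pi_gt0.
(* The factors 2 come from halving the level: Markov's inequality with mass [W] treats early times,
   the weak-type bound late times, and 1/P converts e^{|y|^2} dy into gamma_{-1}. *)
exists (2 * W + 2 * K * c / P).
  by rewrite addr_ge0 ?mulr_ge0 ?invr_ge0 ?(ltW c0) ?(ltW P0).
move=> f s mf s0.
have s20 : 0 < s / 2 by rewrite divr_gt0.
have me := measurable_subordinated_abs he mf.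
have mw := measurable_subordinated_abs hw mf.
have mF : measurable_fun setT (fun y : euclidean R n => expR (sqnorm y) * `|f y|).
  apply: measurable_funM; last exact: measurableT_comp.
  by apply: measurableT_comp => //; exact: measurable_sqnorm.
have F0 (y : euclidean R n) : 0 <= expR (sqnorm y) * `|f y| by rewrite mulr_ge0 ?expR_ge0.
pose Bf := homogeneous_majorant (fun y : euclidean R n => expR (sqnorm y) * `|f y|).
have mB : measurable_fun setT Bf := measurable_homogeneous_majorant mF.
pose E1 : set (euclidean R n) :=
  [set x | ((s / 2)%:E < subordinated_abs (early_weight 1 w) f x)%E].
pose E2 : set (euclidean R n) :=
  [set x | ((s / 2)%:E < (c * expR (- sqnorm x))%:E * Bf x)%E].
have mE1 : measurable E1.
  by rewrite /E1 -[X in measurable X]setTI; exact: emeasurable_fun_o_infty.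
have mE2 : measurable E2.
  rewrite /E2 -[X in measurable X]setTI; apply: emeasurable_fun_o_infty => //.
  apply: emeasurable_funM => //; apply/measurable_EFinP; apply: measurable_funM => //.
  by do 2 apply: measurableT_comp => //; exact: measurable_sqnorm.
have If0 : (0 <= \int[gamma]_y `|f y|%:E)%E by exact: integral_ge0.
apply: (@le_trans _ _ (gamma E1 + gamma E2)%E).
  apply: (@le_trans _ _ (gamma (E1 `|` E2))); last exact: measureU2.
  apply: le_measure; rewrite ?inE.
  - by rewrite -[X in measurable X]setTI; exact: emeasurable_fun_o_infty.
  - exact: measurableU.
  move=> x /= sx.
  have [h1|h1] := ltP (s / 2)%:E (subordinated_abs (early_weight 1 w) f x); first by left.
  right; rewrite /E2 /=; apply: lt_le_trans (hc f x mf).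
  have h2 : ((s / 2)%:E + (s / 2)%:E < subordinated_abs w f x)%E.
    by rewrite -EFinD -splitr.
  rewrite ltNge; apply/negP => h3; move: h2.
  rewrite (subordinated_abs_split 1 x hw mf) ltNge => /negP; apply.
  exact: leeD.
rewrite mulrDl EFinD ge0_muleDl; last 2 first.
- by rewrite lee_fin divr_ge0 ?(ltW s0)// mulr_ge0.
- by rewrite lee_fin divr_ge0 ?(ltW s0)// mulr_ge0 ?invr_ge0 ?(ltW P0)// mulr_ge0 ?(ltW c0)// mulr_ge0.
apply: leeD.
  apply: le_trans (markov_level s20 me (subordinated_abs_ge0 he f)) _.
  rewrite (integral_subordinated_abs he mf) -(fineK WeE) muleA -EFinM.
  rewrite lee_wpmul2r// lee_fin le_eqVlt; apply/orP; left; apply/eqP.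
  by rewrite /W; field; rewrite gt_eqF.
apply: le_trans (hK _ _ _ mF F0 c0 s20) _.
rewrite integral_sqnorm_density//; last exact: measurableT_comp.
rewrite muleA -EFinM lee_wpmul2r// lee_fin le_eqVlt; apply/orP; left; apply/eqP.
by rewrite -/P; field; rewrite !gt_eqF.
Qed.

End subordinated_total.

(** * Hermite polynomials against Gaussians *)

Section hermite_polynomials.
Context {R : realType}.
Local Notation mu := (@lebesgue_measure R).

Lemma horner_le_expR (p : {poly R}) (c : R) : 0 < c ->
  exists2 C : R, 0 <= C & forall y, `|p.[y]| <= C * expR (c * y ^+ 2).
Proof.
elim/poly_ind: p c => [|p a ih] c c0.
  by exists 0 => // y; rewrite horner0 normr0 mul0r.
have c20 : 0 < c / 2 by rewrite divr_gt0.
have [C C0 hC] := ih _ c20.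
(* Half of the exponent goes to the induction hypothesis, the other half absorbs the new factor
   through |y| <= (1 + 2/c) e^{c y^2/2}. *)
exists (C * (1 + 2 / c) + `|a|).
  by rewrite addr_ge0// mulr_ge0// addr_ge0// divr_ge0 ?ltW.
move=> y; rewrite hornerMXaddC (le_trans (ler_normD _ _))// mulrDl normrM.
have e1 (k : R) : 0 <= k -> 1 <= expR (k * y ^+ 2).
  by move=> k0; rewrite -[leLHS]expR0 ler_expR mulr_ge0// sqr_ge0.
apply: lerD; last by rewrite ler_peMr// e1// ltW.
have -> : expR (c * y ^+ 2) = expR (c / 2 * y ^+ 2) * expR (c / 2 * y ^+ 2).
  by rewrite -expRD; congr expR; field.
rewrite [leRHS](_ : _ = (C * expR (c / 2 * y ^+ 2)) *
  ((1 + 2 / c) * expR (c / 2 * y ^+ 2))); last by ring.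
apply: ler_pM => //.
have h := expR_ge1Dx (c / 2 * y ^+ 2).
have hy : `|y| <= 1 + y ^+ 2.
  have := sqr_ge0 (`|y| - 1); rewrite sqrrB1 real_normK ?num_real// => h2.
  by have := sqr_ge0 y; lra.
apply: (le_trans hy).
have -> : 1 + y ^+ 2 = 1 + 2 / c * (c / 2 * y ^+ 2) by field; rewrite gt_eqF.
rewrite [leRHS]mulrDl mul1r; apply: lerD; first exact/e1/ltW.
rewrite ler_wpM2l ?divr_ge0 ?(ltW c0)//.
by rewrite (le_trans _ h)// lerDr.
Qed.

Definition gauss_poly (a b : R) (p : {poly R}) (y : R) : R :=
  p.[y] * expR (- a * (y - b) ^+ 2).

Lemma measurable_gauss_poly a b p :
  measurable_fun (setT : set (measurableTypeR R)) (gauss_poly a b p).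
Proof.
apply: measurable_funM.
  apply: (@continuous_measurable_fun R); exact: continuous_horner.
apply: measurableT_comp => //; apply: measurable_funM => //.
by apply: measurable_funX; exact: measurable_funB.
Qed.

Lemma gauss_poly_le a b p : 0 < a -> exists2 C : R, 0 <= C &
  forall y, `|gauss_poly a b p y| <= C * expR (- (a / 4) * (y - 0) ^+ 2).
Proof.
move=> a0; have a40 : 0 < a / 4 by rewrite divr_gt0.
have [C C0 hC] := horner_le_expR p a40.
(* The factor e^{a b^2} pays for recentring at 0: the exponents then differ by (a/2) (y - 2 b)^2. *)
exists (C * expR (a * b ^+ 2)) => [|y]; first by rewrite mulr_ge0 ?expR_ge0.
rewrite normrM (ger0_norm (expR_ge0 _)).
apply: le_trans (ler_wpM2r (expR_ge0 _) (hC y)) _.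
rewrite -!mulrA ler_wpM2l// -!expRD ler_expR subr0 -subr_ge0.
rewrite [leRHS](_ : _ = a / 2 * (y - 2 * b) ^+ 2); last by field.
by rewrite mulr_ge0 ?sqr_ge0// divr_ge0// ltW.
Qed.

Lemma integrable_gauss_poly a b p : 0 < a ->
  mu.-integrable setT (EFin \o gauss_poly a b p).
Proof.
move=> a0; have [C C0 hC] := gauss_poly_le b p a0.
have [iG _] := gauss1_integral 0 (divr_gt0 a0 (ltr0n R 4)).
have iCG := integrableZl measurableT C iG.
apply: (le_integrable measurableT _ _ iCG).
  by apply/measurable_EFinP; exact: measurable_gauss_poly.
move=> y _; rewrite /= lee_fin (le_trans (hC y))//.
by rewrite ger0_norm// mulr_ge0// expR_ge0.
Qed.

Definition gauss_int (a b : R) (p : {poly R}) : R := \int[mu]_y gauss_poly a b p y.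

Lemma gauss_intE a b p : 0 < a ->
  (\int[mu]_y (gauss_poly a b p y)%:E = (gauss_int a b p)%:E)%E.
Proof.
move=> a0; rewrite /gauss_int /Rintegral fineK//.
exact: (integrable_fin_num measurableT (integrable_gauss_poly b p a0)).
Qed.

Lemma gauss_intD a b p q : 0 < a ->
  gauss_int a b (p + q) = gauss_int a b p + gauss_int a b q.
Proof.
move=> a0; rewrite /gauss_int -RintegralD//; last 2 first.
- exact: integrable_gauss_poly.
- exact: integrable_gauss_poly.
by apply: eq_Rintegral => y _; rewrite /= /gauss_poly hornerD; ring.
Qed.

Lemma gauss_intZ a b c p : 0 < a -> gauss_int a b (c *: p) = c * gauss_int a b p.
Proof.
move=> a0; rewrite /gauss_int -RintegralZl//; last exact: integrable_gauss_poly.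
by apply: eq_Rintegral => y _; rewrite /= /gauss_poly hornerZ; ring.
Qed.

(** The integrand is the derivative of p(y) e^{-a (y - b)^2}, so on symmetric intervals only
    boundary terms remain; these vanish by Gaussian decay, and dominated convergence gives the whole
    integral. *)
Lemma gauss_int_ibp a b p : 0 < a ->
  gauss_int a b (p^`() - (2 * a) *: (('X - b%:P) * p)) = 0.
Proof.
move=> a0; set q := _ - _.
pose F := gauss_poly a b p; pose f := gauss_poly a b q.
have dF (y : R) : is_derive y 1 F (f y).
  have -> : F = horner p * (expR \o (fun z => - a * (z - b) ^+ 2)) by [].
  apply: is_derive_eq.
  rewrite /= /f /gauss_poly /q /GRing.scale/= !hornerE /=.
  by ring.
have cf : continuous f.
  move=> y; apply: continuousM; first exact: continuous_horner.
  apply: continuous_comp; last exact: continuous_expR.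
  apply: continuousM; first exact: cst_continuous.
  apply: (@continuous_comp _ _ _ (fun z => z - b) (fun z => z ^+ 2)).
    by apply: continuousB; [exact: id|exact: cst_continuous].
  exact: sqr_continuous.
have [C C0 hC] := gauss_poly_le b p a0.
have if_ := integrable_gauss_poly b q a0.
have mf : measurable_fun (setT : set (measurableTypeR R)) (EFin \o f).
  exact: measurable_int if_.
pose A (N : nat) : set (measurableTypeR R) := `[- N.+1%:R, N.+1%:R]%classic.
have mA N : measurable (A N) by exact: measurable_itv.
have FTC N : (\int[mu]_y ((EFin \o f) \_ (A N)) y = (F N.+1%:R - F (- N.+1%:R))%:E)%E.
  rewrite -integral_mkcond (FTC_itv _ (fun y _ => dF y) (fun y _ => cf y))//.
  by rewrite gtrN.
have cvA : {ae mu, forall y, setT y -> ((EFin \o f) \_ (A N)) y @[N --> \oo] --> (EFin \o f) y}.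
  apply: nearW => y _; apply: cvg_near_cst; near=> k.
  rewrite patchE ifT// mem_setE in_itv/= -ler_norml.
  near: k; exists (Num.truncn `|y|) => //= k /= hk.
  by rewrite (le_trans (ltW (truncnS_gt _)))// ler_nat ltnS.
have bdA : {ae mu, forall y N, setT y -> (`|((EFin \o f) \_ (A N)) y| <= (abse \o (EFin \o f)) y)%E}.
  apply: nearW => y N _; rewrite patchE; case: ifP => // _.
  by rewrite abse0 /= lee_fin.
have [_ _] := @dominated_convergence _ _ _ mu setT measurableT
  (fun N => (EFin \o f) \_ (A N)) (EFin \o f) (abse \o (EFin \o f))
  (fun N => (measurable_restrictT _ (mA N)).1 (measurable_funTS mf)) mf cvA
  (integrable_abse if_) bdA.
rewrite gauss_intE//; under eq_fun do rewrite FTC.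
move=> /fine_cvgP[_ /=]; rewrite -/(gauss_int a b q) => h.
have lim0 : (fun N => F N.+1%:R - F (- N.+1%:R)) @ \oo --> (0 : R).
  have a40 : 0 < a / 4 by rewrite divr_gt0.
  have geo (u : nat -> R) : (forall N, `|u N| = N.+1%:R) ->
      (fun N => F (u N)) @ \oo --> (0 : R).
    move=> uE; apply/norm_cvg0P.
    (* At distance N + 1 the bound C e^{-(a/4) (N + 1)^2} is below a geometric sequence, since (N +
       1)^2 >= N. *)
    apply: (@squeeze_cvgr _ _ _ _ (cst 0) (geometric C (expR (- (a / 4))))).
    - apply: nearW => N; rewrite normr_ge0 (le_trans (hC _))//= ler_wpM2l//.
      rewrite -expRM_natl ler_expR subr0 -real_normK ?num_real// uE mulNr mulrN lerN2.
      rewrite mulrC ler_pM2l// -natrX ler_nat.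
      by rewrite (leq_trans (leqnSn N))// -[leqLHS]mul1n leq_mul.
    - exact: cvg_cst.
    - by apply: cvg_geometric; rewrite ger0_norm ?expR_ge0// -[ltRHS]expR0 ltr_expR oppr_lt0.
  rewrite -[0](subr0 0); apply: cvgB; apply: geo => N.
    by rewrite ger0_norm.
  by rewrite normrN ger0_norm.
exact: (cvg_unique _ h lim0).
Unshelve. all: by end_near. Qed.

(** Differentiating p(t) e^{-t^2} gives -(2 t p - p') e^{-t^2}; this is the recurrence hidden in
    Rodrigues' formula. *)
Fixpoint herm (m : nat) : {poly R} :=
  if m is m'.+1 then (2 *: ('X * herm m')) - (herm m')^`() else 1.

Lemma hermE m (z : R) : hermite m z = (herm m).[z].
Proof.
suff h : derive1n m (fun t : R => expR (- t ^+ 2)) =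
    fun t => (-1) ^+ m * ((herm m).[t] * expR (- t ^+ 2)).
  have e := @expRxMexpNx_1 R (z ^+ 2).
  have sg : (-1) ^+ m * (-1) ^+ m = 1 :> R by rewrite -expr2 sqrr_sign.
  rewrite /hermite h; set u := _.[z].
  transitivity (((-1) ^+ m * (-1) ^+ m) * (expR (z ^+ 2) * expR (- z ^+ 2)) * u).
    by ring.
  by rewrite e sg !mul1r.
elim: m => [|m ih].
  by apply/funext => t; rewrite derive1n0 expr0 mul1r hornerE mul1r.
rewrite derive1nS ih; apply/funext => t; rewrite derive1E.
have d : is_derive t 1 ((-1) ^+ m \*: (horner (herm m) *
    (expR \o (fun t : R => - t ^+ 2))))
    ((-1) ^+ m.+1 * ((herm m.+1).[t] * expR (- t ^+ 2))).
  apply: is_derive_eq.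
  rewrite /= /GRing.scale/= !hornerE /= [_ ^+ m.+1]exprS.
  by ring.
by rewrite -[RHS](@derive_val _ _ _ _ _ _ _ d).
Qed.

Lemma deriv_herm m : (herm m.+1)^`() = (2 * m.+1%:R) *: herm m.
Proof.
elim: m => [|m ih].
  by rewrite /= mulr1 -polyC1 derivC subr0 derivZ derivX mulr1 polyC1.
have E k : herm k.+1 = 2 *: ('X * herm k) - (herm k)^`() by [].
rewrite [in LHS]E derivB derivZ derivM derivX mul1r ih derivZ -scalerAr.
have gen (c : R) (A B C : {poly R}) :
    2 *: (A + c *: B) - c *: C = 2 *: A + c *: (2 *: B - C).
  by rewrite scalerDr [in RHS]scalerBr !scalerA addrA [2 * c]mulrC.
rewrite gen.
by rewrite -E -scalerDl; congr (_ *: _); rewrite -[m.+2%:R]natr1; ring.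
Qed.

Lemma hermSS m : herm m.+2 = 2 *: ('X * herm m.+1) - (2 * m.+1%:R) *: herm m.
Proof. by rewrite -deriv_herm. Qed.

Lemma gauss_intN a b p : 0 < a -> gauss_int a b (- p) = - gauss_int a b p.
Proof. by move=> a0; rewrite -scaleN1r gauss_intZ// mulN1r. Qed.

(** Under the integral, integration by parts turns multiplication by 2 y into 2 r x plus s d/dy. In
    the three-term recurrence the coefficient of [herm m] becomes 2 (m + 1) (s - 1) = -2 (m + 1)
    r^2, so the integrals satisfy the recurrence of r^m H_m(x). *)
Lemma gauss_int_herm (s r x : R) (m : nat) : 0 < s -> s = 1 - r ^+ 2 ->
  gauss_int s^-1 (r * x) (herm m) = r ^+ m * (herm m).[x] * Num.sqrt (pi * s).
Proof.
move=> s0 sE; have a0 : 0 < s^-1 by rewrite invr_gt0.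
set a := s^-1; set b := r * x.
have g0 : gauss_int a b (herm 0) = Num.sqrt (pi * s).
  have [_ h] := gauss1_integral b a0.
  rewrite /gauss_int /Rintegral /= (_ : (fun y => _) = (fun y => (expR (- a * (y - b) ^+ 2))%:E)).
    by rewrite h /= /a invrK.
  by apply/funext => y; rewrite /gauss_poly hornerE mul1r.
have ibp p : gauss_int a b (2 *: ('X * p)) = 2 * b * gauss_int a b p + s * gauss_int a b p^`().
  have := gauss_int_ibp b p a0.
  rewrite mulrBl scalerBr opprB gauss_intD// gauss_intD// gauss_intN// mul_polyC !gauss_intZ//.
  move=> h; rewrite -/a -/b in h *.
  have : s * (gauss_int a b p^`() + (2 * a * (b * gauss_int a b p) - 2 * a * gauss_int a b ('X * p))) = 0.
    by rewrite h mulr0.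
  have sa : s * a = 1 by rewrite /a mulfV// gt_eqF.
  move=> h2; apply/eqP; rewrite -subr_eq0; apply/eqP; rewrite -[RHS]oppr0 -h2.
  transitivity (s * a * (2 * gauss_int a b ('X * p)) - s * a * (2 * b * gauss_int a b p) -
    s * gauss_int a b p^`()); last by ring.
  by rewrite sa; ring.
elim/ltn_ind: m => -[|[|m]] ih.
- have -> : (herm 0).[x] = 1 by rewrite /= hornerE.
  by rewrite g0 expr0 !mul1r.
- have -> : herm 1 = 2 *: ('X * herm 0).
    by rewrite /= -[X in _ - X^`()]polyC1 derivC subr0.
  have d0 : (herm 0)^`() = 0 *: 1 by rewrite /= -polyC1 derivC scale0r.
  rewrite ibp g0 d0 gauss_intZ// mul0r mulr0 addr0 expr1 hornerZ hornerM hornerX.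
  have -> : (herm 0).[x] = 1 by rewrite /= hornerE.
  by rewrite /b; ring.
- rewrite hermSS gauss_intD// gauss_intN// ibp deriv_herm !gauss_intZ//.
  rewrite ih// ih// !hornerE /= /b sE.
  by rewrite !exprS; ring.
Qed.

(** For the weight e^{-y^2} the raising operator 2 y - d/dy is adjoint to d/dy, so both indices
    descend together, with a factor 2 (i + 1) at each step. *)
Lemma gauss_int_herm_mul (i j : nat) :
  gauss_int 1 0 (herm i * herm j) =
  if i == j then 2 ^+ i * i`!%:R * Num.sqrt pi else 0.
Proof.
have step k l : gauss_int 1 0 (herm k * herm l.+1) = gauss_int 1 0 ((herm k)^`() * herm l).
  have E : (herm k * herm l)^`() - (2 * 1) *: (('X - 0%:P) * (herm k * herm l)) =
      (herm k)^`() * herm l + - (herm k * herm l.+1).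
    have -> : herm l.+1 = 2 *: ('X * herm l) - (herm l)^`() by [].
    by rewrite derivM subr0 mulr1 -!mul_polyC; ring.
  have := gauss_int_ibp 0 (herm k * herm l) ltr01.
  rewrite E gauss_intD// gauss_intN// => /eqP.
  by rewrite subr_eq0 => /eqP ->.
have zero k : gauss_int 1 0 (herm 0 * herm k.+1) = 0.
  have d0 : (herm 0)^`() = 0 by rewrite /= -polyC1 derivC.
  have := @gauss_intZ 1 0 0 0 ltr01; rewrite scale0r mul0r => g00.
  by rewrite step d0 mul0r g00.
elim: i j => [|i ih] [|j].
- rewrite eqxx expr0 fact0 !mul1r.
  have [_ h] := gauss1_integral (0 : R) ltr01.
  rewrite /gauss_int /Rintegral (_ : (fun y => _) = (fun y => (expR (- 1 * (y - 0) ^+ 2))%:E)).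
    by rewrite h /= divr1.
  by apply/funext => y; rewrite /gauss_poly !hornerE ?mul1r.
- by rewrite zero.
- by rewrite mulrC zero.
- rewrite step deriv_herm -scalerAl gauss_intZ// ih eqSS; case: eqP => _; last by rewrite mulr0.
  by rewrite factS natrM exprS; ring.
Qed.

End hermite_polynomials.

(** * Hermite functions in n variables and the Hilbert-Schmidt norm *)

Section multi_hermite.
Context {R : realType} {n : nat}.
Local Notation mu := (@lebesgue_measure R).
Local Notation L := (@lebesgue_measure_tuple R n).
Implicit Types k l : n.-tuple nat.

(** The squared norm of [hermite_tilde k] for e^{|y|^2} dy, hence without the factor pi^{n/2} of
    gamma_{-1}. *)
Definition hermite_sqnorm k : R :=
  \prod_(i < n) (2 ^+ tnth k i * (tnth k i)`!%:R * Num.sqrt pi).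

Lemma hermite_sqnorm_gt0 k : 0 < hermite_sqnorm k.
Proof.
apply: prodr_gt0 => i _.
by rewrite !mulr_gt0 ?exprn_gt0 ?ltr0n ?fact_gt0// sqrtr_gt0 pi_gt0.
Qed.

Lemma hermite_tildeE k (x : euclidean R n) :
  hermite_tilde k x = \prod_(i < n) gauss_poly 1 0 (herm (tnth k i)) (tnth x i).
Proof.
rewrite /hermite_tilde /multi_hermite -mulN1r expR_sqnorm -big_split/=.
by apply: eq_bigr => i _; rewrite hermE /gauss_poly subr0 mulrC.
Qed.

Lemma measurable_hermite_tilde k : measurable_fun setT (@hermite_tilde R n k).
Proof.
rewrite (funext (hermite_tildeE k)); apply: measurable_prod => i _.
exact: (measurableT_comp (measurable_gauss_poly 1 0 _) (measurable_tnth i)).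
Qed.

(** Completing the square turns the kernel times e^{-y^2} into e^{-a^2} times a Gaussian in [y]
    centred at r a, to which [gauss_int_herm] applies; the prefactor of the kernel supplies the
    additional [r], whence the + n in the eigenvalue. *)
Lemma mehler1_hermite (r a : R) (m : nat) : 0 < r < 1 ->
  mu.-integrable setT (EFin \o (fun y => mehler1 r a y * gauss_poly 1 0 (herm m) y)) /\
  (\int[mu]_y (mehler1 r a y * gauss_poly 1 0 (herm m) y)%:E =
   (r ^+ m.+1 * gauss_poly 1 0 (herm m) a)%:E)%E.
Proof.
move=> r01; have s0 := onemX2_gt0 r01; set s := 1 - r ^+ 2 in s0.
have a0 : 0 < s^-1 by rewrite invr_gt0.
pose c := r / Num.sqrt (pi * s) * expR (- a ^+ 2).
have E y : mehler1 r a y * gauss_poly 1 0 (herm m) y =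
    c * gauss_poly s^-1 (r * a) (herm m) y.
  rewrite /mehler1 -/s /gauss_poly /c subr0.
  transitivity (r / Num.sqrt (pi * s) * (herm m).[y] *
     (expR (- (a - r * y) ^+ 2 / s) * expR (- 1 * y ^+ 2))); first by ring.
  transitivity (r / Num.sqrt (pi * s) * (herm m).[y] *
     (expR (- a ^+ 2) * expR (- s^-1 * (y - r * a) ^+ 2))); last by ring.
  rewrite -!expRD.
  have -> // : - (a - r * y) ^+ 2 / s + - 1 * y ^+ 2 = - a ^+ 2 + - s^-1 * (y - r * a) ^+ 2.
  by rewrite /s; field; rewrite gt_eqF.
have iG := integrable_gauss_poly (r * a) (herm m) a0.
split.
  rewrite (_ : _ \o _ = (fun y => c%:E * (gauss_poly s^-1 (r * a) (herm m) y)%:E)%E).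
    exact: (integrableZl measurableT c iG).
  by apply/funext => y /=; rewrite E.
under eq_integral do rewrite E EFinM.
rewrite (integralZl measurableT iG) gauss_intE// -EFinM; congr EFin.
rewrite (gauss_int_herm _ _ s0 (erefl _)) /c /gauss_poly subr0 mulN1r [_ ^+ m.+1]exprS.
have q0 : Num.sqrt (pi * s) != 0 by rewrite gt_eqF// sqrtr_gt0 mulr_gt0 ?pi_gt0.
by field.
Qed.

Lemma mehler_hermite_tilde (r : R) k (x : euclidean R n) : 0 < r < 1 ->
  L.-integrable setT (fun y => (mehler r x y * hermite_tilde k y)%:E) /\
  (\int[L]_y (mehler r x y * hermite_tilde k y)%:E =
   (r ^+ (multi_index_size k + n) * hermite_tilde k x)%:E)%E.
Proof.
move=> r01.
have [i e] := @integral_tuple_prod R n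
  (fun i y => mehler1 r (tnth x i) y * gauss_poly 1 0 (herm (tnth k i)) y)
  (fun i => r ^+ (tnth k i).+1 * gauss_poly 1 0 (herm (tnth k i)) (tnth x i))
  (fun i => (mehler1_hermite _ _ r01).1) (fun i => (mehler1_hermite _ _ r01).2).
have E (y : euclidean R n) : mehler r x y * hermite_tilde k y = \prod_(i < n)
    (mehler1 r (tnth x i) (tnth y i) * gauss_poly 1 0 (herm (tnth k i)) (tnth y i)).
  by rewrite hermite_tildeE /mehler -big_split.
split.
  rewrite (_ : (fun y => _) = (fun y => (\prod_(i < n)
    (mehler1 r (tnth x i) (tnth y i) * gauss_poly 1 0 (herm (tnth k i)) (tnth y i)))%:E))//.
  by apply/funext => y; rewrite E.
under eq_integral do rewrite E.
rewrite e big_split/= -hermite_tildeE; congr (_ * _)%:E.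
rewrite -expr_sum; congr (_ ^+ _); rewrite /multi_index_size.
by rewrite -[X in (_ + X)%N]card_ord -sum1_card -big_split/=; apply: eq_bigr => j _; rewrite addn1.
Qed.

Lemma hermite_tilde_orthogonal k l :
  L.-integrable setT
    (fun y : euclidean R n => (hermite_tilde k y * hermite_tilde l y * expR (sqnorm y))%:E) /\
  (\int[L]_y (hermite_tilde k y * hermite_tilde l y * expR (sqnorm y))%:E =
   (if k == l then hermite_sqnorm k else 0)%:E)%E.
Proof.
pose p i := herm (R := R) (tnth k i) * herm (tnth l i).
have E (y : euclidean R n) : hermite_tilde k y * hermite_tilde l y * expR (sqnorm y) =
    \prod_(i < n) gauss_poly 1 0 (p i) (tnth y i).
  rewrite !hermite_tildeE -[sqnorm y]mul1r expR_sqnorm -!big_split/=.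
  apply: eq_bigr => i _; rewrite /gauss_poly /p hornerM subr0 mul1r mulN1r.
  have e := @expRxMexpNx_1 R (tnth y i ^+ 2).
  transitivity ((herm (tnth k i)).[tnth y i] * (herm (tnth l i)).[tnth y i] *
    expR (- tnth y i ^+ 2) * (expR (tnth y i ^+ 2) * expR (- tnth y i ^+ 2))).
    by ring.
  by rewrite e mulr1.
have [i e] := @integral_tuple_prod R n (fun i => gauss_poly 1 0 (p i))
  (fun i => gauss_int 1 0 (p i)) (fun i => integrable_gauss_poly 0 (p i) ltr01)
  (fun i => gauss_intE 0 (p i) ltr01).
split.
  rewrite (_ : (fun y => _) = (fun y => (\prod_(i < n) gauss_poly 1 0 (p i) (tnth y i))%:E))//.
  by apply/funext => y; rewrite E.
under eq_integral do rewrite E.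
rewrite e; congr EFin; rewrite /p.
case: eqP => [<-|kl].
  by apply: eq_bigr => j _; rewrite gauss_int_herm_mul eqxx.
have [j kj] : exists j, tnth k j != tnth l j.
  apply: contrapT => /forallNP h; apply: kl; apply: eq_from_tnth => j.
  by have /negP := h j; rewrite negbK => /eqP.
by rewrite (bigD1 j)//= gauss_int_herm_mul (negbTE kj) mul0r.
Qed.

Lemma mehler1_sqr_integral (r a : R) : 0 < r < 1 ->
  mu.-integrable setT (EFin \o (fun y => mehler1 r a y ^+ 2 * expR (- y ^+ 2))) /\
  (\int[mu]_y (mehler1 r a y ^+ 2 * expR (- y ^+ 2))%:E =
   (r ^+ 2 / (pi * (1 - r ^+ 2)) * Num.sqrt (pi / ((1 + r ^+ 2) / (1 - r ^+ 2))) *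
    expR (- (2 / (1 + r ^+ 2)) * a ^+ 2))%:E)%E.
Proof.
move=> r01; have s0 := onemX2_gt0 r01; set s := 1 - r ^+ 2 in s0 *.
have /andP[r0 r1] := r01.
have t0 : 0 < 1 + r ^+ 2 by rewrite addr_gt0// exprn_gt0.
have A0 : 0 < (1 + r ^+ 2) / s by rewrite divr_gt0.
have [iG cG] := gauss1_integral (2 * r * a / (1 + r ^+ 2)) A0.
pose c := r ^+ 2 / (pi * s) * expR (- (2 / (1 + r ^+ 2)) * a ^+ 2).
have E y : mehler1 r a y ^+ 2 * expR (- y ^+ 2) =
    c * expR (- ((1 + r ^+ 2) / s) * (y - 2 * r * a / (1 + r ^+ 2)) ^+ 2).
  rewrite /mehler1 -/s /c !exprMn exprVn sqr_sqrtr; last first.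
    by rewrite mulr_ge0 ?pi_ge0// ltW.
  rewrite -[LHS]mulrA -[RHS]mulrA; congr (_ * _).
  rewrite -expRM_natl -!expRD; congr expR.
  by rewrite /s; field; rewrite !gt_eqF.
split.
  rewrite (_ : _ \o _ = (fun y => c%:E *
     (expR (- ((1 + r ^+ 2) / s) * (y - 2 * r * a / (1 + r ^+ 2)) ^+ 2))%:E)%E).
    exact: (integrableZl measurableT c iG).
  by apply/funext => y /=; rewrite E.
under eq_integral do rewrite E EFinM.
rewrite (integralZl measurableT iG) cG -EFinM; congr EFin.
by rewrite /c mulrAC.
Qed.

(** Relative to e^{|y|^2} dy the kernel is [mehler] times e^{-|y|^2}, so this is its squared
    Hilbert-Schmidt norm; per coordinate, r^2/(1 - r^2) is the sum of the squared eigenvalues r^{2(m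
    + 1)}. *)
Lemma mehler_sqr_integral (r : R) : 0 < r < 1 ->
  (forall x : euclidean R n, L.-integrable setT (fun y => (mehler r x y ^+ 2 * expR (- sqnorm y))%:E)) /\
  (\int[L]_x ((\int[L]_y (mehler r x y ^+ 2 * expR (- sqnorm y))%:E) * (expR (sqnorm x))%:E) =
   ((r ^+ 2 / (1 - r ^+ 2)) ^+ n)%:E)%E.
Proof.
move=> r01; have s0 := onemX2_gt0 r01; set s := 1 - r ^+ 2 in s0 *.
have /andP[r0 r1] := r01.
have t0 : 0 < 1 + r ^+ 2 by rewrite addr_gt0// exprn_gt0.
pose c := r ^+ 2 / (pi * s) * Num.sqrt (pi / ((1 + r ^+ 2) / s)).
have E (x y : euclidean R n) : mehler r x y ^+ 2 * expR (- sqnorm y) =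
    \prod_(i < n) (mehler1 r (tnth x i) (tnth y i) ^+ 2 * expR (- tnth y i ^+ 2)).
  rewrite /mehler -prodrXl -[- sqnorm y]mulN1r expR_sqnorm -big_split/=.
  by apply: eq_bigr => i _; rewrite mulN1r.
have H x := @integral_tuple_prod R n
  (fun i y => mehler1 r (tnth x i) y ^+ 2 * expR (- y ^+ 2))
  (fun i => c * expR (- (2 / (1 + r ^+ 2)) * tnth x i ^+ 2))
  (fun i => (mehler1_sqr_integral _ r01).1) (fun i => (mehler1_sqr_integral _ r01).2).
split=> [x|].
  have [i _] := H x.
  rewrite (_ : (fun y => _) = (fun y => (\prod_(i < n)
    (mehler1 r (tnth x i) (tnth y i) ^+ 2 * expR (- tnth y i ^+ 2)))%:E))//.
  by apply/funext => y; rewrite E.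
have A0 : 0 < s / (1 + r ^+ 2) by rewrite divr_gt0.
have [iG cG] := gauss1_integral (0 : R) A0.
have F (x : euclidean R n) : ((\int[L]_y (mehler r x y ^+ 2 * expR (- sqnorm y))%:E) *
    (expR (sqnorm x))%:E)%E =
    (\prod_(i < n) (c * expR (- (s / (1 + r ^+ 2)) * (tnth x i - 0) ^+ 2)))%:E.
  under eq_integral do rewrite E.
  have [_ ->] := H x; rewrite -[sqnorm x]mul1r expR_sqnorm -EFinM -big_split/=.
  congr EFin; apply: eq_bigr => i _; rewrite -mulrA -expRD; congr (_ * expR _).
  by rewrite /s; field; rewrite gt_eqF.
under eq_integral do rewrite F.
have [_ ->] := @integral_tuple_prod R n
  (fun i x => c * expR (- (s / (1 + r ^+ 2)) * (x - 0) ^+ 2))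
  (fun=> c * Num.sqrt (pi / (s / (1 + r ^+ 2))))
  (fun i => integrableZl measurableT c iG)
  (fun i => etrans (integralZl measurableT iG c) (congr1 (fun z => c%:E * z)%E cG)).
rewrite prodr_const card_ord; congr ((_ ^+ _)%:E).
have p0 : 0 < pi / ((1 + r ^+ 2) / s) by rewrite divr_gt0 ?pi_gt0// divr_gt0.
rewrite /c -mulrA -sqrtrM; last exact: ltW.
have -> : pi / ((1 + r ^+ 2) / s) * (pi / (s / (1 + r ^+ 2))) = pi ^+ 2.
  by field; rewrite !gt_eqF.
rewrite sqrtr_sqr ger0_norm ?pi_ge0//.
have pn : (pi : R) != 0 by rewrite gt_eqF// pi_gt0.
move: (@pi R) pn => z zn.
by field; rewrite zn gt_eqF.
Qed.

End multi_hermite.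

(** * The L^2 inner product and Bessel's identity *)

Section gaussian_form.
Context {R : realType} {n : nat}.
Local Notation L := (@lebesgue_measure_tuple R n).
Local Notation E y := (expR (sqnorm y)).
Implicit Types (f g h : euclidean R n -> R) (k l : n.-tuple nat)
  (s : seq (n.-tuple nat)).

(** The factor pi^{n/2} of gamma_{-1} is left out here and in [form]; it cancels in the Hermite
    coefficients. *)
Definition in_L2 f := measurable_fun setT f /\
  L.-integrable setT (fun y => (f y ^+ 2 * E y)%:E).

Definition form f g : R := \int[L]_y (f y * g y * E y).

Lemma measurable_expR_sqnorm1 : measurable_fun setT (fun y : euclidean R n => E y).
Proof. by apply: measurableT_comp => //; exact: measurable_sqnorm. Qed.

Lemma in_L2_mul f g : in_L2 f -> in_L2 g ->
  L.-integrable setT (fun y => (f y * g y * E y)%:E).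
Proof.
move=> [mf if_] [mg ig].
apply: (le_integrable measurableT _ _ (integrableD measurableT if_ ig)).
  apply/measurable_EFinP; apply: measurable_funM; first exact: measurable_funM.
  exact: measurable_expR_sqnorm1.
move=> y _ /=; rewrite lee_fin -mulrDl !normrM (ger0_norm (expR_ge0 _)).
rewrite ler_wpM2r ?expR_ge0// [leRHS]ger0_norm; last by rewrite addr_ge0 ?sqr_ge0.
have := sqr_ge0 (`|f y| - `|g y|).
rewrite sqrrB !real_normK ?num_real// => h.
by have := sqr_ge0 (f y); have := sqr_ge0 (g y); lra.
Qed.

Lemma formE f g : in_L2 f -> in_L2 g ->
  (\int[L]_y (f y * g y * E y)%:E = (form f g)%:E)%E.
Proof.
move=> hf hg; rewrite /form /Rintegral fineK//.
exact: (integrable_fin_num measurableT (in_L2_mul hf hg)).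
Qed.

Lemma formC f g : form f g = form g f.
Proof. by apply: eq_Rintegral => y _ /=; rewrite [f y * _]mulrC. Qed.

Lemma in_L2_lin (a : R) f g : in_L2 f -> in_L2 g -> in_L2 (fun y => f y + a * g y).
Proof.
move=> hf hg; have [mf if_] := hf; have [mg ig] := hg.
have m : measurable_fun setT (fun y => f y + a * g y).
  by apply: measurable_funD => //; exact: measurable_funM.
split=> //.
have i1 := integrableZl measurableT (2 * a) (in_L2_mul hf hg).
have i2 := integrableZl measurableT (a ^+ 2) ig.
rewrite (_ : (fun y => _) = (((fun y => (f y ^+ 2 * E y)%:E) \+
  (fun y => (2 * a)%:E * (f y * g y * E y)%:E)) \+
  (fun y => (a ^+ 2)%:E * (g y ^+ 2 * E y)%:E))%E).
  apply: integrableD => //; exact: integrableD.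
by apply/funext => y /=; rewrite -!EFinM -!EFinD; congr EFin; ring.
Qed.

Lemma form_linl (a : R) f g h : in_L2 f -> in_L2 g -> in_L2 h ->
  form (fun y => f y + a * g y) h = form f h + a * form g h.
Proof.
move=> hf hg hh.
have i1 := in_L2_mul hf hh; have i2 := in_L2_mul hg hh.
rewrite /form -RintegralZl// -RintegralD//; last exact: (integrableZl measurableT a i2).
by apply: eq_Rintegral => y _ /=; ring.
Qed.

Lemma form_ge0 f : 0 <= form f f.
Proof.
by apply: Rintegral_ge0 => y _; rewrite -expr2 mulr_ge0 ?sqr_ge0 ?expR_ge0.
Qed.

Lemma form_lin2 (a : R) f g : in_L2 f -> in_L2 g ->
  form (fun y => f y + a * g y) (fun y => f y + a * g y) =
  form f f + 2 * a * form f g + a ^+ 2 * form g g.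
Proof.
move=> hf hg; have hfg := in_L2_lin a hf hg.
by rewrite form_linl// !(formC _ (fun y => f y + a * g y)) !form_linl// (formC g f); ring.
Qed.

Lemma form_cauchy_schwarz f g : in_L2 f -> in_L2 g ->
  form f g ^+ 2 <= form f f * form g g.
Proof.
move=> hf hg.
have H a : 0 <= form f f + 2 * a * form f g + a ^+ 2 * form g g.
  by rewrite -form_lin2// form_ge0.
have [g0|g0] := eqVneq (form g g) 0.
  rewrite g0 mulr0; have [->|c0] := eqVneq (form f g) 0; first by rewrite expr0n.
  (* When [form g g] is 0 the trinomial is affine; at this point its value would be -1. *)
  have := H (- (form f f + 1) / (2 * form f g)).
  rewrite g0 mulr0 addr0 [X in _ + X](_ : _ = - (form f f + 1)); last by field.
  by lra.
have gp : 0 < form g g by rewrite lt_neqAle eq_sym g0 form_ge0.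
have := H (- form f g / form g g).
rewrite (_ : _ + _ = (form f f * form g g - form f g ^+ 2) / form g g); last by field.
by rewrite pmulr_lge0 ?invr_gt0// subr_ge0.
Qed.

Lemma in_L2_hermite k : in_L2 (hermite_tilde k).
Proof.
split; first exact: measurable_hermite_tilde.
by have [+ _] := @hermite_tilde_orthogonal R n k k; under eq_fun do rewrite -expr2.
Qed.

Lemma form_hermite k l :
  form (hermite_tilde k) (hermite_tilde l) = if k == l then hermite_sqnorm k else 0.
Proof.
apply: EFin_inj; rewrite -formE; [|exact: in_L2_hermite..].
by have [_ ->] := @hermite_tilde_orthogonal R n k l.
Qed.

Definition hermite_remainder (a : n.-tuple nat -> R) f s (y : euclidean R n) : R :=
  f y - \sum_(k <- s) a k * hermite_tilde k y.

Lemma hermite_remainder_nil a f : hermite_remainder a f [::] = f.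
Proof. by apply/funext => y; rewrite /hermite_remainder big_nil subr0. Qed.

Lemma hermite_remainder_cons a f k s : hermite_remainder a f (k :: s) =
  (fun y => hermite_remainder a f s y + (- a k) * hermite_tilde k y).
Proof.
by apply/funext => y; rewrite /hermite_remainder big_cons; ring.
Qed.

Lemma in_L2_hermite_remainder a f s : in_L2 f -> in_L2 (hermite_remainder a f s).
Proof.
move=> hf; elim: s => [|k s ih]; first by rewrite hermite_remainder_nil.
by rewrite hermite_remainder_cons; apply: in_L2_lin => //; exact: in_L2_hermite.
Qed.

Lemma form_hermite_remainderl a f s g : in_L2 f -> in_L2 g ->
  form (hermite_remainder a f s) g =
  form f g - \sum_(k <- s) a k * form (hermite_tilde k) g.
Proof.
move=> hf hg; elim: s => [|k s ih].
  by rewrite hermite_remainder_nil big_nil subr0.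
rewrite hermite_remainder_cons form_linl//; last 2 first.
- exact: in_L2_hermite_remainder.
- exact: in_L2_hermite.
by rewrite ih big_cons; ring.
Qed.

Definition hermite_error f s : euclidean R n -> R :=
  hermite_remainder (fun k => form f (hermite_tilde k) / hermite_sqnorm k) f s.

(** Pythagoras: the list is built one index at a time and, as indices do not repeat, the new Hermite
    function is orthogonal to those already subtracted. *)
Lemma form_hermite_error f s : in_L2 f -> uniq s ->
  form (hermite_error f s) (hermite_error f s) =
  form f f - \sum_(k <- s) form f (hermite_tilde k) ^+ 2 / hermite_sqnorm k.
Proof.
rewrite /hermite_error => hf; set a := fun k => _.
elim: s => [|k s ih] /=; first by rewrite hermite_remainder_nil big_nil subr0.
move=> /andP[ks us]; have {}ih := ih us.
have hr := in_L2_hermite_remainder a s hf.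
rewrite hermite_remainder_cons form_lin2//; last exact: in_L2_hermite.
rewrite ih form_hermite_remainderl//; last exact: in_L2_hermite.
rewrite [\sum_(l <- s) a l * _]big1_seq; last first.
  move=> l /andP[_ ls]; rewrite form_hermite; case: eqP => [lk|_]; last by rewrite mulr0.
  by move: ks; rewrite -lk ls.
rewrite subr0 form_hermite eqxx big_cons /a.
by field; rewrite gt_eqF// hermite_sqnorm_gt0.
Qed.

End gaussian_form.

(** * Remainder of the semigroup after a finite Hermite sum *)

Section semigroup_remainder.
Context {R : realType} {n : nat}.
Local Notation L := (@lebesgue_measure_tuple R n).
Local Notation E y := (expR (sqnorm y)).
Local Notation D := inverse_gaussian_density.
Implicit Types (f g h : euclidean R n -> R) (k l : n.-tuple nat)
  (s : seq (n.-tuple nat)).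

Definition mehler_op (r : R) f (x : euclidean R n) : R :=
  \int[L]_y (mehler r x y * f y).

Definition eigenvalue_index k : nat := (multi_index_size k + n)%N.

Definition semigroup_remainder (r : R) f s (x : euclidean R n) : R :=
  mehler_op r f x - \sum_(k <- s) r ^+ eigenvalue_index k *
    (form f (hermite_tilde k) / hermite_sqnorm k) * hermite_tilde k x.

Definition hs_tail (r : R) s : R :=
  (r ^+ 2 / (1 - r ^+ 2)) ^+ n - \sum_(k <- s) (r ^+ eigenvalue_index k) ^+ 2.

(** The kernel of the semigroup relative to e^{|y|^2} dy, for which it is symmetric and [form]
    governs its expansion in [y]. *)
Definition symmetric_kernel (r : R) (x y : euclidean R n) : R :=
  mehler r x y * expR (- sqnorm y).

Lemma in_L2_symmetric_kernel r x : 0 < r < 1 -> in_L2 (symmetric_kernel r x).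
Proof.
move=> r01; split.
  apply: measurable_funM; first exact: measurable_mehler.
  under eq_fun do rewrite -mulN1r; exact: measurable_expR_sqnorm.
have [/(_ x) + _] := @mehler_sqr_integral R n r r01.
rewrite (_ : (fun y => (symmetric_kernel r x y ^+ 2 * E y)%:E) =
  (fun y => (mehler r x y ^+ 2 * expR (- sqnorm y))%:E))//.
apply/funext => y; congr EFin; have e := @expRxMexpNx_1 R (sqnorm y).
rewrite /symmetric_kernel.
transitivity (mehler r x y ^+ 2 * expR (- sqnorm y) * (E y * expR (- sqnorm y))).
  by ring.
by rewrite e mulr1.
Qed.

Lemma form_symmetric_kernel r x g : form (symmetric_kernel r x) g = mehler_op r g x.
Proof.
apply: eq_Rintegral => y _ /=; rewrite /symmetric_kernel.
have e := @expRxMexpNx_1 R (sqnorm y).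
transitivity (mehler r x y * g y * (E y * expR (- sqnorm y))); first by ring.
by rewrite e mulr1.
Qed.

Lemma form_symmetric_kernel_hermite r x k : 0 < r < 1 ->
  form (symmetric_kernel r x) (hermite_tilde k) =
  r ^+ eigenvalue_index k * hermite_tilde k x.
Proof.
move=> r01; rewrite form_symmetric_kernel /mehler_op /Rintegral.
by have [_ ->] := mehler_hermite_tilde k x r01.
Qed.

(** Hermite components may be removed from the kernel or, as in the next lemma, from [f]. The former
    leads to the Hilbert-Schmidt bound, the latter to the contraction bound. *)
Lemma semigroup_remainder_kernel r f s x : 0 < r < 1 -> in_L2 f ->
  semigroup_remainder r f s x = form (hermite_error (symmetric_kernel r x) s) f.
Proof.
move=> r01 hf; rewrite form_hermite_remainderl//; last exact: in_L2_symmetric_kernel.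
rewrite form_symmetric_kernel; congr (_ - _); apply: eq_bigr => k _.
by rewrite form_symmetric_kernel_hermite// (formC _ f); ring.
Qed.

Lemma semigroup_remainder_op r f s x : 0 < r < 1 -> in_L2 f ->
  semigroup_remainder r f s x = mehler_op r (hermite_error f s) x.
Proof.
move=> r01 hf; have hk := in_L2_symmetric_kernel x r01.
rewrite -form_symmetric_kernel formC form_hermite_remainderl//.
rewrite formC form_symmetric_kernel; congr (_ - _); apply: eq_bigr => k _.
by rewrite (formC _ (symmetric_kernel _ _)) form_symmetric_kernel_hermite//; ring.
Qed.

Lemma semigroup_remainder_sqr_le r f s x : 0 < r < 1 -> in_L2 f -> uniq s ->
  semigroup_remainder r f s x ^+ 2 <=
  (form (symmetric_kernel r x) (symmetric_kernel r x) -
   \sum_(k <- s) (r ^+ eigenvalue_index k * hermite_tilde k x) ^+ 2 / hermite_sqnorm k) *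
  form f f.
Proof.
move=> r01 hf us; have hk := in_L2_symmetric_kernel x r01.
rewrite semigroup_remainder_kernel//.
apply: le_trans (form_cauchy_schwarz _ hf) _; first exact: in_L2_hermite_remainder.
rewrite form_hermite_error// ler_wpM2r ?form_ge0// lerB// le_eqVlt; apply/orP; left.
by apply/eqP; apply: eq_bigr => k _; rewrite form_symmetric_kernel_hermite.
Qed.

Lemma measurable_mehler_op d (T : measurableType d) (r : T -> R)
    (x : T -> euclidean R n) f :
  measurable_fun setT r -> measurable_fun setT x -> measurable_fun setT f ->
  measurable_fun setT (fun u => mehler_op (r u) f (x u)).
Proof.
move=> mr mx mf.
have m : measurable_fun setT (fun u => \int[L]_y (mehler (r u) (x u) y * f y)%:E)%E.
  apply: (@measurable_integral_param _ _ _ _ _ L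
    (fun u y => (mehler (r u) (x u) y * f y)%:E)).
  apply/measurable_EFinP; apply: measurable_funM; last exact: (measurableT_comp mf).
  apply: measurable_mehler => //.
    exact: (measurableT_comp mr measurable_fst).
  exact: (measurableT_comp mx measurable_fst).
exact: (measurableT_comp (fine_measurable measurableT) m).
Qed.

Lemma measurable_semigroup_remainder d (T : measurableType d) (r : T -> R)
    (x : T -> euclidean R n) f s :
  measurable_fun setT r -> measurable_fun setT x -> measurable_fun setT f ->
  measurable_fun setT (fun u => semigroup_remainder (r u) f s (x u)).
Proof.
move=> mr mx mf; apply: measurable_funB; first exact: measurable_mehler_op.
apply: measurable_sum => k; apply: measurable_funM.
  by apply: measurable_funM => //; exact: measurable_funX.
exact: (measurableT_comp (measurable_hermite_tilde k)).
Qed.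

(** Cauchy-Schwarz at each [x] leaves the norm of the truncated kernel, which Bessel's identity
    makes explicit and integrable in closed form. *)
Lemma integral_semigroup_remainder_hs r f s : 0 < r < 1 -> in_L2 f -> uniq s ->
  (\int[L]_x (semigroup_remainder r f s x ^+ 2 * E x)%:E <=
   (hs_tail r s * form f f)%:E)%E.
Proof.
move=> r01 hf us; have [mf _] := hf.
have mE := @measurable_expR_sqnorm1 R n.
pose K x := symmetric_kernel r x.
pose S x := \sum_(k <- s) (r ^+ eigenvalue_index k * hermite_tilde k x) ^+ 2 / hermite_sqnorm k.
pose G x := (form (K x) (K x) - S x) * E x.
have KE x : (form (K x) (K x))%:E = (\int[L]_y (mehler r x y ^+ 2 * expR (- sqnorm y))%:E)%E.
  have hk := in_L2_symmetric_kernel x r01.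
  rewrite -formE//; apply: eq_integral => y _; congr EFin.
  have e := @expRxMexpNx_1 R (sqnorm y).
  rewrite /K /symmetric_kernel.
  transitivity (mehler r x y ^+ 2 * expR (- sqnorm y) * (E y * expR (- sqnorm y))).
    by ring.
  by rewrite e mulr1.
have G0 x : 0 <= G x.
  rewrite mulr_ge0 ?expR_ge0//.
  have hk := in_L2_symmetric_kernel x r01.
  have := form_ge0 (hermite_error (K x) s).
  rewrite form_hermite_error//; congr (_ <= _ - _); apply: eq_bigr => k _.
  by rewrite form_symmetric_kernel_hermite.
have mK : measurable_fun setT (fun x => form (K x) (K x)).
  apply/measurable_EFinP; rewrite (_ : EFin \o _ = (fun x =>
      \int[L]_y (mehler r x y ^+ 2 * expR (- sqnorm y))%:E)%E); last first.
    by apply/funext => x /=; rewrite KE.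
  apply: (@measurable_integral_param _ _ _ _ _ L
    (fun x y => (mehler r x y ^+ 2 * expR (- sqnorm y))%:E)).
  apply/measurable_EFinP; apply: measurable_funM.
    by apply: measurable_funX; exact: measurable_mehler.
  apply: measurableT_comp => //; apply: measurableT_comp => //.
  exact: (measurableT_comp (@measurable_sqnorm R n)).
have mS : measurable_fun setT S.
  apply: measurable_sum => k; apply: measurable_funM => //; apply: measurable_funX.
  by apply: measurable_funM => //; exact: measurable_hermite_tilde.
have mG : measurable_fun setT G.
  by apply: measurable_funM => //; exact: measurable_funB.
have IS : (\int[L]_x (S x * E x)%:E = (\sum_(k <- s) (r ^+ eigenvalue_index k) ^+ 2)%:E)%E.
  have -> : (fun x => (S x * E x)%:E) = (fun x => \sum_(k <- s)
      ((r ^+ eigenvalue_index k) ^+ 2 / hermite_sqnorm k)%:E *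
        (hermite_tilde k x * hermite_tilde k x * E x)%:E)%E.
    apply/funext => x; rewrite /S mulr_suml -sumEFin; apply: eq_bigr => k _.
    by rewrite -EFinM; congr EFin; ring.
  have c0 k : 0 <= (r ^+ eigenvalue_index k) ^+ 2 / hermite_sqnorm k.
    by rewrite divr_ge0 ?sqr_ge0// ltW// hermite_sqnorm_gt0.
  have h0 k (x : euclidean R n) : (0 <= (hermite_tilde k x * hermite_tilde k x * E x)%:E)%E.
    by rewrite lee_fin -expr2 mulr_ge0 ?sqr_ge0 ?expR_ge0.
  have mh k : measurable_fun setT (fun x : euclidean R n => (hermite_tilde k x * hermite_tilde k x * E x)%:E).
    by have [/measurable_int] := @hermite_tilde_orthogonal R n k k.
  rewrite ge0_integral_sum//; last 2 first.
  - by move=> k; exact: emeasurable_funM.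
  - by move=> k x _; rewrite mule_ge0// lee_fin.
  rewrite -sumEFin; apply: eq_bigr => k _.
  rewrite ge0_integralZl//; last by rewrite lee_fin.
  have [_ ->] := @hermite_tilde_orthogonal R n k k.
  by rewrite eqxx -EFinM divfK// gt_eqF// hermite_sqnorm_gt0.
have S0 x : 0 <= S x.
  apply: sumr_ge0 => k _; rewrite divr_ge0 ?sqr_ge0// ltW// hermite_sqnorm_gt0//.
have IG : (\int[L]_x (G x)%:E = (hs_tail r s)%:E)%E.
  (* [G] and the Hermite part add up to the full kernel, whose integral is known, so the integral of
     [G] is a difference of real numbers. *)
  have : (\int[L]_x ((G x)%:E + (S x * E x)%:E) = ((r ^+ 2 / (1 - r ^+ 2)) ^+ n)%:E)%E.
    have [_ <-] := @mehler_sqr_integral R n r r01.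
    apply: eq_integral => x _; rewrite -KE -EFinD -EFinM; congr EFin.
    by rewrite /G; ring.
  rewrite ge0_integralD//; last 4 first.
  - by move=> x _; rewrite lee_fin.
  - exact/measurable_EFinP.
  - by move=> x _; rewrite lee_fin mulr_ge0 ?expR_ge0.
  - by apply/measurable_EFinP; exact: measurable_funM.
  rewrite IS => h.
  have Gf : (\int[L]_x (G x)%:E)%E \is a fin_num.
    rewrite ge0_fin_numE; last by apply: integral_ge0 => x _; rewrite lee_fin.
    by rewrite ltey; apply/negP => /eqP e; move: h; rewrite e.
  by move: h; rewrite -(fineK Gf) -EFinD => -[] h; congr EFin; rewrite /hs_tail -h addrK.
have mu2 : measurable_fun setT (fun x => (semigroup_remainder r f s x ^+ 2 * E x)%:E).
  apply/measurable_EFinP; apply: measurable_funM => //; apply: measurable_funX.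
  exact: (@measurable_semigroup_remainder _ _ (fun=> r) id).
have step : (\int[L]_x (semigroup_remainder r f s x ^+ 2 * E x)%:E <=
    \int[L]_x ((G x)%:E * (form f f)%:E))%E.
  apply: ge0_le_integral => //.
  - by move=> x _; rewrite lee_fin mulr_ge0 ?sqr_ge0 ?expR_ge0.
  - by apply: emeasurable_funM => //; exact/measurable_EFinP.
  move=> x _; rewrite -EFinM lee_fin /G [leRHS]mulrAC ler_wpM2r ?expR_ge0//.
  exact: semigroup_remainder_sqr_le.
apply: le_trans step _; rewrite ge0_integralZr//.
- by rewrite IG -EFinM.
- exact/measurable_EFinP.
- by move=> x _; rewrite lee_fin.
- by rewrite lee_fin form_ge0.
Qed.

(** Jensen's inequality for the kernel, a probability density in [y], followed by Tonelli and the
    invariance of the measure. *)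
Lemma mehler_op_contraction r g : 0 < r < 1 -> in_L2 g ->
  (\int[L]_x (mehler_op r g x ^+ 2 * E x)%:E <= (form g g)%:E)%E.
Proof.
move=> r01 hg; have [mg ig] := hg; have /andP[r0 r1] := r01.
have mE := @measurable_expR_sqnorm1 R n.
have m0 (x y : euclidean R n) : 0 <= mehler r x y by exact: (mehler_ge0 _ _ (ltW r0)).
have mm : measurable_fun setT (fun u : euclidean R n * euclidean R n => mehler r u.1 u.2).
  exact: (@measurable_mehler _ _ _ _ (fun=> r) fst snd).
have pw x : ((mehler_op r g x ^+ 2)%:E <= \int[L]_y (mehler r x y * g y ^+ 2)%:E)%E.
  have hk := in_L2_symmetric_kernel x r01.
  have ik : L.-integrable setT (fun y => (mehler r x y * g y)%:E).
    have := in_L2_mul hk hg.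
    rewrite (_ : (fun y => _) = (fun y => (mehler r x y * g y)%:E))//.
    apply/funext => y; rewrite /symmetric_kernel; congr EFin.
    have e := @expRxMexpNx_1 R (sqnorm y).
    transitivity (mehler r x y * g y * (E y * expR (- sqnorm y))); first by ring.
    by rewrite e mulr1.
  have h1 := le_normr_Rintegral measurableT ik.
  have h2 := @ge0_powR_integral_le _ _ _ L (fun y : euclidean R n => mehler r x y) (normr \o g) 2 (ltr1n R 2)
    (measurableT_comp mm (pair1_measurable x))
    (measurableT_comp (@normr_measurable R setT) mg) (m0 x) (fun y => normr_ge0 _).
  rewrite mehler_integral// poweR1r mul1e in h2.
  apply: le_trans (le_trans _ h2) _; last first.
    apply: ge0_le_integral => //.
    - by move=> y _; rewrite lee_fin mulr_ge0 ?powR_ge0.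
    - apply/measurable_EFinP; apply: measurable_funM.
        exact: (measurableT_comp mm (pair1_measurable x)).
      apply: (measurableT_comp (measurable_powR _)).
      exact: (measurableT_comp (@normr_measurable R setT) mg).
    - apply/measurable_EFinP; apply: measurable_funM; last exact: measurable_funX.
      exact: (measurableT_comp mm (pair1_measurable x)).
    - by move=> y _; rewrite lee_fin /= powR_mulrn// real_normK ?num_real.
  have IE : (\int[L]_y (mehler r x y * (normr \o g) y)%:E =
      (\int[L]_y `|mehler r x y * g y|)%:E)%E.
    rewrite /Rintegral fineK; last first.
      exact: (integrable_fin_num measurableT (integrable_abse ik)).
    apply: eq_integral => y _ /=.
    by rewrite normrM (ger0_norm (m0 x y)).
  rewrite IE poweR_EFin lee_fin powR_mulrn; last by apply: Rintegral_ge0.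
  by rewrite -real_normK ?num_real// lerXn2r// ?nnegrE// Rintegral_ge0.
have mp : measurable_fun setT (fun u : euclidean R n * euclidean R n =>
    (mehler r u.1 u.2 * g u.2 ^+ 2 * E u.1)%:E).
  apply/measurable_EFinP; apply: measurable_funM; last first.
    exact: (measurableT_comp mE measurable_fst).
  apply: measurable_funM => //; apply: measurable_funX.
  exact: (measurableT_comp mg measurable_snd).
have step : (\int[L]_x (mehler_op r g x ^+ 2 * E x)%:E <=
    \int[L]_x \int[L]_y (mehler r x y * g y ^+ 2 * E x)%:E)%E.
  apply: ge0_le_integral => //.
  - by move=> x _; rewrite lee_fin mulr_ge0 ?sqr_ge0 ?expR_ge0.
  - apply/measurable_EFinP; apply: measurable_funM => //; apply: measurable_funX.
    exact: (@measurable_mehler_op _ _ (fun=> r) id).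
  - apply: (@measurable_integral_param _ _ _ _ _ L
      (fun x y => (mehler r x y * g y ^+ 2 * E x)%:E)) => //.
  move=> x _; rewrite EFinM.
  apply: le_trans (lee_wpmul2r _ (pw x)) _; first by rewrite lee_fin expR_ge0.
  rewrite -ge0_integralZr//.
  - apply/measurable_EFinP; apply: measurable_funM; last exact: measurable_funX.
    exact: (measurableT_comp mm (pair1_measurable x)).
  - by move=> y _; rewrite lee_fin mulr_ge0 ?sqr_ge0.
apply: le_trans step _.
rewrite (@ge0_integral_swap _ _ _ _ _ L L
  (fun x y => (mehler r x y * g y ^+ 2 * E x)%:E))//; last first.
  by move=> x y; rewrite lee_fin mulr_ge0 ?expR_ge0// mulr_ge0 ?sqr_ge0.
rewrite -formE//; pose P : R := pi `^ (n%:R / 2).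
have P0 : 0 < P by rewrite powR_gt0// pi_gt0.
have IE y : (\int[L]_x (mehler r x y * E x)%:E = (E y)%:E)%E.
  have := mehler_integral_density y r01.
  under eq_integral do rewrite /D mulrCA EFinM.
  rewrite ge0_integralZl//; last 3 first.
  - apply/measurable_EFinP; apply: measurable_funM => //.
    exact: (measurableT_comp mm (pair2_measurable y)).
  - by move=> x _; rewrite lee_fin mulr_ge0 ?expR_ge0.
  - by rewrite lee_fin powR_ge0.
  rewrite -/P /D -/P EFinM => h.
  have := congr1 (fun z => (P^-1)%:E * z)%E h.
  by rewrite !muleA -!EFinM mulVf ?gt_eqF// mul1e mul1r.
rewrite le_eqVlt; apply/orP; left; apply/eqP; apply: eq_integral => y _.
under eq_integral do rewrite mulrAC mulrC EFinM.
rewrite ge0_integralZl//.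
- by rewrite IE -EFinM expr2.
- apply/measurable_EFinP; apply: measurable_funM => //.
  exact: (measurableT_comp mm (pair2_measurable y)).
- by move=> x _; rewrite lee_fin mulr_ge0 ?expR_ge0.
- by rewrite lee_fin sqr_ge0.
Qed.

(** The Hilbert-Schmidt bound degenerates as r tends to 1. The contraction bound covers that end,
    removal of Hermite components not increasing the norm of [f]. *)
Lemma integral_semigroup_remainder_le r f s : 0 < r < 1 -> in_L2 f -> uniq s ->
  (\int[L]_x (semigroup_remainder r f s x ^+ 2 * E x)%:E <=
   (Num.min 1 (hs_tail r s) * form f f)%:E)%E.
Proof.
move=> r01 hf us; rewrite /Num.min; case: ifP => _; last first.
  exact: integral_semigroup_remainder_hs.
rewrite mul1r.
under eq_integral do rewrite semigroup_remainder_op//.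
apply: le_trans (mehler_op_contraction r01 _) _; first exact: in_L2_hermite_remainder.
rewrite lee_fin form_hermite_error// gerBl sumr_ge0// => k _.
by rewrite divr_ge0 ?sqr_ge0// ltW// hermite_sqnorm_gt0.
Qed.

End semigroup_remainder.

(* Tails over finite sets of indices *)
#[local] Existing Instance totally_filter.

Lemma ler_sum_subset {R : realDomainType} {I : eqType} (s t : seq I) (F : I -> R) :
  uniq s -> uniq t -> {subset s <= t} -> (forall i, 0 <= F i) ->
  \sum_(i <- s) F i <= \sum_(i <- t) F i.
Proof.
move=> us ut st F0.
rewrite [leRHS](bigID (mem s))/= -[X in _ <= X + _]big_filter.
have -> : \sum_(i <- s) F i = \sum_(i <- [seq i <- t | i \in s]) F i.
  apply: perm_big; apply: uniq_perm => //; first exact: filter_uniq.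
  by move=> i; rewrite mem_filter; case: (boolP (i \in s)) => //= /st ->.
by rewrite lerDl sumr_ge0.
Qed.

Lemma geometric_sum {R : fieldType} (q : R) N : 1 - q != 0 ->
  \sum_(m < N) q ^+ m.+1 = q / (1 - q) * (1 - q ^+ N).
Proof.
move=> q1; elim: N => [|N ih]; first by rewrite big_ord0 expr0 subrr mulr0.
by rewrite big_ord_recr/= ih !exprS; field.
Qed.

Section tail.
Context {R : realType} {n : nat}.
Local Notation mu := (@lebesgue_measure R).
Implicit Types (k : n.-tuple nat) (s : seq (n.-tuple nat)) (N : nat).

(** On boxes the tail has a closed form; they also form a sequence, to which dominated convergence
    applies, cofinal among the finite sets. *)
Definition index_box N : seq (n.-tuple nat) :=
  [seq [tuple (f i : nat) | i < n] | f : {ffun 'I_n -> 'I_N}].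

Lemma index_box_uniq N : uniq (index_box N).
Proof.
rewrite map_inj_uniq ?enum_uniq// => f g fg; apply/ffunP => i; apply/val_inj.
by have := congr1 (fun t => tnth t i) fg; rewrite !tnth_mktuple.
Qed.

Lemma hs_tail_subset (r : R) s t : 0 <= r -> uniq s -> uniq t -> {subset s <= t} ->
  hs_tail r t <= hs_tail r s.
Proof.
move=> r0 us ut st; rewrite lerD2l lerN2; apply: ler_sum_subset => // k.
exact: sqr_ge0.
Qed.

Lemma hs_tail_box (r : R) N : 0 < r < 1 ->
  hs_tail r (index_box N) =
  (r ^+ 2 / (1 - r ^+ 2)) ^+ n * (1 - (1 - (r ^+ 2) ^+ N) ^+ n).
Proof.
move=> r01; have q1 : 1 - r ^+ 2 != 0 by rewrite gt_eqF// onemX2_gt0.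
rewrite /hs_tail big_map big_enum /= mulrBr mulr1 -exprMn -geometric_sum//.
(* The n-th power of a geometric sum expands into a sum over all functions from coordinates to
   exponents, that is, over the box. *)
congr (_ - _); rewrite -[in RHS](card_ord n) -prodr_const bigA_distr_bigA /=.
apply: eq_bigr => f _; rewrite /eigenvalue_index /multi_index_size.
have -> : (\sum_(i < n) tnth [tuple (f i : nat) | i < n] i = \sum_(i < n) f i)%N.
  by apply: eq_bigr => i _; rewrite tnth_mktuple.
rewrite -exprM mulnC exprM.
under [RHS]eq_bigr do rewrite exprSr.
rewrite big_split/= prodr_const card_ord exprD; congr (_ * _).
by rewrite -expr_sum.
Qed.

Lemma hs_tail_box_cvg (r : R) : 0 < r < 1 ->
  hs_tail r (index_box N) @[N --> \oo] --> 0.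
Proof.
move=> r01; under eq_fun do rewrite hs_tail_box//.
have r21 : `|r ^+ 2| < 1.
  by have := onemX2_gt0 r01; rewrite subr_gt0 ger0_norm ?sqr_ge0.
have h1 : (1 - (r ^+ 2) ^+ N) @[N --> \oo] --> (1 : R).
  suff : (1 - (r ^+ 2) ^+ N) @[N --> \oo] --> (1 - 0 : R) by rewrite subr0.
  by apply: cvgB; [exact: cvg_cst|exact: cvg_expr].
have h2 : ((1 - (r ^+ 2) ^+ N) ^+ n) @[N --> \oo] --> (1 : R).
  suff : ((1 - (r ^+ 2) ^+ N) ^+ n) @[N --> \oo] --> ((1 : R) ^+ n) by rewrite expr1n.
  exact: (cvg_comp _ _ h1 (@exprn_continuous R n 1)).
set c := (_ / _) ^+ n.
suff : (c * (1 - (1 - (r ^+ 2) ^+ N) ^+ n)) @[N --> \oo] --> (c * (1 - 1) : R).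
  by rewrite subrr mulr0.
by apply: cvgM; [exact: cvg_cst|apply: cvgB; [exact: cvg_cst|]].
Qed.

(** The tail times the squared norm of any [f] bounds an integral of squares; the Hermite function
    of index 0 serves as a nonzero [f]. *)
Lemma hs_tail_ge0 (r : R) s : 0 < r < 1 -> uniq s -> 0 <= hs_tail r s.
Proof.
move=> r01 us; pose k : n.-tuple nat := [tuple 0%N | i < n].
have h := integral_semigroup_remainder_hs r01 (in_L2_hermite k) us.
have : (0 <= (hs_tail r s * form (hermite_tilde k) (hermite_tilde k))%:E)%E.
  apply: le_trans h; apply: integral_ge0 => x _.
  by rewrite lee_fin mulr_ge0 ?sqr_ge0 ?expR_ge0.
by rewrite form_hermite eqxx lee_fin pmulr_lge0// hermite_sqnorm_gt0.
Qed.

Lemma hs_tail_le_geometric (r : R) s : 0 < r < 1 ->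
  hs_tail r s <= (r ^+ 2 / (1 - r ^+ 2)) ^+ n.
Proof.
by move=> r01; rewrite /hs_tail gerBl sumr_ge0// => k _; exact: sqr_ge0.
Qed.

Hypothesis n_ge1 : (1 <= n)%N.
Variable b : R.
Hypothesis b0 : 0 < b.

(** The factor e^{t/2} is left over by Cauchy-Schwarz in t; the minimum comes from the two bounds on
    the remainder of the semigroup. *)
Definition tail_density s (t : R) : R :=
  power_weight b t * expR (t / 2) * Num.min 1 (hs_tail (expR (- t)) s).

Lemma measurable_tail_density s :
  measurable_fun (setT : set (measurableTypeR R)) (tail_density s).
Proof.
have mr := @measurable_expRN R _ _ id (@measurable_id _ _ _).
apply: measurable_funM.
  apply: measurable_funM; first exact: measurable_power_weight.
  by apply: measurableT_comp => //; exact: measurable_funM.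
apply: measurable_minr => //; apply: measurable_funB; last first.
  by apply: measurable_sum => k; apply: measurable_funX; exact: measurable_funX.
apply: measurable_funX; apply: measurable_funM; first exact: measurable_funX.
apply: measurableT_comp; first exact: measurable_invr.
by apply: measurable_funB => //; exact: measurable_funX.
Qed.

Lemma tail_density_ge0 s t : uniq s -> 0 <= tail_density s t.
Proof.
move=> us; rewrite /tail_density /power_weight; case: ifPn => [t0|_]; last first.
  by rewrite !mul0r.
rewrite mulr_ge0 ?mulr_ge0 ?powR_ge0 ?expR_ge0// le_min ler01.
by rewrite hs_tail_ge0// expRN_itv.
Qed.

(** For t <= 1 the minimum is at most 1 and e^{t/2} <= e^{2 - t}. For t > 1, q = e^{-2t} <= 1/2
    gives (q/(1 - q))^n <= 2 q, so the factor of the weight decays like e^{-3t/2}. *)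
Lemma tail_density_le s t : uniq s ->
  tail_density s t <= expR 2 * (power_weight b t * expR (- t)).
Proof.
move=> us; have [t0|t0] := leP t 0.
  by rewrite /tail_density /power_weight ltNge t0/= !mul0r mulr0.
have r01 := expRN_itv t0; have := hs_tail_le_geometric s r01.
rewrite /tail_density; set m := hs_tail _ _ => hm.
have w0 := power_weight_ge0 b t.
rewrite [leRHS]mulrCA -mulrA ler_wpM2l//.
have [t1|t1] := leP t 1.
  apply: (@le_trans _ _ (expR (t / 2))).
    by rewrite ler_piMr ?expR_ge0// ge_min lexx.
  by rewrite -expRD ler_expR; lra.
pose q : R := expR (- t) ^+ 2.
have q0 : 0 < q by rewrite exprn_gt0// expR_gt0.
have e2 : 3 <= expR 2 :> R by have := @expR_ge1Dx R 2; lra.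
have qE : q = expR (- (2 * t)).
  by rewrite /q -expRM_natl; congr expR; ring.
have q2 : q <= 2^-1.
  rewrite qE (@le_trans _ _ (expR (- 2)))//; first by rewrite ler_expR; lra.
  by rewrite expRN lef_pV2 ?posrE ?expR_gt0//; lra.
have gq : q / (1 - q) <= 2 * q.
  by rewrite ler_pdivrMr; [nra|lra].
have g0 : 0 <= q / (1 - q) by rewrite divr_ge0; lra.
have g1 : q / (1 - q) <= 1 by lra.
have gn : (q / (1 - q)) ^+ n <= 2 * q.
  apply: le_trans gq; case: n n_ge1 => // m' _; rewrite exprS ler_piMr//.
  by rewrite exprn_ile1.
apply: (@le_trans _ _ (expR (t / 2) * (2 * q))).
  by rewrite ler_wpM2l ?expR_ge0// ge_min (le_trans hm gn) orbT.
rewrite qE mulrCA -expRD.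
apply: (@le_trans _ _ (expR 2 * expR (t / 2 - 2 * t))).
  by rewrite ler_wpM2r ?expR_ge0//; lra.
by rewrite ler_wpM2l ?expR_ge0// ler_expR; lra.
Qed.

Definition tail_mass s : R := \int[mu]_t tail_density s t.

Lemma integrable_tail_dominant :
  mu.-integrable setT (fun t : R => (expR 2 * (power_weight b t * expR (- t)))%:E).
Proof.
apply/integrableP; split.
  apply/measurable_EFinP; apply: measurable_funM => //; apply: measurable_funM.
    exact: measurable_power_weight.
  exact: (@measurable_expRN R _ _ id (@measurable_id _ _ _)).
under eq_integral do rewrite gee0_abs ?lee_fin ?mulr_ge0 ?power_weight_ge0 ?expR_ge0// EFinM.
rewrite ge0_integralZl//.
- by rewrite power_weight_massE// -EFinM ltry.
- apply/measurable_EFinP; apply: measurable_funM.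
    exact: measurable_power_weight.
  exact: (@measurable_expRN R _ _ id (@measurable_id _ _ _)).
- by move=> t _; rewrite lee_fin mulr_ge0 ?power_weight_ge0 ?expR_ge0.
Qed.

Lemma integrable_tail_density s : uniq s ->
  mu.-integrable setT (fun t : R => (tail_density s t)%:E).
Proof.
move=> us; apply: (le_integrable measurableT _ _ integrable_tail_dominant).
  by apply/measurable_EFinP; exact: measurable_tail_density.
move=> t _; rewrite !abse_EFin lee_fin !ger0_norm ?tail_density_ge0//.
  exact: tail_density_le.
by rewrite !mulr_ge0 ?power_weight_ge0 ?expR_ge0.
Qed.

Lemma tail_massE s : uniq s ->
  (\int[mu]_t (tail_density s t)%:E = (tail_mass s)%:E)%E.
Proof.
move=> us; rewrite /tail_mass /Rintegral fineK//.
exact: (integrable_fin_num measurableT (integrable_tail_density us)).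
Qed.

Lemma tail_mass_ge0 s : uniq s -> 0 <= tail_mass s.
Proof. by move=> us; apply: Rintegral_ge0 => t _; exact: tail_density_ge0. Qed.

Lemma tail_mass_subset s t : uniq s -> uniq t -> {subset s <= t} ->
  tail_mass t <= tail_mass s.
Proof.
move=> us ut st; rewrite -lee_fin -!tail_massE//; apply: ge0_le_integral => //.
- by move=> u _; rewrite lee_fin tail_density_ge0.
- by apply/measurable_EFinP; exact: measurable_tail_density.
- by apply/measurable_EFinP; exact: measurable_tail_density.
move=> u _; rewrite lee_fin ler_wpM2l//.
  by rewrite mulr_ge0 ?power_weight_ge0 ?expR_ge0.
by rewrite le_min2// hs_tail_subset// expR_ge0.
Qed.

Lemma tail_density_box_cvg t : tail_density (index_box N) t @[N --> \oo] --> 0.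
Proof.
have [t0|t0] := leP t 0.
  rewrite /tail_density /power_weight ltNge t0/=.
  by under eq_fun do rewrite !mul0r; exact: cvg_cst.
have r01 := expRN_itv t0.
have h1 : Num.min 1 (hs_tail (expR (- t)) (index_box N)) @[N --> \oo] --> (0 : R).
  apply: (squeeze_cvgr _ (cvg_cst 0) (hs_tail_box_cvg r01)).
  apply: nearW => N; rewrite le_min ler01 hs_tail_ge0 ?index_box_uniq//=.
  by rewrite ge_min lexx orbT.
rewrite -[0](mulr0 (power_weight b t * expR (t / 2))).
by apply: cvgM => //; exact: cvg_cst.
Qed.

Lemma tail_mass_box_cvg : tail_mass (index_box N) @[N --> \oo] --> 0.
Proof.
have m N := (measurable_EFinP _ _).2 (measurable_tail_density (index_box N)).
have c : {ae mu, forall t, setT t ->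
    (tail_density (index_box N) t)%:E @[N --> \oo] --> (cst 0%E : R -> \bar R) t}.
  apply: aeW => t _; apply: cvg_EFin; first exact: nearW.
  exact: tail_density_box_cvg.
have d : {ae mu, forall t, forall N, setT t ->
    (`|(tail_density (index_box N) t)%:E| <=
     (expR 2 * (power_weight b t * expR (- t)))%:E)%E}.
  apply: aeW => t N _; rewrite abse_EFin lee_fin.
  by rewrite ger0_norm ?tail_density_ge0 ?tail_density_le ?index_box_uniq.
have [_ _] := dominated_convergence measurableT m (measurable_cst _) c
  integrable_tail_dominant d.
rewrite integral0 => h.
suff : (tail_mass (index_box N))%:E @[N --> \oo] --> 0%E by move/fine_cvgP => -[].
apply: cvg_trans h; apply: near_eq_cvg; apply: nearW => N /=.
by rewrite tail_massE ?index_box_uniq.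
Qed.

(** The tail decreases as the set grows, so one box with a small tail controls every finite set
    containing it. *)
Lemma tail_mass_cvg :
  (fun K : {fset n.-tuple nat} => tail_mass (enum_fset K)) @ totally --> 0.
Proof.
apply/cvgr0Pnorm_le => e e0.
have /cvgr0Pnorm_le/(_ e e0)[N _ hN] := tail_mass_box_cvg.
exists [fset k in index_box N]%fset => //= K /fsubsetP sK.
rewrite ger0_norm ?tail_mass_ge0 ?fset_uniq//.
have := hN N (leqnn N); rewrite /= ger0_norm ?tail_mass_ge0 ?index_box_uniq//.
apply: le_trans; apply: tail_mass_subset; rewrite ?index_box_uniq ?fset_uniq//.
by move=> k kN; apply: sK; rewrite in_fset.
Qed.
End tail.

(** * The negative power operator on L^p *)

Section negative_power_operator.
Context {R : realType} {n : nat}.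
Local Notation mu := (@lebesgue_measure R).
Local Notation L := (@lebesgue_measure_tuple R n).
Local Notation M := (sigma_finite_product mu L).
Local Notation gamma := (inverse_gaussian R n).
Implicit Types (f g : euclidean R n -> R) (x : euclidean R n).

(** Where the integral is not a real number the value is the default 0; for [f] in L^p, p >= 1, and
    a power weight this happens on a null set only. *)
Definition subordinated_op (w : R -> R) f x : R :=
  \int[M]_z (subordinated_kernel w x z * f z.2).

Definition negative_power_op (b : R) f x : R :=
  (power_weight_mass b)^-1 * subordinated_op (power_weight b) f x.

Section weight.
Variable w : R -> R.
Hypothesis hw : kernel_weight w.

Lemma integrable_subordinated_kernel f x : measurable_fun setT f ->
  (subordinated_abs w f x < +oo)%E ->
  M.-integrable setT (fun z => (subordinated_kernel w x z * f z.2)%:E).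
Proof.
move=> mf fx; apply/integrableP; split.
  apply/measurable_EFinP; apply: measurable_funM.
    exact: (@measurable_subordinated_kernel _ _ _ hw _ _ (fun=> x) id).
  exact: (measurableT_comp mf measurable_snd).
apply: le_lt_trans fx; rewrite le_eqVlt; apply/orP; left; apply/eqP.
apply: eq_integral => z _; rewrite abse_EFin normrM.
by rewrite (ger0_norm (subordinated_kernel_ge0 hw x z)).
Qed.

Lemma measurable_subordinated_op f : measurable_fun setT f ->
  measurable_fun setT (subordinated_op w f).
Proof.
move=> mf.
have m : measurable_fun setT (fun x => \int[M]_z (subordinated_kernel w x z * f z.2)%:E)%E.
  apply: (@measurable_integral_param _ _ _ _ _ M
    (fun x z => (subordinated_kernel w x z * f z.2)%:E)).
  apply/measurable_EFinP; apply: measurable_funM.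
    exact: measurable_subordinated_kernel.
  apply: (measurableT_comp mf).
  exact: (measurableT_comp measurable_snd measurable_snd).
exact: (measurableT_comp (fine_measurable measurableT) m).
Qed.

Lemma subordinated_op_le f x : measurable_fun setT f ->
  (`|subordinated_op w f x|%:E <= subordinated_abs w f x)%E.
Proof.
move=> mf; have := subordinated_abs_ge0 hw f x.
have [fx _|] := ltP (subordinated_abs w f x) +oo%E; last by rewrite leye_eq => /eqP -> _; rewrite leey.
have i := integrable_subordinated_kernel mf fx.
rewrite /subordinated_op /Rintegral -[X in (X <= _)%E]abse_EFin fineK; last first.
  exact: (integrable_fin_num measurableT i).
apply: le_trans (le_abse_integral _ _ _) _ => //.
  by case/integrableP: i.
rewrite le_eqVlt; apply/orP; left; apply/eqP; apply: eq_integral => z _.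
by rewrite abse_EFin normrM (ger0_norm (subordinated_kernel_ge0 hw x z)).
Qed.

Lemma subordinated_op_linear (a : R) f g x :
  measurable_fun setT f -> measurable_fun setT g ->
  (subordinated_abs w f x < +oo)%E -> (subordinated_abs w g x < +oo)%E ->
  subordinated_op w (fun y => a * f y + g y) x =
  a * subordinated_op w f x + subordinated_op w g x.
Proof.
move=> mf mg fx gx.
have fi := integrable_subordinated_kernel mf fx.
have gi := integrable_subordinated_kernel mg gx.
rewrite /subordinated_op -RintegralZl// -RintegralD//; last first.
  exact: (integrableZl measurableT a fi).
by apply: eq_Rintegral => z _; ring.
Qed.

End weight.

Hypothesis n_ge1 : (1 <= n)%N.
Variable b : R.
Hypothesis b0 : 0 < b.
Local Notation w := (power_weight b).
Local Notation G := (power_weight_mass b).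
Local Notation S := (negative_power_op b).

Lemma measurable_negative_power_op f : measurable_fun setT f ->
  measurable_fun setT (S f).
Proof.
move=> mf; apply: measurable_funM => //.
exact: (measurable_subordinated_op (kernel_weight_power b)).
Qed.

Lemma negative_power_op_le f x : measurable_fun setT f ->
  (`|S f x|%:E <= G^-1%:E * subordinated_abs w f x)%E.
Proof.
move=> mf; have G0 := power_weight_mass_gt0 b0.
rewrite normrM gtr0_norm ?invr_gt0// EFinM.
rewrite lee_wpmul2l ?lee_fin ?invr_ge0 ?(ltW G0)//.
exact: (subordinated_op_le (kernel_weight_power b)).
Qed.

Lemma negative_power_op_linear_ae (a : R) f g :
  measurable_fun setT f -> measurable_fun setT g ->
  {ae gamma, forall x, (subordinated_abs w f x < +oo)%E} ->
  {ae gamma, forall x, (subordinated_abs w g x < +oo)%E} ->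
  S (fun x => a * f x + g x) = (fun x => a * S f x + S g x) %[ae gamma].
Proof.
move=> mf mg; apply: filterS2 => x fx gx _.
by rewrite /S subordinated_op_linear//; [ring|exact: kernel_weight_power].
Qed.

Lemma Lnorm_gammaE p f :
  ('N[gamma]_p%:E[EFin \o f] = (\int[gamma]_x (`|f x| `^ p)%:E) `^ p^-1)%E.
Proof. by rewrite unlock. Qed.

Lemma Lfun_gammaP p f : 1 <= p -> f \in Lfun gamma p%:E <->
  measurable_fun setT f /\ (\int[gamma]_x (`|f x| `^ p)%:E < +oo)%E.
Proof.
move=> p1; have p0 : 0 < p by rewrite (lt_le_trans _ p1).
split.
  move=> /andP[]; rewrite !inE/= => mf; rewrite /finite_norm Lnorm_gammaE => fp; split=> //.
  have := poweR_lty p fp; rewrite -poweRrM mulVf ?gt_eqF// poweRe1//.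
  by apply: integral_ge0 => x _; rewrite lee_fin powR_ge0.
move=> [mf fp]; apply/andP; split; rewrite inE//=.
by rewrite /finite_norm Lnorm_gammaE poweR_lty.
Qed.

(** For p > 1 the p-th power is integrable. For p = 1 only the weak bound is at hand: the set of
    infinite values lies in every level set, and the measure of these tends to 0. *)
Lemma subordinated_abs_fin_ae p f : 1 <= p -> f \in Lfun gamma p%:E ->
  {ae gamma, forall x, (subordinated_abs w f x < +oo)%E}.
Proof.
move=> p1 /(Lfun_gammaP _ p1)[mf fp]; have hw := kernel_weight_power b.
have mU := measurable_subordinated_abs hw mf.
have [p1'|] := boolP (1 < p).
  have [C C0 hC] := subordinated_powR_bound n_ge1 b0 p1'.
  have i : gamma.-integrable setT (fun x => subordinated_abs w f x `^ p)%E.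
    apply/integrableP; split; first exact: (measurableT_comp (measurable_poweR p)).
    under eq_integral do rewrite gee0_abs ?poweR_ge0//.
    by apply: le_lt_trans (hC f mf) _; rewrite lte_mul_pinfty// lee_fin.
  apply: filterS (integrable_ae measurableT i) => x /(_ I).
  rewrite ge0_fin_numE ?poweR_ge0//; apply: lty_poweRy.
  by rewrite gt_eqF// (lt_trans ltr01).
rewrite lt_neqAle p1 andbT negbK => /eqP pE; move: fp; rewrite -{p p1}pE.
under eq_integral do rewrite powRr1//.
move=> fp; have [K K0 hK] := subordinated_weak_bound n_ge1 b0.
pose I := fine (\int[gamma]_y `|f y|%:E)%E.
have IE : (\int[gamma]_y `|f y|%:E = I%:E)%E.
  by rewrite fineK// ge0_fin_numE// integral_ge0.
have I0 : 0 <= I by rewrite fine_ge0// integral_ge0.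
pose A := [set x | (+oo <= subordinated_abs w f x)%E].
have mA : measurable A.
  by rewrite -[A]setTI; exact: emeasurable_fun_c_infty.
exists A; split => //.
  apply/eqP; rewrite eq_le measure_ge0 andbT; apply/lee_addgt0Pr => e e0.
  (* A level at which the weak bound K I / s is at most [e]; the 1 keeps it positive when K I =
     0. *)
  pose s := (K * I + 1) / e.
  have KI0 : 0 < K * I + 1 by rewrite ltr_wpDl// mulr_ge0.
  have s0 : 0 < s by rewrite divr_gt0.
  apply: (@le_trans _ _ (gamma [set x | s%:E < subordinated_abs w f x]%E)).
    apply: le_measure; rewrite ?inE//.
      by rewrite -[X in measurable X]setTI; exact: emeasurable_fun_o_infty.
    by move=> x /=; apply: lt_le_trans; rewrite ltry.
  apply: le_trans (hK f s mf s0) _; rewrite IE -EFinM add0e lee_fin.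
  by rewrite /s invf_div mulrAC mulrA ler_pdivrMr// -mulrA; nra.
by move=> x /= /negP; rewrite -leNgt.
Qed.

Lemma negative_power_op_Lp p : 1 < p -> exists C : R, forall f,
  f \in Lfun gamma p%:E ->
  ('N[gamma]_p%:E[EFin \o S f] <= C%:E * 'N[gamma]_p%:E[EFin \o f])%E.
Proof.
move=> p1; have p0 : 0 < p by rewrite (lt_trans _ p1).
have [C C0 hC] := subordinated_powR_bound n_ge1 b0 p1.
have hw := kernel_weight_power b; have G0 := power_weight_mass_gt0 b0.
(* [C] bounds the integral of the p-th power, so a p-th root is taken; [G^-1] is the normalisation
   of the average. *)
exists ((G^-1 `^ p * C) `^ p^-1) => f /(Lfun_gammaP _ (ltW p1))[mf fp].
have mS := measurable_negative_power_op mf.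
rewrite !Lnorm_gammaE -poweR_EFin -poweRM; last 2 first.
- by rewrite lee_fin mulr_ge0 ?powR_ge0.
- by apply: integral_ge0 => x _; rewrite lee_fin powR_ge0.
apply: gt0_ler_poweR.
- by rewrite invr_ge0 ltW.
- by rewrite in_itv/= leey andbT; apply: integral_ge0 => x _; rewrite lee_fin powR_ge0.
- rewrite in_itv/= leey andbT mule_ge0// ?lee_fin ?mulr_ge0 ?powR_ge0//.
  by apply: integral_ge0 => x _; rewrite lee_fin powR_ge0.
rewrite EFinM -muleA.
apply: (@le_trans _ _ ((G^-1 `^ p)%:E * \int[gamma]_x (subordinated_abs w f x `^ p))%E).
  rewrite -ge0_integralZl//; last 3 first.
  - exact: (measurableT_comp (measurable_poweR p) (measurable_subordinated_abs hw mf)).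
  - by move=> x _; exact: poweR_ge0.
  - by rewrite lee_fin powR_ge0.
  apply: ge0_le_integral => //.
  - apply/measurable_EFinP; apply: (measurableT_comp (measurable_powR _)).
    exact: measurableT_comp.
  - apply: emeasurable_funM => //.
    exact: (measurableT_comp (measurable_poweR p) (measurable_subordinated_abs hw mf)).
  move=> x _; rewrite -!poweR_EFin -poweRM; last 2 first.
  - by rewrite lee_fin invr_ge0 ltW.
  - exact: subordinated_abs_ge0.
  apply: gt0_ler_poweR; first exact: ltW.
  - by rewrite in_itv/= leey lee_fin normr_ge0.
  - rewrite in_itv/= leey andbT mule_ge0 ?subordinated_abs_ge0//.
    by rewrite lee_fin invr_ge0 ltW.
  exact: negative_power_op_le.
by rewrite lee_wpmul2l ?lee_fin ?powR_ge0// hC.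
Qed.

Lemma negative_power_op_Lfun p f : 1 < p -> f \in Lfun gamma p%:E ->
  S f \in Lfun gamma p%:E.
Proof.
move=> p1 fp; have [C hC] := negative_power_op_Lp p1.
have := fp => /(Lfun_gammaP _ (ltW p1))[mf _].
apply/andP; split; rewrite inE/=; first exact: measurable_negative_power_op.
apply: le_lt_trans (hC f fp) _.
have : 'N[gamma]_p%:E[EFin \o f]%E \is a fin_num.
  by rewrite ge0_fin_numE ?Lnorm_ge0//; case/andP: fp => _; rewrite inE.
by move=> /fineK <-; rewrite -EFinM ltry.
Qed.

Lemma negative_power_op_weak : exists C : R, forall f,
  f \in Lfun gamma 1%:E ->
  (weak_L1_norm gamma (S f) <= C%:E * 'N[gamma]_1%:E[EFin \o f])%E.
Proof.
have [K K0 hK] := subordinated_weak_bound n_ge1 b0.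
have hw := kernel_weight_power b; have G0 := power_weight_mass_gt0 b0.
exists (K / G) => f /(Lfun_gammaP _ (lexx _))[mf fp].
have mS := measurable_negative_power_op mf.
rewrite Lnorm1; apply: ge_ereal_sup => _ [t /= t0 <-].
have tG : 0 < t * G by rewrite mulr_gt0.
(* |S f| > t forces the majorant above t G. *)
apply: (@le_trans _ _ (t%:E * gamma [set x | (t * G)%:E < subordinated_abs w f x]%E)%E).
  rewrite lee_wpmul2l ?lee_fin ?(ltW t0)//; apply: le_measure; rewrite ?inE.
  - rewrite -[X in measurable X]setTI; apply: measurable_fun_ltr => //.
    exact: measurableT_comp.
  - rewrite -[X in measurable X]setTI; apply: emeasurable_fun_o_infty => //.
    exact: measurable_subordinated_abs.
  move=> x /=; rewrite -lte_fin => tx; have := lt_le_trans tx (negative_power_op_le x mf).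
  by rewrite lte_pdivlMl// -EFinM mulrC.
apply: le_trans (lee_wpmul2l _ (hK f _ mf tG)) _; first by rewrite lee_fin ltW.
rewrite muleA -EFinM le_eqVlt; apply/orP; left; apply/eqP; congr (_%:E * _)%E.
by field; rewrite !gt_eqF.
Qed.

Lemma negative_power_op_weak_L1 f : f \in Lfun gamma 1%:E ->
  weak_L1 gamma (S f).
Proof.
move=> f1; have [C hC] := negative_power_op_weak.
have := f1 => /(Lfun_gammaP _ (lexx _))[mf _].
split; first exact: measurable_negative_power_op.
apply: le_lt_trans (hC f f1) _.
have : 'N[gamma]_1%:E[EFin \o f]%E \is a fin_num.
  by rewrite ge0_fin_numE ?Lnorm_ge0//; case/andP: f1 => _; rewrite inE.
by move=> /fineK <-; rewrite -EFinM ltry.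
Qed.

End negative_power_operator.

(** An infinite integral of [v] has real value 0 by convention, so the inequality covers that case
    too. *)
Lemma abs_Rintegral_le d (T : measurableType d) (R : realType)
    (m : {measure set T -> \bar R}) (v : T -> R) : measurable_fun setT v ->
  (`|\int[m]_t v t|%:E <= \int[m]_t `|v t|%:E)%E.
Proof.
move=> mv; have := @le_abse_integral _ _ _ m setT (EFin \o v) measurableT
  ((measurable_EFinP _ _).2 mv).
have h0 : (0 <= \int[m]_t `|v t|%:E)%E by apply: integral_ge0 => t _; rewrite lee_fin.
by rewrite /Rintegral; case: (integral _ _ (EFin \o v)) => [r| |]//=; rewrite normr0.
Qed.

(** * Pointwise comparison with the Hermite series *)

Section identification.
Context {R : realType} {n : nat}.
Local Notation mu := (@lebesgue_measure R).
Local Notation L := (@lebesgue_measure_tuple R n).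
Local Notation gamma := (inverse_gaussian R n).
Local Notation E y := (expR (sqnorm y)).
Local Notation P := (pi `^ (n%:R / 2) : R).
Implicit Types (f g : euclidean R n -> R) (x : euclidean R n) (k : n.-tuple nat)
  (s : seq (n.-tuple nat)).

Lemma gamma_sqr g : measurable_fun setT g ->
  (\int[gamma]_x (`|g x| `^ 2)%:E = P%:E * \int[L]_x (g x ^+ 2 * E x)%:E)%E.
Proof.
move=> mg; have mE := @measurable_expR_sqnorm1 R n.
rewrite ge0_integral_inverse_gaussian; last 2 first.
- by apply/measurable_EFinP; apply: (measurableT_comp (measurable_powR _));
    exact: measurableT_comp.
- by move=> x; rewrite lee_fin powR_ge0.
rewrite -ge0_integralZl//; last 3 first.
- apply/measurable_EFinP; apply: measurable_funM => //; exact: measurable_funX.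
- by move=> x _; rewrite lee_fin mulr_ge0 ?sqr_ge0 ?expR_ge0.
- by rewrite lee_fin powR_ge0.
apply: eq_integral => x _; rewrite -!EFinM /inverse_gaussian_density.
by rewrite powR_mulrn// real_normK ?num_real//; congr EFin; ring.
Qed.

Lemma Lfun2_in_L2 f : f \in Lfun gamma 2%:E -> in_L2 f.
Proof.
have P0 : 0 < P by rewrite powR_gt0// pi_gt0.
move=> /(Lfun_gammaP _ (ler1n R 2))[mf]; rewrite gamma_sqr// => fy; split=> //.
apply/integrableP; split.
  by apply/measurable_EFinP; apply: measurable_funM; [exact: measurable_funX|
    exact: measurable_expR_sqnorm1].
have -> : (\int[L]_x `|(f x ^+ 2 * E x)%:E| = \int[L]_x (f x ^+ 2 * E x)%:E)%E.
  by apply: eq_integral => x _; rewrite gee0_abs// lee_fin mulr_ge0 ?sqr_ge0 ?expR_ge0.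
rewrite ltey; apply: contraTN fy => /eqP ->.
by rewrite gt0_muley// lte_fin.
Qed.

(** The squared norm of the Hermite function contains the same factor pi^{n/2} as the definition of
    the coefficient, and the two cancel. *)
Lemma hermite_coefE k f :
  hermite_coef k f = form f (hermite_tilde k) / hermite_sqnorm k.
Proof.
have P0 : 0 < P by rewrite powR_gt0// pi_gt0.
have h0 := @hermite_sqnorm_gt0 R n k.
have h2 : ('N[gamma]_2%:E[EFin \o hermite_tilde k] `^ 2 = (P * hermite_sqnorm k)%:E)%E.
  rewrite powR_Lnorm ?pnatr_eq0// EFinM.
  have <- : (\int[L]_y (hermite_tilde k y ^+ 2 * E y)%:E = (hermite_sqnorm k)%:E)%E.
    have := @form_hermite R n k k; rewrite eqxx => <-.
    by rewrite -formE; [apply: eq_integral => y _; rewrite expr2|exact: in_L2_hermite..].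
  by rewrite -gamma_sqr//; exact: measurable_hermite_tilde.
have := Lnorm_ge0 gamma 2%:E (EFin \o hermite_tilde k).
rewrite /hermite_coef; case: Lnorm h2 => [v| |]//; first last.
  by rewrite poweRyr ?pnatr_eq0.
  rewrite poweR_EFin /= => -[] +; rewrite lee_fin => + v0; rewrite powR_mulrn// => ->.
  rewrite /form; field; by rewrite !gt_eqF.
Qed.

Variable b : R.
Hypothesis b0 : 0 < b.
Hypothesis n_ge1 : (1 <= n)%N.
Local Notation w := (power_weight b).
Local Notation G := (power_weight_mass b).
Local Notation S := (negative_power_op b).

Lemma mehler_integrable f r x : 0 < r < 1 -> in_L2 f ->
  L.-integrable setT (fun y => (mehler r x y * f y)%:E).
Proof.
move=> r01 hf; have := in_L2_mul (in_L2_symmetric_kernel x r01) hf.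
apply: eq_integrable => // y _; rewrite /symmetric_kernel; congr EFin.
have e := @expRxMexpNx_1 R (sqnorm y).
transitivity (mehler r x y * f y * (E y * expR (- sqnorm y))); first by ring.
by rewrite e mulr1.
Qed.

(** Absolute convergence at [x] permits Fubini's theorem; the inner integral in [y] is then the
    semigroup at time t. *)
Lemma subordinated_op_fubini f x : in_L2 f -> (subordinated_abs w f x < +oo)%E ->
  mu.-integrable setT (fun t : R => (w t * mehler_op (expR (- t)) f x)%:E) /\
  subordinated_op w f x = \int[mu]_t (w t * mehler_op (expR (- t)) f x).
Proof.
move=> hf fx; have [mf _] := hf.
have i := integrable_subordinated_kernel (kernel_weight_power b) mf fx.
have e : fubini_F L (fun z => (subordinated_kernel w x z * f z.2)%:E) =
    (fun t : R => (w t * mehler_op (expR (- t)) f x)%:E).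
  apply/funext => t; rewrite /fubini_F /subordinated_kernel /=.
  have [t0|t0] := leP t 0.
    have -> : w t = 0 by rewrite /power_weight ltNge t0.
    by under eq_integral do rewrite !mul0r; rewrite integral0 mul0r.
  have i' := mehler_integrable x (expRN_itv t0) hf.
  under eq_integral do rewrite -mulrA EFinM.
  rewrite integralZl// EFinM; congr (_ * _)%E.
  by rewrite /mehler_op /Rintegral fineK// (integrable_fin_num measurableT i').
split; first by rewrite -e; exact: integrable_fubini_F.
rewrite /subordinated_op /Rintegral -[in RHS]e; congr fine.
by rewrite (@integral12_prod_meas1 _ _ _ _ _ mu L).
Qed.

Lemma power_weight_eigenvalue k :
  mu.-integrable setT (fun t : R => (w t * expR (- t) ^+ eigenvalue_index k)%:E) /\
  \int[mu]_t (w t * expR (- t) ^+ eigenvalue_index k) =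
    G / (eigenvalue_index k)%:R `^ b.
Proof.
(* n >= 1 makes the eigenvalue positive even at index 0. *)
have l0 : (0 : R) < (eigenvalue_index k)%:R.
  by rewrite ltr0n addn_gt0 n_ge1 orbT.
have e : (fun t : R => (w t * expR (- t) ^+ eigenvalue_index k)%:E) =
    (fun t : R => (w t * expR (- ((eigenvalue_index k)%:R * t)))%:E).
  by apply/funext => t; rewrite -expRM_natl mulrN.
have I : (\int[mu]_t (w t * expR (- t) ^+ eigenvalue_index k)%:E =
    (G / (eigenvalue_index k)%:R `^ b)%:E)%E by rewrite e power_weight_laplace.
split; last by rewrite /Rintegral I.
apply/integrableP; split.
  apply/measurable_EFinP; apply: measurable_funM.
    exact: measurable_power_weight.
  apply: measurable_funX; exact: (@measurable_expRN R _ _ id (@measurable_id _ _ _)).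
rewrite (_ : integral _ _ _ = (G / (eigenvalue_index k)%:R `^ b)%:E) ?ltry// -I.
apply: eq_integral => t _.
by rewrite gee0_abs// lee_fin mulr_ge0 ?power_weight_ge0 ?exprn_ge0 ?expR_ge0.
Qed.

(** (|k| + n)^{-b} is itself the Gamma average of r^{|k| + n}, so the partial sum moves under the
    integral in t and only the remainder of the semigroup is averaged. *)
Lemma negative_power_remainder f (K : {fset n.-tuple nat}) x :
  in_L2 f -> (subordinated_abs w f x < +oo)%E ->
  S f x - negative_power_sum b f K x =
  G^-1 * \int[mu]_t (w t * semigroup_remainder (expR (- t)) f K x).
Proof.
move=> hf fx; have [i Se] := subordinated_op_fubini hf fx.
rewrite /negative_power_op Se.
have G0 := power_weight_mass_gt0 b0.
pose c k := form f (hermite_tilde k) / hermite_sqnorm k * hermite_tilde k x.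
have ik k := integrableZl measurableT (c k) (power_weight_eigenvalue k).1.
have iS : mu.-integrable setT (fun t : R => (\sum_(k <- K)
    (c k)%:E * (w t * expR (- t) ^+ eigenvalue_index k)%:E)%E).
  by apply: (integrable_sum measurableT) => k _; exact: ik.
have -> : \int[mu]_t (w t * semigroup_remainder (expR (- t)) f K x) =
    \int[mu]_t (w t * mehler_op (expR (- t)) f x -
      \sum_(k <- K) c k * (w t * expR (- t) ^+ eigenvalue_index k)).
  apply: eq_Rintegral => t _; rewrite /semigroup_remainder mulrBr mulr_sumr.
  by congr (_ - _); apply: eq_bigr => k _; rewrite /c; ring.
rewrite RintegralB//; last first.
  by apply: eq_integrable iS => // t _; rewrite /= -sumEFin.
rewrite mulrBr; congr (_ - _).
have -> : \int[mu]_t (\sum_(k <- K) c k * (w t * expR (- t) ^+ eigenvalue_index k)) =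
    \sum_(k <- K) c k * (G / (eigenvalue_index k)%:R `^ b).
  rewrite /Rintegral.
  have -> : (\int[mu]_t (\sum_(k <- K) c k * (w t * expR (- t) ^+ eigenvalue_index k))%:E =
      \int[mu]_t (\sum_(k <- K) (c k)%:E * (w t * expR (- t) ^+ eigenvalue_index k)%:E)%E)%E.
    by apply: eq_integral => t _; rewrite -sumEFin.
  rewrite integral_sum//.
  rewrite (eq_bigr (fun k => (c k * (G / (eigenvalue_index k)%:R `^ b))%:E)).
    by rewrite sumEFin.
  move=> k _; have [i' <-] := power_weight_eigenvalue k.
  rewrite integralZl// [in RHS]EFinM /Rintegral fineK//.
  exact: (integrable_fin_num measurableT i').
rewrite mulr_sumr /negative_power_sum; apply: eq_bigr => k _.
rewrite /negative_power_term hermite_coefE /c -/(eigenvalue_index k).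
have l0 : (0 : R) < (eigenvalue_index k)%:R `^ b.
  by rewrite powR_gt0// ltr0n addn_gt0 n_ge1 orbT.
have h0 := @hermite_sqnorm_gt0 R n k.
by field; rewrite !gt_eqF.
Qed.

(** Cauchy-Schwarz in t. The weight alone has infinite mass, so it is multiplied by e^{-t/2}, which
    gives the mass G 2^b; the compensating e^{t/2} stays with the squared remainder. *)
Lemma negative_power_remainder_sqr f (K : {fset n.-tuple nat}) x :
  in_L2 f -> (subordinated_abs w f x < +oo)%E ->
  (((negative_power_sum b f K x - S f x) ^+ 2)%:E <=
   (G^-1 ^+ 2 * (G / 2^-1 `^ b))%:E *
   \int[mu]_t (w t * expR (t / 2) * semigroup_remainder (expR (- t)) f K x ^+ 2)%:E)%E.
Proof.
move=> hf fx; have [mf _] := hf; have G0 := power_weight_mass_gt0 b0.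
pose u (t : R) := semigroup_remainder (expR (- t)) f K x.
have mu_ : measurable_fun (setT : set (measurableTypeR R)) u.
  apply: (@measurable_semigroup_remainder _ _ _ _ (fun t : measurableTypeR R => expR (- t))
    (fun=> x)) => //.
  exact: (@measurable_expRN R _ _ id (@measurable_id _ _ _)).
have mexp (c : R) : measurable_fun (setT : set (measurableTypeR R)) (fun t : R => expR (c * t)).
  by apply: measurableT_comp => //; exact: measurable_funM.
have mw := @measurable_power_weight R b.
pose k (t : R) := w t * expR (- (2^-1 * t)).
pose h (t : R) := `|u t| * expR (2^-1 * t).
have k0 t : 0 <= k t by rewrite mulr_ge0 ?power_weight_ge0 ?expR_ge0.
have h0 t : 0 <= h t by rewrite mulr_ge0 ?expR_ge0.
have mk : measurable_fun (setT : set (measurableTypeR R)) k.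
  apply: measurable_funM => //.
  by under eq_fun do rewrite -mulNr; exact: mexp.
have mh : measurable_fun (setT : set (measurableTypeR R)) h.
  by apply: measurable_funM => //; exact: measurableT_comp.
have kh t : k t * h t = `|w t * u t|.
  have e := @expRxMexpNx_1 R (2^-1 * t).
  rewrite normrM (ger0_norm (power_weight_ge0 b t)) /k /h.
  transitivity (w t * `|u t| * (expR (2^-1 * t) * expR (- (2^-1 * t)))); first by ring.
  by rewrite e mulr1.
have kh2 t : k t * h t `^ 2 = w t * expR (t / 2) * u t ^+ 2.
  have e := @expRxMexpNx_1 R (2^-1 * t).
  rewrite powR_mulrn// /k /h exprMn real_normK ?num_real//.
  transitivity (w t * expR (2^-1 * t) * u t ^+ 2 *
    (expR (2^-1 * t) * expR (- (2^-1 * t)))); first by ring.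
  by rewrite e mulr1 [2^-1 * t]mulrC.
have cs := @ge0_powR_integral_le _ _ _ mu k h 2 (ltr1n R 2) mk mh k0 h0.
have e1 : (\int[mu]_t (k t)%:E = (G / 2^-1 `^ b)%:E)%E.
  by rewrite /k power_weight_laplace.
rewrite (_ : 2 - 1 = 1 :> R) in cs; last by ring.
rewrite e1 poweRe1 in cs; last first.
  by rewrite lee_fin divr_ge0 ?powR_ge0// ltW.
rewrite -[_ - S f x]opprB sqrrN negative_power_remainder// exprMn EFinM.
rewrite [X in (_ <= X * _)%E]EFinM -muleA lee_wpmul2l ?lee_fin ?sqr_ge0//.
have <- : (\int[mu]_t (k t * h t `^ 2)%:E =
    \int[mu]_t (w t * expR (t / 2) * semigroup_remainder (expR (- t)) f K x ^+ 2)%:E)%E.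
  by apply: eq_integral => t _; rewrite kh2.
apply: le_trans cs.
have := @abs_Rintegral_le _ _ _ mu (fun t => w t * u t) (measurable_funM mw mu_).
have <- : (\int[mu]_t (k t * h t)%:E = \int[mu]_t `|w t * u t|%:E)%E.
  by apply: eq_integral => t _; rewrite kh.
move=> hI.
have <- : (`|\int[mu]_t (w t * u t)|%:E `^ 2 = ((\int[mu]_t (w t * u t)) ^+ 2)%:E)%E.
  by rewrite poweR_EFin powR_mulrn// real_normK ?num_real.
apply: gt0_ler_poweR hI => //.
- by rewrite in_itv/= leey lee_fin normr_ge0.
- rewrite in_itv/= leey andbT; apply: integral_ge0 => t _.
  by rewrite lee_fin mulr_ge0.
Qed.

End identification.

(** * Convergence of the Hermite series in L^2 *)

Section convergence.
Context {R : realType} {n : nat}.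
Local Notation mu := (@lebesgue_measure R).
Local Notation L := (@lebesgue_measure_tuple R n).
Local Notation gamma := (inverse_gaussian R n).
Local Notation E y := (expR (sqnorm y)).
Local Notation P := (pi `^ (n%:R / 2) : R).
Variables (n_ge1 : (1 <= n)%N) (b : R) (b0 : 0 < b).
Local Notation w := (power_weight b).
Local Notation G := (power_weight_mass b).
Local Notation S := (negative_power_op b).
Implicit Types (f : euclidean R n -> R) (K : {fset n.-tuple nat}).

Lemma measurable_remainder_density f K : measurable_fun setT f ->
  measurable_fun setT (fun u : euclidean R n * measurableTypeR R =>
    w u.2 * expR ((u.2 : R) / 2) * semigroup_remainder (expR (- (u.2 : R))) f K u.1 ^+ 2).
Proof.
move=> mf; have mw := @measurable_power_weight R b.
have me : measurable_fun (setT : set (measurableTypeR R)) (fun t : R => expR (t / 2)).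
  by apply: measurableT_comp => //; exact: measurable_funM.
apply: measurable_funM.
  apply: measurable_funM; first exact: (measurableT_comp mw measurable_snd).
  exact: (measurableT_comp me measurable_snd).
apply: measurable_funX.
apply: (@measurable_semigroup_remainder _ _ _ _
  (fun u : euclidean R n * measurableTypeR R => expR (- (u.2 : R))) fst) => //.
exact: (@measurable_expRN R _ _ snd measurable_snd).
Qed.

(** After Tonelli, [integral_semigroup_remainder_le] bounds the integral in [x] at each t > 0, and
    what remains in t is [tail_density]. *)
Lemma integral_remainder_density f K : in_L2 f ->
  (\int[gamma]_x \int[mu]_t
     (w t * expR (t / 2) * semigroup_remainder (expR (- t)) f K x ^+ 2)%:E <=
   (P * form f f * tail_mass b K)%:E)%E.
Proof.
move=> hf; have [mf _] := hf.
have m := measurable_remainder_density K mf.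
pose W x (t : R) := w t * expR (t / 2) * semigroup_remainder (expR (- t)) f K x ^+ 2.
have W0 x t : 0 <= W x t.
  by rewrite mulr_ge0 ?sqr_ge0// mulr_ge0 ?power_weight_ge0 ?expR_ge0.
have I0 x : (0 <= \int[mu]_t (W x t)%:E)%E.
  by apply: integral_ge0 => t _; rewrite lee_fin.
have mW x : measurable_fun (setT : set (measurableTypeR R)) (fun t : R => (W x t)%:E).
  by apply/measurable_EFinP; exact: (measurableT_comp m (pair1_measurable x)).
have mI : measurable_fun setT (fun x : euclidean R n => \int[mu]_t (W x t)%:E)%E.
  by apply: (@measurable_integral_param _ _ _ _ _ mu
    (fun (x : euclidean R n) (t : measurableTypeR R) => (W x t)%:E)); apply/measurable_EFinP.
rewrite ge0_integral_inverse_gaussian//.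
have -> : (\int[L]_x ((\int[mu]_t (W x t)%:E) * (inverse_gaussian_density x)%:E) =
    \int[L]_x \int[mu]_t (W x t * inverse_gaussian_density x)%:E)%E.
  apply: eq_integral => x _; rewrite -ge0_integralZr//.
    by move=> t _; rewrite lee_fin.
  by rewrite lee_fin inverse_gaussian_density_ge0.
have mD := @measurable_inverse_gaussian_density R n.
rewrite (@ge0_integral_swap _ _ _ _ _ L mu
  (fun (x : euclidean R n) (t : measurableTypeR R) =>
     (W x t * inverse_gaussian_density x)%:E)); last 2 first.
- apply/measurable_EFinP; apply: measurable_funM => //.
  exact: (measurableT_comp mD measurable_fst).
- by move=> x t; rewrite lee_fin mulr_ge0// inverse_gaussian_density_ge0.
have uK := fset_uniq K.
rewrite EFinM -tail_massE// -ge0_integralZl//; last 3 first.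
- by apply/measurable_EFinP; exact: measurable_tail_density.
- by move=> t _; rewrite lee_fin tail_density_ge0.
- by rewrite lee_fin mulr_ge0 ?powR_ge0 ?form_ge0.
apply: ge0_le_integral => //.
- by move=> t _; apply: integral_ge0 => x _;
    rewrite lee_fin mulr_ge0// inverse_gaussian_density_ge0.
- apply: (@measurable_integral_param _ _ _ _ _ L
    (fun (t : measurableTypeR R) (x : euclidean R n) =>
      (W x t * inverse_gaussian_density x)%:E)).
  apply/measurable_EFinP; apply: measurable_funM.
    exact: (measurableT_comp m (measurable_fun_pair measurable_snd measurable_fst)).
  exact: (measurableT_comp mD measurable_snd).
- apply: emeasurable_funM => //.
  by apply/measurable_EFinP; exact: measurable_tail_density.
move=> t _; have [t0|t0] := leP t 0.
  rewrite /W /tail_density /power_weight ltNge t0/=.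
  under eq_integral do rewrite !mul0r.
  by rewrite integral0 !mul0r mule0.
have r01 := expRN_itv t0.
have h := integral_semigroup_remainder_le r01 hf uK.
pose c := w t * expR (t / 2) * P.
have c0 : 0 <= c by rewrite !mulr_ge0 ?power_weight_ge0 ?expR_ge0 ?powR_ge0.
have -> : (\int[L]_x (W x t * inverse_gaussian_density x)%:E =
    \int[L]_x (c%:E * (semigroup_remainder (expR (- t)) f K x ^+ 2 * E x)%:E))%E.
  apply: eq_integral => x _; rewrite -EFinM; congr EFin.
  by rewrite /W /c /inverse_gaussian_density; ring.
rewrite ge0_integralZl//; last 2 first.
- apply/measurable_EFinP; apply: measurable_funM; last exact: measurable_expR_sqnorm1.
  by apply: measurable_funX; exact: (@measurable_semigroup_remainder _ _ _ _ (fun=> expR (- t)) id).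
- by move=> x _; rewrite lee_fin mulr_ge0 ?sqr_ge0 ?expR_ge0.
apply: le_trans (lee_wpmul2l _ h) _; first by rewrite lee_fin.
by rewrite -!EFinM lee_fin le_eqVlt /c /tail_density; apply/orP; left; apply/eqP; ring.
Qed.

Lemma negative_power_sum_Lnorm f K : f \in Lfun gamma 2%:E ->
  ('N[gamma]_2%:E[EFin \o (negative_power_sum b f K \- S f)%R] <=
   (Num.sqrt (G^-1 ^+ 2 * (G / 2^-1 `^ b) * (P * form f f) * tail_mass b K))%:E)%E.
Proof.
move=> f2; have hf := Lfun2_in_L2 f2; have [mf _] := hf.
have G0 := power_weight_mass_gt0 b0.
have c0 : 0 <= G^-1 ^+ 2 * (G / 2^-1 `^ b).
  by rewrite mulr_ge0 ?sqr_ge0// divr_ge0 ?powR_ge0// ltW.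
have uK := fset_uniq K.
have mg : measurable_fun setT (negative_power_sum b f K \- S f).
  apply: measurable_funB; last exact: measurable_negative_power_op.
  apply: measurable_sum => k; apply: measurable_funM => //.
  exact: measurable_hermite_tilde.
have m := measurable_remainder_density K mf.
rewrite Lnorm_gammaE -powR12_sqrt; last first.
  by rewrite mulr_ge0 ?tail_mass_ge0// mulr_ge0// mulr_ge0 ?powR_ge0 ?form_ge0.
rewrite -poweR_EFin; apply: gt0_ler_poweR => //.
- by rewrite in_itv/= leey andbT; apply: integral_ge0 => x _; rewrite lee_fin powR_ge0.
- rewrite in_itv/= leey andbT lee_fin.
  by rewrite mulr_ge0 ?tail_mass_ge0// mulr_ge0// mulr_ge0 ?powR_ge0 ?form_ge0.
rewrite -mulrA EFinM.
apply: le_trans (lee_wpmul2l _ (integral_remainder_density K hf)); last by rewrite lee_fin.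
have W0 x (t : R) :
    (0 <= (w t * expR (t / 2) * semigroup_remainder (expR (- t)) f K x ^+ 2)%:E)%E.
  by rewrite lee_fin mulr_ge0 ?sqr_ge0// mulr_ge0 ?power_weight_ge0 ?expR_ge0.
have mI : measurable_fun setT (fun x : euclidean R n => \int[mu]_t
    (w t * expR (t / 2) * semigroup_remainder (expR (- t)) f K x ^+ 2)%:E)%E.
  by apply: (@measurable_integral_param _ _ _ _ _ mu
    (fun (x : euclidean R n) (t : measurableTypeR R) =>
      (w t * expR (t / 2) * semigroup_remainder (expR (- t)) f K x ^+ 2)%:E));
    apply/measurable_EFinP.
rewrite -ge0_integralZl//; last first.
  by move=> x _; apply: integral_ge0.
(* The pointwise bound is available only where the absolute integral is finite, so the comparison is
   almost everywhere. *)
apply: ae_ge0_le_integral => //.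
- apply/measurable_EFinP; apply: (measurableT_comp (measurable_powR _)).
  exact: measurableT_comp.
- by move=> x _; rewrite mule_ge0 ?lee_fin//; apply: integral_ge0.
- exact: emeasurable_funM.
apply: filterS (subordinated_abs_fin_ae n_ge1 b0 (ler1n R 2) f2) => x fx _.
by rewrite powR_mulrn// real_normK ?num_real// negative_power_remainder_sqr.
Qed.

Lemma negative_power_op_is_negative_power f : f \in Lfun gamma 2%:E ->
  is_negative_power b f (S f).
Proof.
move=> f2; split.
  exact: (negative_power_op_Lfun n_ge1 b0 (ltr1n R 2)).
pose c := G^-1 ^+ 2 * (G / 2^-1 `^ b) * (P * form f f).
apply: (@squeeze_cvge _ _ _ _ (cst 0%E) _
  (fun K => (Num.sqrt (c * tail_mass b K))%:E)).
- apply: nearW => K; rewrite Lnorm_ge0/=; exact: negative_power_sum_Lnorm.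
- exact: cvg_cst.
apply: cvg_EFin; first exact: nearW.
have h : (fun K => c * tail_mass b K) @ totally --> 0.
  suff : (fun K => c * tail_mass b K) @ totally --> c * 0 by rewrite mulr0.
  by apply: cvgM; [exact: cvg_cst|exact: tail_mass_cvg].
have := cvg_comp _ _ h (@sqrt_continuous R 0).
by rewrite sqrtr0.
Qed.

End convergence.

Theorem proposition2p1 (R : realType) (n : nat) (beta : R)
    (n_ge1 : (1 <= n)%N) (beta_gt0 : 0 < beta) :
  (forall p : R, 1 < p ->
    exists S : (euclidean R n -> R) -> (euclidean R n -> R),
      bounded_linear_operator (inverse_gaussian R n)
        [set f | f \in Lfun (inverse_gaussian R n) p%:E]
        (fun f => 'N[inverse_gaussian R n]_p%:E[EFin \o f]%E)
        [set f | f \in Lfun (inverse_gaussian R n) p%:E]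
        (fun f => 'N[inverse_gaussian R n]_p%:E[EFin \o f]%E)
        S /\
      forall f, f \in Lfun (inverse_gaussian R n) p%:E ->
        f \in Lfun (inverse_gaussian R n) 2%:E ->
        is_negative_power beta f (S f)) /\
  (exists S : (euclidean R n -> R) -> (euclidean R n -> R),
      bounded_linear_operator (inverse_gaussian R n)
        [set f | f \in Lfun (inverse_gaussian R n) 1%:E]
        (fun f => 'N[inverse_gaussian R n]_1%:E[EFin \o f]%E)
        (weak_L1 (inverse_gaussian R n))
        (weak_L1_norm (inverse_gaussian R n))
        S /\
      forall f, f \in Lfun (inverse_gaussian R n) 1%:E ->
        f \in Lfun (inverse_gaussian R n) 2%:E ->
        is_negative_power beta f (S f)).
Proof.
have lin (p : R) (a : R) f g : 1 <= p ->
    f \in Lfun (inverse_gaussian R n) p%:E -> g \in Lfun (inverse_gaussian R n) p%:E ->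
    negative_power_op beta (fun x => a * f x + g x) =
    (fun x => a * negative_power_op beta f x + negative_power_op beta g x)
      %[ae inverse_gaussian R n].
  move=> p1 fp gp; have /(Lfun_gammaP _ p1)[mf _] := fp.
  have /(Lfun_gammaP _ p1)[mg _] := gp.
  apply: negative_power_op_linear_ae => //; exact: (subordinated_abs_fin_ae n_ge1 _ p1).
(* One and the same operator is the extension for every p. *)
split=> [p p1|]; exists (negative_power_op beta); split; last 1 first.
- by move=> f _; exact: negative_power_op_is_negative_power.
- split; last exact: negative_power_op_Lp.
    by move=> f; exact: negative_power_op_Lfun.
  by move=> a f g; exact: (lin p _ _ _ (ltW p1)).
- by move=> f _; exact: negative_power_op_is_negative_power.
- split; last exact: negative_power_op_weak.
    by move=> f; exact: negative_power_op_weak_L1.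
  by move=> a f g; exact: (lin 1).
Qed.
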